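(* Let $r>1$ be a natural number, let $d\ge1$, and let $A\subseteq[0,1]^d$ be an $r$-regular set such that $d_H(\overline{\pi_i(A)})<1$ for all $i\in\{1,\dots,d\}$. Let $\mathcal{R}_A=(\mathbb{R},<,+,0,1,A)$. The following are equivalent: (1) $A$ is $r$-sparse; (2) $d_H(\overline{\pi_i(A)})=0$ for all $i\in\{1,\dots,d\}$; (3) $\mathcal{R}_A$ is d-minimal; (4) the theory of $\mathcal{R}_A$ has NIP; (5) the theory of $\mathcal{R}_A$ has NTP$_2$.
   Context: Write $[r]=\{0,\dots,r-1\}$. A Büchi automaton over a finite alphabet $\Sigma$ is a finite automaton (finite set of states, initial state, transitions, set of accept states) reading infinite words in $\Sigma^\omega$; it accepts a word $w$ if some run on $w$ visits accept states infinitely often. A language $L\subseteq\Sigma^\omega$ is regular if it is the set of words accepted by some Büchi automaton. For $w=w_0w_1\cdots\in[r]^\omega$ put $\nu_r(w)=\sum_{i\ge0} w_i r^{-(i+1)}\in[0,1]$; extend $\nu_r$ coordinatewise to $\nu_r:([r]^m)^\omega\to[0,1]^m$. A set $X\subseteq[0,1]^m$ is $r$-regular if $X=\nu_r(L)$ for some regular $L\subseteq([r]^m)^\omega$. A language $L\subseteq([r]^m)^\omega$ is sparse if it is regular and the number of distinct length-$n$ prefixes of elements of $L$ grows at most polynomially in $n$; a set $X\subseteq[0,1]^m$ is $r$-sparse if $X=\nu_r(L)$ for some sparse $L$. The map $\pi_i:\mathbb{R}^d\to\mathbb{R}$ is projection onto the $i$-th coordinate, $\overline{\,\cdot\,}$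 is topological closure, and $d_H$ is Hausdorff dimension. In $\mathcal{R}_A$ the set $A$ is named by a $d$-ary predicate. A set $X\subseteq\mathbb{R}$ is discrete if for every $x\in X$ there is an open interval $I$ with $X\cap I=\{x\}$. A structure expanding $(\mathbb{R},<)$ is d-minimal if for every $m$ and every definable $(m+1)$-ary set $B$ there is $N\in\mathbb{N}$ such that for each $m$-tuple $x$ the fiber $\{t:(x,t)\in B\}$ either has interior or is a union of at most $N$ discrete sets. NIP is ''not the independence property'' and NTP$_2$ is ''not the tree property of the second kind'', in the standard model-theoretic sense. *)

(* Defs.v *)
From HB Require Import structures.
From mathcomp Require Import all_boot all_order all_algebra.
From mathcomp Require Import all_classical all_reals all_analysis.
Set Implicit Arguments.
Unset Strict Implicit.
Unset Printing Implicit Defensive.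
Import Order.TTheory GRing.Theory Num.Theory numFieldNormedType.Exports.
Local Open Scope classical_set_scope.
Local Open Scope ring_scope.

(** * Omega-languages and Buchi automata *)

Definition word (Sigma : Type) := nat -> Sigma.

(* Nondeterministic: [trans q a q'] says that q' is a possible successor of q. *)
Record buchi (Sigma : finType) := Buchi {
  state : finType;
  init : state;
  trans : state -> Sigma -> pred state;
  accept : {set state} }.

Definition is_run (Sigma : finType) (B : buchi Sigma) (w : word Sigma)
    (rho : nat -> state B) : Prop :=
  rho 0%N = init B /\ forall n, trans (rho n) (w n) (rho n.+1).

Definition buchi_language (Sigma : finType) (B : buchi Sigma) :
    set (word Sigma) :=
  [set w | exists rho : nat -> state B, is_run w rho /\
     forall n, exists2 k, (n <= k)%N & rho k \in accept B].

Definition regular_language (Sigma : finType) (L : set (word Sigma)) : Prop :=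
  exists B : buchi Sigma, L = buchi_language B.

Definition prefixes (Sigma : finType) (L : set (word Sigma)) (n : nat) :
    {set n.-tuple Sigma} :=
  [set t | `[< exists2 w, L w & forall i : 'I_n, tnth t i = w i >]].

(* [n.+1] rather than [n] because a nonempty language has one prefix of
   length 0. *)
Definition sparse_language (Sigma : finType) (L : set (word Sigma)) : Prop :=
  regular_language L /\
  exists c k : nat, forall n, (#|prefixes L n| <= c * n.+1 ^ k)%N.

(** * Sets of points represented by omega-languages *)

Definition digits (r m : nat) : finType := {ffun 'I_m -> 'I_r}.

Definition nu (R : realType) (r : nat) (w : word 'I_r) : R :=
  limn (series (fun i : nat => (w i)%:R * r%:R ^- i.+1 : R)).

Definition nu_vec (R : realType) (r m : nat) (w : word (digits r m)) :
    'rV[R]_m :=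
  \row_(j < m) nu R (fun i => w i j).

Definition regular_set (R : realType) (r m : nat) (X : set 'rV[R]_m) : Prop :=
  exists2 L : set (word (digits r m)),
    regular_language L & X = @nu_vec R r m @` L.

Definition sparse_set (R : realType) (r m : nat) (X : set 'rV[R]_m) : Prop :=
  exists2 L : set (word (digits r m)),
    sparse_language L & X = @nu_vec R r m @` L.

Definition coord_proj (R : realType) (d : nat) (i : 'I_d) (X : set 'rV[R]_d) :
    set R :=
  [set x ord0 i | x in X].

(** * Hausdorff dimension of subsets of the line *)

Section Hausdorff.
Local Open Scope ereal_scope.
Variable R : realType.
Implicit Types (U X : set R) (s delta : R).

(* The point 0 is added so that the empty set has diameter 0. *)
Definition diameter U : \bar R :=
  ereal_sup ([set 0] `|`
    [set z : \bar R | exists x y, [/\ U x, U y & z = `|x - y|%:E]]).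

(* For s = 0 this is 0 if U is empty and 1 otherwise, so that the
   0-dimensional Hausdorff measure is the counting measure. *)
Definition diameter_pow s U : \bar R :=
  if U == set0 then 0 else diameter U `^ s.

Definition hausdorff_premeasure s delta X : \bar R :=
  ereal_inf [set v : \bar R | exists U : nat -> set R,
    [/\ X `<=` \bigcup_n U n,
        forall n, diameter (U n) <= delta%:E &
        v = \sum_(0 <= n <oo) diameter_pow s (U n)]].

Definition hausdorff_measure s X : \bar R :=
  ereal_sup [set hausdorff_premeasure s delta X |
    delta in [set e : R | (0 < e)%R]].

Definition hausdorff_dim X : \bar R :=
  ereal_inf [set s%:E |
    s in [set s : R | (0 <= s)%R /\ hausdorff_measure s X = 0]].

End Hausdorff.

(** * First-order logic *)

Record language := Language {
  funsym : Type;
  fun_arity : funsym -> nat;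
  relsym : Type;
  rel_arity : relsym -> nat }.

Inductive term (L : language) (n : nat) : Type :=
| Var of 'I_n
| App (f : funsym L) of ('I_(fun_arity f) -> term L n).

(* Formulas whose free variables are among x_0, ..., x_(n-1); [Forall]
   binds x_n. The other connectives are classically definable from these. *)
Inductive formula (L : language) (n : nat) : Type :=
| Bot
| Equal of term L n & term L n
| Rel (p : relsym L) of ('I_(rel_arity p) -> term L n)
| Imp of formula L n & formula L n
| Forall of formula L (n + 1).

Definition sentence (L : language) := formula L 0.

Record structure (L : language) (M : Type) := Structure {
  fun_interp : forall f : funsym L, ('I_(fun_arity f) -> M) -> M;
  rel_interp : forall p : relsym L, ('I_(rel_arity p) -> M) -> Prop }.

Definition fcat (M : Type) (m n : nat) (x : 'I_m -> M) (y : 'I_n -> M)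
    (i : 'I_(m + n)) : M :=
  match fintype.split i with inl j => x j | inr k => y k end.

Section Semantics.
Variables (L : language) (M : Type) (S : structure L M).

Fixpoint eval (n : nat) (v : 'I_n -> M) (t : term L n) : M :=
  match t with
  | Var i => v i
  | App f ts => fun_interp S (fun k => eval v (ts k))
  end.

Fixpoint sat (n : nat) (phi : formula L n) : ('I_n -> M) -> Prop :=
  match phi with
  | Bot => fun _ => False
  | Equal t u => fun v => eval v t = eval v u
  | Rel p ts => fun v => rel_interp S (fun k => eval v (ts k))
  | Imp f g => fun v => sat f v -> sat g v
  | Forall f => fun v => forall a : M, sat f (fcat v (fun _ : 'I_1 => a))
  end.

Definition theory_of : set (sentence L) :=
  [set phi | sat phi (tnth [tuple])].

Definition is_model (T : set (sentence L)) : Prop := T `<=` theory_of.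

(* Definable with parameters (the tuple c). *)
Definition definable (n : nat) (B : set ('I_n -> M)) : Prop :=
  exists (p : nat) (phi : formula L (n + p)) (c : 'I_p -> M),
    B = [set x | sat phi (fcat x c)].

End Semantics.

(** * The independence property and the tree property of the second kind *)

Definition has_IP (L : language) (T : set (sentence L)) (m n : nat)
    (phi : formula L (m + n)) : Prop :=
  exists (M : Type) (S : structure L M), is_model S T /\
  exists (a : nat -> 'I_m -> M) (b : set nat -> 'I_n -> M),
    forall i J, sat S phi (fcat (a i) (b J)) <-> J i.

Definition NIP (L : language) (T : set (sentence L)) : Prop :=
  forall (m n : nat) (phi : formula L (m + n)), ~ has_IP T phi.

(* Each row (phi(x, b_ij))_j is 2-inconsistent and each path
   (phi(x, b_(i, f i)))_i is consistent, i.e. finitely satisfiable in M. *)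
Definition has_TP2 (L : language) (T : set (sentence L)) (m n : nat)
    (phi : formula L (m + n)) : Prop :=
  exists (M : Type) (S : structure L M), is_model S T /\
  exists b : nat -> nat -> 'I_n -> M,
    (forall i j k, j <> k -> ~ exists a : 'I_m -> M,
       sat S phi (fcat a (b i j)) /\ sat S phi (fcat a (b i k))) /\
    (forall (f : nat -> nat) (N : nat), exists a : 'I_m -> M,
       forall i, (i < N)%N -> sat S phi (fcat a (b i (f i)))).

Definition NTP2 (L : language) (T : set (sentence L)) : Prop :=
  forall (m n : nat) (phi : formula L (m + n)), ~ has_TP2 T phi.

(** * d-minimality *)

Definition discrete_set (R : realType) (X : set R) : Prop :=
  forall x, X x -> exists a b : R, X `&` [set` `]a, b[%R] = [set x].

Definition d_minimal (R : realType) (L : language) (S : structure L R) : Prop :=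
  forall (m : nat) (B : set ('I_(m + 1) -> R)), definable S B ->
  exists N : nat, forall x : 'I_m -> R,
    let fiber := [set t : R | B (fcat x (fun _ : 'I_1 => t))] in
    interior fiber !=set0 \/
    exists D : 'I_N -> set R,
      (forall k, discrete_set (D k)) /\ fiber = \bigcup_k D k.

(** * The structure (R, <, +, 0, 1, A) *)

Variant group_funsym := Add | Zero | One.
Variant group_relsym := Lt | Pred.

Definition lang_A (d : nat) : language := {|
  funsym := group_funsym;
  fun_arity f := match f with Add => 2 | Zero | One => 0 end;
  relsym := group_relsym;
  rel_arity p := match p with Lt => 2 | Pred => d end |}.

Definition structure_A (R : realType) (d : nat) (A : set 'rV[R]_d) :
    structure (lang_A d) R := {|
  fun_interp := fun f : funsym (lang_A d) =>
    match f return ('I_(@fun_arity (lang_A d) f) -> R) -> R with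
    | Add => fun x => x (@Ordinal 2 0 isT) + x (@Ordinal 2 1 isT)
    | Zero => fun _ => 0
    | One => fun _ => 1
    end;
  rel_interp := fun p : relsym (lang_A d) =>
    match p return ('I_(@rel_arity (lang_A d) p) -> R) -> Prop with
    | Lt => fun x => x (@Ordinal 2 0 isT) < x (@Ordinal 2 1 isT)
    | Pred => fun x => A (\row_(i < d) x i)
    end |}.

(* Main.v *)
Require Import Defs.
From HB Require Import structures.
From mathcomp Require Import all_boot all_order all_algebra.
From mathcomp Require Import all_classical all_reals all_analysis.
From mathcomp Require Import ring lra zify.

(* Suppose first that A is sparse. In an automaton for A, the loops at a state are
   determined by their lengths, so every run is a bounded sequence of iterated loops,
   and A is definable in the real ordered vector space over R with a predicate for the
   powers of rho = r^l, for a suitable l. With the function lam x, the largest power of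
   rho below x, this structure has quantifier elimination: a quantified real x is
   replaced by new variables for the values of lam at affine functions of x, which
   leaves a linear problem; a quantified power p is then eliminated since
   lam (a p + s) is a constant multiple of p or of lam |s|, or else p is a
   constant multiple of lam |s / a|. A term is locally affine off finitely many discrete
   sets, hence d-minimality. The terms define only polynomially many patterns on N
   parameters, hence NIP. NIP implies NTP2 by compactness, here by an ultrapower. The
   dimension of the projections is 0 since they have polynomially many prefixes.

   If A is not sparse, then some projection has exponentially many prefixes, and the
   subset automaton for these prefixes has a state with two different loops of the
   same length. The closure K of this projection is definable and has no interior, as
   its dimension is less than 1. It contains a Cantor set on which a binary expansion
   map is Hoelder continuous, so it has positive dimension, and it is not a finite union
   of discrete sets, as these are countable. For e(x, t) the right end of the last gap of
   K of size at least t before x, the formula e(x, t') - e(x, t) = c has TP2: rows are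
   pairs of scales (t, t') and columns are differences c, which can be prescribed
   independently at different scales by the choice of loops. *)

Set Implicit Arguments.
Unset Strict Implicit.
Unset Printing Implicit Defensive.
Import Order.TTheory GRing.Theory Num.Theory numFieldNormedType.Exports.
Local Open Scope classical_set_scope.
Local Open Scope ring_scope.

(** * Powers of a base in the real line *)

(** No two variables are ever multiplied, so once the values of [lam] have been named, every
    condition on one variable is linear. For a quantified real these names are existentially
    quantified powers, and nothing forces them to be the right values: the formula is tested
    outright at a point computed from them, so a wrong choice does no harm. NIP speaks of all models
    of the theory, while the counting takes place in the reals. A finite shattering pattern is one
    existential sentence, so it descends to the reals; conversely, arrays of every finite size in
    the reals yield TP2 in an ultrapower. Two loops u and v of equal length can have adjacent
    cylinders, with a common value at the shared end. The loops uu and vv do not, since the cylinder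
    of uv lies between theirs. This makes the expansion map on the Cantor set well defined and
    Hoelder continuous. *)

Section LinearPowers.
Variables (R : realType) (rho : R).
Hypothesis rho_ge2 : 2 <= rho.

Let rho_gt0 : 0 < rho. Proof. exact: lt_le_trans rho_ge2. Qed.
Let rho_gt1 : 1 < rho. Proof. by apply: lt_le_trans rho_ge2; rewrite ltr1n. Qed.

Definition is_power (x : R) : Prop := exists z : int, x = rho ^ z.

Lemma is_power_gt0 x : is_power x -> 0 < x.
Proof. by move=> [z ->]; rewrite exprz_gt0. Qed.

Lemma is_power1 : is_power 1. Proof. by exists 0. Qed.
Lemma is_power_rho : is_power rho. Proof. by exists 1. Qed.

Lemma is_powerM x y : is_power x -> is_power y -> is_power (x * y).
Proof.
move=> [a ->] [b ->]; exists (a + b).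
by rewrite expfzDr// gt_eqF.
Qed.

Lemma is_powerV x : is_power x -> is_power x^-1.
Proof. by move=> [a ->]; exists (- a); rewrite invr_expz. Qed.

Lemma is_power_lt x y : is_power x -> is_power y -> x < y -> rho * x <= y.
Proof.
move=> [a ->] [b ->]; rewrite ltr_eXz2l// => ab.
rewrite -[X in X * _]expr1z -expfzDr ?gt_eqF//.
rewrite ler_eXz2l//; lia.
Qed.

Lemma is_power_floor x : 0 < x -> exists2 p, is_power p & p <= x < rho * p.
Proof.
move=> x0; have lr : 0 < ln rho by rewrite ln_gt0.
pose z := Num.floor (ln x / ln rho).
exists (rho ^ z); first by exists z.
have key (k : int) : rho ^ k = expR (ln rho * k%:~R).
  by rewrite -powR_intmul ?ltW// /powR gt_eqF// mulrC.
have := floor_itv (ln x / ln rho).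
rewrite ler_pdivlMr// ltr_pdivrMr// -/z => /andP[h1 h2].
apply/andP; split.
  by rewrite key -ler_ln ?posrE ?expR_gt0// expRK mulrC.
rewrite -[X in X * _]expr1z -expfzDr ?gt_eqF// key -ltr_ln ?posrE ?expR_gt0//.
by rewrite expRK mulrC addrC.
Qed.

(** The value 0 off the positive reals makes [lam] total and keeps [0 < lam x] equivalent to
    [0 < x]. *)
Definition lam (x : R) : R :=
  if 0 < x then xget 0 [set p | is_power p /\ p <= x < rho * p] else 0.

Lemma lam_le0 x : x <= 0 -> lam x = 0.
Proof. by rewrite /lam leNgt => /negbTE ->. Qed.

Lemma lamP x : 0 < x -> is_power (lam x) /\ lam x <= x < rho * lam x.
Proof.
move=> x0; rewrite /lam x0; case: xgetP => [y -> //|].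
have [p Pp px] := is_power_floor x0.
by move=> /(_ p) []; split.
Qed.

Lemma lam_unique p x : is_power p -> p <= x < rho * p -> lam x = p.
Proof.
move=> Pp /andP[px xp]; have x0 : 0 < x := lt_le_trans (is_power_gt0 Pp) px.
have [Pl /andP[lx xl]] := lamP x0.
case: (ltgtP p (lam x)) => // h.
  by have := is_power_lt Pp Pl h; lra.
by have := is_power_lt Pl Pp h; lra.
Qed.

Lemma lam_power p : is_power p -> lam p = p.
Proof.
move=> Pp; apply: lam_unique => //; have := is_power_gt0 Pp.
by move=> p0; rewrite lexx /= ltr_pMl.
Qed.

Lemma lam_gt0 x : (0 < lam x) = (0 < x).
Proof.
case: (ltP 0 x) => h; last by rewrite lam_le0// ltxx.
by have [/is_power_gt0] := lamP h.
Qed.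

Lemma lam_ge0 x : 0 <= lam x.
Proof.
case: (ltP 0 x) => h; last by rewrite lam_le0.
by rewrite ltW// lam_gt0.
Qed.

Lemma lamM p x : is_power p -> lam (p * x) = p * lam x.
Proof.
move=> Pp; have p0 := is_power_gt0 Pp.
case: (ltP 0 x) => x0; last by rewrite !lam_le0 ?mulr0// pmulr_rle0.
have [Pl /andP[h1 h2]] := lamP x0.
apply: lam_unique; first exact: is_powerM.
by rewrite ler_pM2l// h1 /= mulrCA ltr_pM2l.
Qed.

Lemma lam_gt0P x : 0 < lam x -> is_power (lam x).
Proof. by rewrite lam_gt0 => /lamP[]. Qed.

(* The factors by which [lam] can vary between two numbers whose quotient is
   at most [rho]. *)
Definition steps : seq R := [:: rho^-1; 1; rho].

Lemma steps_power c : c \in steps -> is_power c.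
Proof.
rewrite !inE => /or3P[] /eqP ->; [|exact: is_power1|exact: is_power_rho].
exact/is_powerV/is_power_rho.
Qed.

Lemma lam_close x y : 0 < x -> 0 < y -> x <= rho * y -> y <= rho * x ->
  exists2 c, c \in steps & lam x = c * lam y.
Proof.
move=> x0 y0 xy yx.
have [Px /andP[x1 x2]] := lamP x0.
have [Py /andP[y1 y2]] := lamP y0.
case: (ltgtP (lam x) (lam y)) => h.
- exists rho^-1; first by rewrite !inE eqxx.
  apply: (mulfI (lt0r_neq0 rho_gt0)); rewrite mulVKf ?gt_eqF//.
  have h1 := is_power_lt Px Py h.
  apply/eqP; rewrite eq_le h1 /= leNgt; apply/negP => h2.
  have := is_power_lt (is_powerM is_power_rho Px) Py h2.
  have : rho * x < rho * (rho * lam x) by rewrite ltr_pM2l.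
  lra.
- exists rho; first by rewrite !inE eqxx !orbT.
  have h1 := is_power_lt Py Px h.
  apply/eqP; rewrite eq_le h1 andbT leNgt; apply/negP => h2.
  have := is_power_lt (is_powerM is_power_rho Py) Px h2.
  have : rho * y < rho * (rho * lam y) by rewrite ltr_pM2l.
  lra.
- by exists 1; rewrite ?mul1r// !inE eqxx orbT.
Qed.

(** Each of [a * p + s], [|a| * p] and [|s|] is at most the sum of the other two. If one of the last
    two is more than twice the other, it is within a factor 2 of [a * p + s]; otherwise [p] is
    within a factor 2 of [|s| / |a|]. This is why the base is at least 2. *)
Lemma lam_linear_cases (a p s : R) : is_power p -> 0 < a * p + s -> exists2 c, c \in steps &
  [\/ lam (a * p + s) = c * lam `|a| * p,
      lam (a * p + s) = c * lam `|s| |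
      p = c * lam (`|s| / `|a|)].
Proof.
move=> Pp; have p0 := is_power_gt0 Pp.
have [->|a0 y0] := eqVneq a 0.
  rewrite mul0r add0r => s0; exists 1; first by rewrite !inE eqxx orbT.
  by apply: Or32; rewrite mul1r gtr0_norm.
have a1 : 0 < `|a| by rewrite normr_gt0.
set y := a * p + s in y0 *.
pose A := `|a| * p; have A0 : 0 < A by rewrite mulr_gt0.
have hy1 : y <= A + `|s|.
  by rewrite lerD ?ler_norm// /A ler_pM2r// ler_norm.
have hA : `|a * p| = A by rewrite normrM (gtr0_norm p0).
have hy2 : A <= y + `|s|.
  rewrite -hA -[X in X + _]gtr0_norm//.
  have -> : a * p = y - s by rewrite /y; lra.
  by rewrite ler_normB.
have hy3 : `|s| <= y + A.
  rewrite -hA -[X in X + _]gtr0_norm//.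
  have -> : s = y - a * p by rewrite /y; lra.
  by rewrite ler_normB.
have s0 : 0 <= `|s| by [].
have r2 (t : R) : 0 < t -> 2 * t <= rho * t by move=> t0; rewrite ler_pM2r.
have [h1|h1] := ltP (2 * `|s|) A.
  have [c cs e] : exists2 c, c \in steps & lam y = c * lam A.
    apply: lam_close => //; have := r2 _ A0; have := r2 _ y0; lra.
  exists c => //; apply: Or31.
  by rewrite e (_ : A = p * `|a|) 1?mulrC// lamM//; ring.
have [h2|h2] := ltP (2 * A) `|s|.
  have [c cs e] : exists2 c, c \in steps & lam y = c * lam `|s|.
    apply: lam_close => //; first lra.
      have := r2 `|s|; lra.
    have := r2 _ y0; lra.
  by exists c => //; apply: Or32.
have s1 : 0 < `|s| by lra.
have [c cs e] : exists2 c, c \in steps & lam p = c * lam (`|s| / `|a|).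
  apply: lam_close => //; first by rewrite divr_gt0.
    rewrite mulrA ler_pdivlMr// mulrC -/A; have := r2 _ s1; lra.
  rewrite ler_pdivrMr// -mulrA [p * _]mulrC -/A; have := r2 _ A0; lra.
by exists c => //; apply: Or33; rewrite -e lam_power.
Qed.

End LinearPowers.

(** * Quantifier elimination with powers of the base *)

Definition upd (T : Type) (e : nat -> T) (i : nat) (x : T) (j : nat) : T :=
  if j == i then x else e j.

Section Positions.
Variables (R : realType).
Implicit Types (l : seq R) (x y t : R).

Definition same_pos l x y : Prop :=
  forall t, t \in l -> (x < t) = (y < t) /\ (t < x) = (t < y).

Lemma same_pos_sub l1 l2 x y :
  {subset l1 <= l2} -> same_pos l2 x y -> same_pos l1 x y.
Proof. by move=> h s t /h/s. Qed.

Lemma same_pos_linear l (a b x y : R) : (- b / a) \in l -> same_pos l x y ->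
  (0 < a * x + b) = (0 < a * y + b) /\ (a * x + b < 0) = (a * y + b < 0).
Proof.
move=> tl /(_ _ tl) [h1 h2]; case: (ltgtP a 0) => [a0|a0|->]; last by rewrite !mul0r.
- have hx z : (0 < a * z + b) = (z < - b / a).
    by rewrite ltr_ndivlMr// mulrC; apply/idP/idP => ?; lra.
  have hy z : (a * z + b < 0) = (- b / a < z).
    by rewrite ltr_ndivrMr// mulrC; apply/idP/idP => ?; lra.
  by rewrite !hx !hy.
- have hx z : (0 < a * z + b) = (- b / a < z).
    by rewrite ltr_pdivrMr// mulrC; apply/idP/idP => ?; lra.
  have hy z : (a * z + b < 0) = (z < - b / a).
    by rewrite ltr_pdivlMr// mulrC; apply/idP/idP => ?; lra.
  by rewrite !hx !hy.
Qed.

Lemma seq_max_below (p : pred R) l :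
  (forall t, t \in l -> ~~ p t) \/
  exists2 t, t \in l & p t /\ forall u, u \in l -> p u -> u <= t.
Proof.
elim: l => [|a l [IH|[t tl [pt IH]]]]; first by left.
- have [pa|pa] := boolP (p a).
    right; exists a; first by rewrite inE eqxx.
    split=> // u; rewrite inE => /orP[/eqP -> //|/IH /negP//].
  by left=> t; rewrite inE => /orP[/eqP ->//|/IH].
- right; have [/andP[pa ta]|pa] := boolP (p a && (t <= a)).
    exists a; first by rewrite inE eqxx.
    split=> // u; rewrite inE => /orP[/eqP -> //|ul pu].
    exact: le_trans (IH _ ul pu) ta.
  exists t; first by rewrite inE tl orbT.
  split=> // u; rewrite inE => /orP[/eqP -> pu|]; last exact: IH.
  by move: pa; rewrite pu /= -ltNge => /ltW.
Qed.

Lemma seq_min_above (p : pred R) l :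
  (forall t, t \in l -> ~~ p t) \/
  exists2 t, t \in l & p t /\ forall u, u \in l -> p u -> t <= u.
Proof.
have [h|[t tl [pt h]]] := seq_max_below (fun x => p (- x)) [seq - x | x <- l].
  left=> t tl; apply/negP => pt.
  by have := h (- t); rewrite (map_f _ tl) opprK pt => /(_ isT).
right; move/mapP: tl pt h => [u ul ->]; rewrite opprK => pu h.
exists u => //; split=> // v vl pv.
by have := h (- v); rewrite map_f// opprK lerN2; apply.
Qed.

(** One point in each cell into which [l] cuts the line: the points of [l], midpoints for the
    bounded gaps, points beyond both ends, and 0 in case [l] is empty. *)
Definition real_tests l : seq R :=
  0 :: l ++ [seq (t + u) / 2 | t <- l, u <- l] ++
  [seq t + 1 | t <- l] ++ [seq t - 1 | t <- l].

Lemma real_testsP l x : exists2 c, c \in real_tests l & same_pos l x c.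
Proof.
have [xl|xl] := boolP (x \in l).
  by exists x => //; rewrite inE mem_cat xl orbT.
have xne t : t \in l -> t != x by apply: contraTneq => ->.
have [h1|[t tl [tx h1]]] := seq_max_below (fun t => t < x) l;
have [h2|[u ul [xu h2]]] := seq_min_above (fun t => x < t) l.
- exists 0; first by rewrite inE eqxx.
  move=> t tl; have := h1 _ tl; have := h2 _ tl; have := xne _ tl.
  by case: ltgtP.
- exists (u - 1); first by rewrite inE !mem_cat (map_f (fun t => t - 1) ul) !orbT.
  move=> t tl; have := h1 _ tl; have := h2 _ tl; have := xne _ tl.
  case: (ltgtP t x) => // xt _ /(_ isT) ut _.
  by split; [symmetry|apply/esym/negbTE; rewrite -leNgt]; lra.
- exists (t + 1); first by rewrite inE !mem_cat (map_f (fun t => t + 1) tl) !orbT.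
  move=> u ul; have := h1 _ ul; have := h2 _ ul; have := xne _ ul.
  case: (ltgtP u x) => // ux _ _ /(_ isT) ut.
  by split; [apply/esym/negbTE; rewrite -leNgt|symmetry]; lra.
- exists ((t + u) / 2).
    rewrite inE !mem_cat; apply/orP; right; apply/orP; right; apply/orP; left.
    by apply/allpairsP; exists (t, u).
  move=> v vl; have := h1 _ vl; have := h2 _ vl; have := xne _ vl.
  case: (ltgtP v x) => // vx _.
    move=> _ /(_ isT) vt.
    by split; [apply/esym/negbTE; rewrite -leNgt|symmetry]; lra.
  move=> /(_ isT) uv _.
  by split; [symmetry|apply/esym/negbTE; rewrite -leNgt]; lra.
Qed.

Variable rho : R.
Hypothesis rho_ge2 : 2 <= rho.

(** If [t] is the largest positive element of [l] below a power [x], the first power after [t],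
    which is [rho * lam t], lies in the cell of [x]. If there is none, [rho^-1 * lam u] does, for
    [u] the least element above [x], or else 1. The step 1 serves the case that [x] is in [l]. *)
Definition power_tests l : seq R :=
  1 :: [seq c * lam rho t | c <- steps rho, t <- l].

Lemma power_testsP l x : is_power rho x ->
  exists2 c, c \in power_tests l & is_power rho c /\ same_pos l x c.
Proof.
move=> Px; have x0 := is_power_gt0 rho_ge2 Px.
have r0 : 0 < rho by apply: lt_le_trans rho_ge2.
have st c t : c \in steps rho -> t \in l -> c * lam rho t \in power_tests l.
  by move=> cs tl; rewrite inE; apply/orP; right; apply/allpairsP; exists (c, t).
have Pst c t : c \in steps rho -> 0 < t -> is_power rho (c * lam rho t).
  by move=> cs t0; apply: is_powerM => //; [exact: steps_power|case: (lamP rho_ge2 t0)].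
have s1 : 1 \in steps rho by rewrite !inE eqxx orbT.
have s2 : rho \in steps rho by rewrite !inE eqxx !orbT.
have s3 : rho^-1 \in steps rho by rewrite !inE eqxx.
have [xl|xl] := boolP (x \in l).
  exists (1 * lam rho x); first exact: st.
  by rewrite mul1r lam_power.
have xne t : t \in l -> t != x by apply: contraTneq => ->.
have [h1|[t tl [/andP[t0 tx] h1]]] := seq_max_below (fun t => 0 < t < x) l.
  have [h2|[u ul [xu h2]]] := seq_min_above (fun t => x < t) l.
    exists 1; first by rewrite inE eqxx.
    split; first exact: is_power1.
    move=> t tl; have := h1 _ tl; have := h2 _ tl; have := xne _ tl.
    case: (ltgtP t x) => // tx _ _; rewrite andbT -leNgt => t0.
    by split; [apply/esym/negbTE; rewrite -leNgt|symmetry]; lra.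
  have u0 : 0 < u by apply: lt_trans xu.
  exists (rho^-1 * lam rho u); first exact: st.
  have PP := Pst _ _ s3 u0; split=> //.
  have [Pl /andP[l1 l2]] := lamP rho_ge2 u0.
  have lu : rho^-1 * lam rho u < u.
    rewrite mulrC ltr_pdivrMr//; apply: le_lt_trans l1 _.
    by rewrite ltr_pMr//; apply: lt_le_trans rho_ge2; rewrite ltr1n.
  have c0 := is_power_gt0 rho_ge2 PP.
  move=> t tl; have := h1 _ tl; have := h2 _ tl; have := xne _ tl.
  case: (ltgtP t x) => // tx _.
    rewrite andbT -leNgt => _ t0.
    by split; [apply/esym/negbTE; rewrite -leNgt|symmetry]; lra.
  move=> /(_ isT) ut _.
  by split; [symmetry|apply/esym/negbTE; rewrite -leNgt]; lra.
have [Pl /andP[l1 l2]] := lamP rho_ge2 t0.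
exists (rho * lam rho t); first exact: st.
have PP := Pst _ _ s2 t0; split=> //.
have cx : rho * lam rho t <= x by apply: is_power_lt => //; apply: le_lt_trans tx.
have c0 := is_power_gt0 rho_ge2 PP.
move=> v vl; have := h1 _ vl; have := xne _ vl.
case: (ltgtP v x) => // vx _.
  rewrite andbT => h; have {}h : v <= t.
    by case: (ltP 0 v) => v0; [exact: h|lra].
  by split; [apply/esym/negbTE; rewrite -leNgt|symmetry]; lra.
by split; [symmetry|apply/esym/negbTE; rewrite -leNgt]; lra.
Qed.

End Positions.

Section Terms.
Variables (R : realType) (rho : R).
Hypothesis rho_ge2 : 2 <= rho.

Inductive tm := TV of nat | TC of R | TA of tm & tm | TM of R & tm | TL of tm.

Fixpoint ev (e : nat -> R) (t : tm) : R :=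
  match t with
  | TV i => e i
  | TC c => c
  | TA t u => ev e t + ev e u
  | TM c t => c * ev e t
  | TL t => lam rho (ev e t)
  end.

Fixpoint below (n : nat) (t : tm) : bool :=
  match t with
  | TV j => (j < n)%N
  | TC c => true
  | TA t u => below n t && below n u
  | TM c t => below n t
  | TL t => below n t
  end.

Fixpoint tsub (s : nat -> tm) (t : tm) : tm :=
  match t with
  | TV j => s j
  | TC c => TC c
  | TA t u => TA (tsub s t) (tsub s u)
  | TM c t => TM c (tsub s t)
  | TL t => TL (tsub s t)
  end.

Lemma ev_tsub e s t : ev e (tsub s t) = ev (fun j => ev e (s j)) t.
Proof. by elim: t => //= [t -> u ->|c t ->|t ->]. Qed.

Lemma ev_below n t e e' : below n t -> (forall j, (j < n)%N -> e j = e' j) ->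
  ev e t = ev e' t.
Proof.
by move=> + h; elim: t => //= [t IHt u IHu /andP[/IHt -> /IHu ->]//|c t IH /IH ->|t IH /IH ->].
Qed.

Lemma below_leq n m t : (n <= m)%N -> below n t -> below m t.
Proof.
move=> nm; elim: t => //= [j jn|t IHt u IHu /andP[/IHt -> /IHu ->]//].
exact: leq_trans nm.
Qed.

Inductive qf := QF | QP of tm | QI of qf & qf.

Fixpoint qs (e : nat -> R) (q : qf) : bool :=
  match q with
  | QF => false
  | QP t => 0 < ev e t
  | QI q1 q2 => qs e q1 ==> qs e q2
  end.

Fixpoint qbelow (n : nat) (q : qf) : bool :=
  match q with
  | QF => true
  | QP t => below n t
  | QI q1 q2 => qbelow n q1 && qbelow n q2
  end.

Fixpoint qsub (s : nat -> tm) (q : qf) : qf :=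
  match q with
  | QF => QF
  | QP t => QP (tsub s t)
  | QI q1 q2 => QI (qsub s q1) (qsub s q2)
  end.

Lemma qs_qsub e s q : qs e (qsub s q) = qs (fun j => ev e (s j)) q.
Proof. by elim: q => //= [t|q1 -> q2 ->//]; rewrite ev_tsub. Qed.

Lemma qs_below n q e e' : qbelow n q -> (forall j, (j < n)%N -> e j = e' j) ->
  qs e q = qs e' q.
Proof.
move=> + h; elim: q => //= [t b|q1 IH1 q2 IH2 /andP[/IH1 -> /IH2 ->]//].
by rewrite (ev_below b h).
Qed.

Lemma exists_below t : exists n, below n t.
Proof.
elim: t => /= [i|c|t [n hn] u [m hm]|c t [n hn]|t [n hn]].
- by exists i.+1.
- by exists 0%N.
- exists (maxn n m); rewrite (below_leq _ hn) ?leq_maxl//=.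
  by rewrite (below_leq _ hm) ?leq_maxr.
- by exists n.
- by exists n.
Qed.

Lemma qbelow_leq n m q : (n <= m)%N -> qbelow n q -> qbelow m q.
Proof.
move=> nm; elim: q => //= [t|q1 IH1 q2 IH2 /andP[/IH1 -> /IH2 ->]//].
exact: below_leq.
Qed.

Lemma exists_qbelow q : exists n, qbelow n q.
Proof.
elim: q => /= [|t|q1 [n hn] q2 [m hm]]; first by exists 0%N.
  exact: exists_below.
exists (maxn n m); rewrite (qbelow_leq _ hn) ?leq_maxl//=.
by rewrite (qbelow_leq _ hm) ?leq_maxr.
Qed.

(** Quantifier-free definability. Quantifier elimination is the closure of this class under
    quantifiers, proved in [def_ex] and [def_all]. *)
Definition def (B : (nat -> R) -> Prop) : Prop :=
  exists q, forall e, B e <-> qs e q.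

Lemma def_ext B B' : (forall e, B e <-> B' e) -> def B -> def B'.
Proof. by move=> h [q hq]; exists q => e; rewrite -h. Qed.

Lemma def_false : def (fun=> False).
Proof. by exists QF => e; split. Qed.

Lemma def_imp B B' : def B -> def B' -> def (fun e => B e -> B' e).
Proof.
move=> [q hq] [q' hq']; exists (QI q q') => e /=.
split=> [h|/implyP h /hq /h /hq' //].
by apply/implyP => /hq /h /hq'.
Qed.

Lemma def_not B : def B -> def (fun e => ~ B e).
Proof. by move=> h; apply: def_imp => //; exact: def_false. Qed.

Lemma def_true : def (fun=> True).
Proof. by apply: def_ext (def_not def_false) => e; split=> // _ []. Qed.

Lemma def_or B B' : def B -> def B' -> def (fun e => B e \/ B' e).
Proof.
move=> h h'; apply: def_ext (def_imp (def_not h) h') => e; split.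
  by move=> k; case: (EM (B e)) => [|/k]; [left|right].
by move=> [|].
Qed.

Lemma def_and B B' : def B -> def B' -> def (fun e => B e /\ B' e).
Proof.
move=> h h'; apply: def_ext (def_not (def_imp h (def_not h'))) => e; split.
  by move=> k; split; apply: contrapT => k'; apply: k.
by move=> [b b'] /(_ b).
Qed.

Lemma def_pos t : def (fun e => 0 < ev e t).
Proof. by exists (QP t). Qed.

Lemma def_lt t u : def (fun e => ev e t < ev e u).
Proof.
apply: def_ext (def_pos (TA u (TM (-1) t))) => e /=.
by rewrite mulN1r subr_gt0.
Qed.

Lemma def_le t u : def (fun e => ev e t <= ev e u).
Proof.
by apply: def_ext (def_not (def_lt u t)) => e; rewrite leNgt; split=> /negP.
Qed.

Lemma def_eq t u : def (fun e => ev e t = ev e u).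
Proof.
apply: def_ext (def_and (def_le t u) (def_le u t)) => e.
by split=> [[h1 h2]|->//]; apply/eqP; rewrite eq_le h1.
Qed.

Lemma def_sub s B : def B -> def (fun e => B (fun j => ev e (s j))).
Proof. by move=> [q hq]; exists (qsub s q) => e; rewrite hq qs_qsub. Qed.

Lemma def_bigor (T : eqType) (l : seq T) (B : T -> (nat -> R) -> Prop) :
  (forall x, x \in l -> def (B x)) -> def (fun e => exists2 x, x \in l & B x e).
Proof.
elim: l => [_|a l IH h]; first by apply: def_ext def_false => e; split=> // -[].
have h1 := h a (mem_head _ _).
have h2 : def (fun e => exists2 x, x \in l & B x e).
  by apply: IH => x xl; apply: h; rewrite inE xl orbT.
apply: def_ext (def_or h1 h2) => e; split.
  by move=> [b|[x xl b]]; [exists a; rewrite ?mem_head|exists x; rewrite // inE xl orbT].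
by move=> [x]; rewrite inE => /orP[/eqP ->|xl b]; [left|right; exists x].
Qed.

Lemma def_is_power t : def (fun e => is_power rho (ev e t)).
Proof.
apply: def_ext (def_and (def_pos t) (def_eq (TL t) t)) => e /=; split.
  by move=> [t0 <-]; have [] := lamP rho_ge2 t0.
by move=> h; rewrite (is_power_gt0 rho_ge2 h) lam_power.
Qed.

End Terms.

HB.instance Definition _ (R : realType) := gen_eqMixin (tm R).

Section Elimination.
Variables (R : realType) (rho : R).
Hypothesis rho_ge2 : 2 <= rho.

Local Notation tm := (tm R).
Local Notation ev := (ev rho).
Local Notation qs := (qs rho).
Local Notation def := (def rho).
Local Notation lam := (lam rho).
Local Notation is_power := (is_power rho).
Local Notation steps := (steps rho).
Local Notation evs v T := [seq ev v u | u <- T].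

Let rho_gt0 : 0 < rho. Proof. by apply: lt_le_trans rho_ge2. Qed.

(* For [a = 0] this is a junk value, harmless since [a * x + s] is then constant. *)
Definition threshold (a : R) (s : tm) : tm := TM (- a^-1) s.

Lemma ev_threshold e a s : ev e (threshold a s) = - ev e s / a.
Proof. by rewrite /= mulNr mulrC mulNr. Qed.

Lemma same_pos_threshold e (T : seq tm) a s x y : threshold a s \in T ->
  same_pos (evs e T) x y ->
  (0 < a * x + ev e s) = (0 < a * y + ev e s) /\
  (a * x + ev e s < 0) = (a * y + ev e s < 0).
Proof.
move=> h; apply: same_pos_linear.
by rewrite -ev_threshold; apply: map_f.
Qed.

(** The affine functions of [p] that [lam (a * p + s)] can equal, following [lam_linear_cases].
    Terms have no absolute value, hence both signs of [s]. The last two put [c * lam (|s| / |a|)] in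
    place of [p], so that the result is free of [p]. *)
Definition candidates (a : R) (s : tm) : seq (R * tm) :=
  flatten [seq [:: (c * lam `|a|, TC 0);
                   (0, TM c (TL s)); (0, TM c (TL (TM (-1) s)));
                   (0, TL (TA (TM (a * c) (TL (TM `|a|^-1 s))) s));
                   (0, TL (TA (TM (a * c) (TL (TM (- `|a|^-1) s))) s))]
          | c <- steps].

Lemma mem_candidates a s d : d \in candidates a s -> exists2 c, c \in steps &
  [\/ d = (c * lam `|a|, TC 0), d = (0, TM c (TL s)),
      d = (0, TM c (TL (TM (-1) s))) |
      d = (0, TL (TA (TM (a * c) (TL (TM `|a|^-1 s))) s)) \/
      d = (0, TL (TA (TM (a * c) (TL (TM (- `|a|^-1) s))) s))].
Proof.
move=> /flatten_mapP[c cs]; rewrite !inE => h; exists c => //.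
by case/orP: h => [/eqP|/or4P[/eqP|/eqP|/eqP|/eqP]];
  [constructor 1|constructor 2|constructor 3|constructor 4; left|constructor 4; right].
Qed.

(** Thresholds preserve inequalities but not the property of being a power. The latter survives a
    change of [p] because a candidate is either free of [p] or a constant multiple of [p]. *)
Lemma candidates_power a s d e p p' : d \in candidates a s ->
  is_power p -> is_power p' -> is_power (d.1 * p + ev e d.2) ->
  is_power (d.1 * p' + ev e d.2).
Proof.
move=> /mem_candidates[c _ [|||[]]] -> /=; rewrite ?mul0r// !addr0 => Pp Pp' h.
apply: is_powerM => //; have p0 := is_power_gt0 rho_ge2 Pp.
have -> : c * lam `|a| = c * lam `|a| * p * p^-1 by rewrite mulfK// gt_eqF.
by apply: is_powerM => //; exact: is_powerV.
Qed.

Lemma candidates_lam a s e p : is_power p -> 0 < a * p + ev e s ->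
  exists2 d, d \in candidates a s & lam (a * p + ev e s) = d.1 * p + ev e d.2.
Proof.
move=> Pp y0; have [c cs h] := lam_linear_cases rho_ge2 Pp y0.
have inc d : d \in [:: (c * lam `|a|, TC 0);
                   (0, TM c (TL s)); (0, TM c (TL (TM (-1) s)));
                   (0, TL (TA (TM (a * c) (TL (TM `|a|^-1 s))) s));
                   (0, TL (TA (TM (a * c) (TL (TM (- `|a|^-1) s))) s))] ->
   d \in candidates a s.
  by move=> ?; apply/flatten_mapP; exists c.
case: h => h.
- exists (c * lam `|a|, TC 0); first by apply: inc; rewrite !inE eqxx.
  by rewrite /= addr0.
- case: (ler0P (ev e s)) h => s0 h.
    exists (0, TM c (TL (TM (-1) s))); first by apply: inc; rewrite !inE eqxx !orbT.
    by rewrite /= mul0r add0r mulN1r.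
  exists (0, TM c (TL s)); first by apply: inc; rewrite !inE eqxx !orbT.
  by rewrite /= mul0r add0r.
- case: (ler0P (ev e s)) h => s0 h.
    exists (0, TL (TA (TM (a * c) (TL (TM (- `|a|^-1) s))) s)).
      by apply: inc; rewrite !inE eqxx !orbT.
    by rewrite /= mul0r add0r {1}h mulrA (mulrC _ (ev e s)) mulrN mulNr.
  exists (0, TL (TA (TM (a * c) (TL (TM `|a|^-1 s))) s)).
    by apply: inc; rewrite !inE eqxx !orbT.
  by rewrite /= mul0r add0r {1}h mulrA [_ * ev e s]mulrC.
Qed.

(** [T] and [C] serve all [e] at once. For [lam y] with [y] affine in [p], the value is a candidate
    [d]; the inequalities [d <= y < rho * d] which characterise it are linear in [p], so they pass
    to [p'] when their thresholds are tests. *)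
Lemma term_power_normal i t : exists (T : seq tm) (C : seq (R * tm)),
  forall e p, is_power p -> exists2 c, c \in C & forall p', is_power p' ->
    same_pos (evs e T) p p' -> ev (upd e i p') t = c.1 * p' + ev e c.2.
Proof.
elim: t => [j|c|t [T [C h]] u [T' [C' h']]|a t [T [C h]]|t [T [C h]]].
- have [ji|ji] := eqVneq j i.
    exists [::], [:: (1, TC 0)] => e p _.
    exists (1, TC 0) => [|p' _ _] /=; first by rewrite inE.
    by rewrite ji /upd eqxx mul1r addr0.
  exists [::], [:: (0, TV R j)] => e p _.
  exists (0, TV R j) => [|p' _ _] /=; first by rewrite inE.
  by rewrite /upd (negbTE ji) mul0r add0r.
- exists [::], [:: (0, TC c)] => e p _.
  exists (0, TC c) => [|p' _ _] /=; first by rewrite inE.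
  by rewrite mul0r add0r.
- exists (T ++ T'), [seq (c.1 + d.1, TA c.2 d.2) | c <- C, d <- C'] => e p Pp.
  have [c cC hc] := h e p Pp; have [d dC hd] := h' e p Pp.
  exists (c.1 + d.1, TA c.2 d.2); first by apply/allpairsP; exists (c, d).
  move=> p' Pp' sp /=; rewrite hc//; last first.
    by apply: same_pos_sub sp => x; rewrite map_cat mem_cat => ->.
  rewrite hd//; last first.
    by apply: same_pos_sub sp => x; rewrite map_cat mem_cat orbC => ->.
  by rewrite mulrDl; ring.
- exists T, [seq (a * c.1, TM a c.2) | c <- C] => e p Pp.
  have [c cC hc] := h e p Pp.
  exists (a * c.1, TM a c.2); first exact: (map_f (fun c => (a * c.1, TM a c.2))).
  by move=> p' Pp' sp /=; rewrite hc// mulrDr mulrA.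
(* With [y] the affine function given by [c], these control the signs of [y], [y - d] and
   [rho * d - y]. *)
- pose thrs (c d : R * tm) := [:: threshold c.1 c.2;
    threshold (c.1 - d.1) (TA c.2 (TM (-1) d.2));
    threshold (rho * d.1 - c.1) (TA (TM rho d.2) (TM (-1) c.2))].
  pose T1 := flatten [seq threshold c.1 c.2 ::
     flatten [seq thrs c d | d <- candidates c.1 c.2] | c <- C].
  exists (T ++ T1), ((0, TC 0) :: flatten [seq candidates c.1 c.2 | c <- C]) => e p Pp.
  have [c cC hc] := h e p Pp.
  have T0in : threshold c.1 c.2 \in T ++ T1.
    rewrite mem_cat; apply/orP; right; apply/flatten_mapP; exists c => //.
    exact: mem_head.
  have subT p' : same_pos (evs e (T ++ T1)) p p' -> same_pos (evs e T) p p'.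
    by apply: same_pos_sub => x; rewrite map_cat mem_cat => ->.
  have [y0|y0] := ltP 0 (c.1 * p + ev e c.2); last first.
    exists (0, TC 0); first exact: mem_head.
    move=> p' Pp' sp /=; rewrite hc ?mul0r ?add0r//; last exact: subT.
    have [hs _] := same_pos_threshold T0in sp.
    by rewrite lam_le0// leNgt -hs -leNgt.
  have [d dC hd] := candidates_lam Pp y0.
  exists d; first by rewrite inE; apply/orP; right; apply/flatten_mapP; exists c.
  move=> p' Pp' sp /=; rewrite hc//; last exact: subT.
  have thin u : u \in thrs c d -> u \in T ++ T1.
    move=> ut; rewrite mem_cat; apply/orP; right; apply/flatten_mapP; exists c => //.
    by rewrite inE; apply/orP; right; apply/flatten_mapP; exists d.
  have [Pl /andP[l1 l2]] := lamP rho_ge2 y0.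
  apply: lam_unique => //.
    by apply: (candidates_power dC Pp) => //; rewrite -hd.
  rewrite hd in l1 l2.
  have [|_ h1] := same_pos_threshold (thin (threshold (c.1 - d.1) (TA c.2 (TM (-1) d.2))) _) sp.
    by rewrite !inE eqxx orbT.
  have [|h2 _] := same_pos_threshold (thin (threshold (rho * d.1 - c.1) (TA (TM rho d.2) (TM (-1) c.2))) _) sp.
    by rewrite !inE eqxx !orbT.
  move: h1 h2 => /= h1 h2.
  apply/andP; split.
    rewrite leNgt; apply/negP => l3.
    have : (c.1 - d.1) * p' + (ev e c.2 + -1 * ev e d.2) < 0 by lra.
    by rewrite -h1; lra.
  have : 0 < (rho * d.1 - c.1) * p' + (rho * ev e d.2 + -1 * ev e c.2).
    by rewrite -h2; lra.
  lra.
Qed.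

Lemma qf_power_normal i q : exists T : seq tm,
  forall e p p', is_power p -> is_power p' -> same_pos (evs e T) p p' ->
  qs (upd e i p) q = qs (upd e i p') q.
Proof.
elim: q => [|t|q1 [T1 h1] q2 [T2 h2]].
- by exists [::].
- have [T [C h]] := term_power_normal i t.
  exists (T ++ [seq threshold c.1 c.2 | c <- C]) => e p p' Pp Pp' sp /=; have [c cC hc] := h e p Pp.
  have s1 : same_pos (evs e T) p p'.
    by apply: same_pos_sub sp => x; rewrite map_cat mem_cat => ->.
  rewrite !hc//.
  have [|] := @same_pos_threshold e _ c.1 c.2 _ _ _ sp; last by [].
  by rewrite mem_cat (map_f (fun c => threshold c.1 c.2) cC) orbT.
- exists (T1 ++ T2) => e p p' Pp Pp' sp /=; rewrite (h1 e p p')// ?(h2 e p p')//.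
    by apply: same_pos_sub sp => x; rewrite map_cat mem_cat orbC => ->.
  by apply: same_pos_sub sp => x; rewrite map_cat mem_cat => ->.
Qed.

Lemma def_upd i u B : def B -> def (fun e => B (upd e i (ev e u))).
Proof.
move=> /(def_sub (fun j => if j == i then u else TV R j)).
apply: def_ext => e; rewrite (_ : (fun _ => _) = upd e i (ev e u))//.
by apply: funext => j; rewrite /upd; case: ifP.
Qed.

(** The test points are values of terms in [e], so the quantifier turns into a finite
    disjunction. *)
Lemma def_ex_power i B : def B -> def (fun e => exists p, is_power p /\ B (upd e i p)).
Proof.
move=> [q hq]; have [T h] := qf_power_normal i q.
pose tests := TC 1 :: [seq TM c (TL u) | c <- steps, u <- T].
have evt e : evs e tests = power_tests rho (evs e T).
  by rewrite /tests /power_tests map_cons map_allpairs allpairs_mapr.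
apply: (@def_ext _ _ (fun e => exists2 u, u \in tests &
    is_power (ev e u) /\ B (upd e i (ev e u)))); last first.
  apply: def_bigor => u _; apply: def_and; first exact: def_is_power.
  by apply: def_upd; exists q.
move=> e; split=> [[u _ h1]|[p [Pp /hq Bp]]]; first by exists (ev e u).
have [c cT [Pc sc]] := power_testsP rho_ge2 (evs e T) Pp.
move: cT; rewrite -evt => /mapP[u uT cu]; subst c.
by exists u => //; split=> //; apply/hq; rewrite -(h e p).
Qed.

(** The range of [lam]: it takes the value 0 at arguments that are not positive. *)
Definition is_power0 x := x = 0 \/ is_power x.

Lemma def_ex_power0 i B : def B ->
  def (fun e => exists p, is_power0 p /\ B (upd e i p)).
Proof.
move=> dB; apply: def_ext (def_or (def_upd i (TC 0) dB) (def_ex_power i dB)) => e.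
split=> /= [[h|[p [Pp h]]]|[p [[->|Pp] h]]].
- by exists 0; split=> //; left.
- by exists p; split=> //; right.
- by left.
- by right; exists p.
Qed.

Lemma def_ex_powers n k B : def B -> def (fun e => exists v,
  [/\ forall j, ~~ (n <= j < n + k)%N -> v j = e j,
      forall j, (n <= j < n + k)%N -> is_power0 (v j) & B v]).
Proof.
elim: k B => [|k IH] B dB.
  apply: def_ext dB => e; split=> [Be|[v [h _ Bv]]].
    by exists e; split=> // j; rewrite addn0; lia.
  rewrite (_ : e = v)//; apply: funext => j; rewrite h//; lia.
apply: def_ext (IH _ (def_ex_power0 (n + k) dB)) => e; split.
  move=> [v [h1 h2 [p [Pp Bp]]]]; exists (upd v (n + k) p); split=> // j hj.
    by rewrite /upd; case: eqP hj => [->|jk hj]; [lia|apply: h1; lia].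
  by rewrite /upd; case: eqP hj => // jk hj; apply: h2; lia.
move=> [v [h1 h2 Bv]]; exists (upd v (n + k) (e (n + k)%N)); split.
- by move=> j hj; rewrite /upd; case: eqP hj => [->//|jk hj]; apply: h1; lia.
- by move=> j hj; rewrite /upd; case: eqP hj => [->|jk hj]; [lia|apply: h2; lia].
- exists (v (n + k)%N); split; first by apply: h2; lia.
  rewrite (_ : upd _ _ _ = v)//; apply: funext => j.
  by rewrite /upd; case: eqP => // ->.
Qed.

(* The new variables, from [N] on, stand for the values of the subterms [TL u]
   which contain [x]; once they are fixed, [t] is affine near [x]. *)
Lemma term_real_normal i t N : below N t ->
  exists k a s (T : seq tm),
  [/\ below (N + k) s & all (below (N + k)) T] /\
  forall e x, exists v,
    [/\ forall j, ~~ (N <= j < N + k)%N -> v j = e j,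
        forall j, (N <= j < N + k)%N -> is_power0 (v j) &
        forall x', same_pos (evs v T) x x' ->
          ev (upd e i x') t = a * x' + ev v s].
Proof.
elim: t N => [j|c|t IHt u IHu|c t IH|t IH] N /=.
- move=> jN; have [ji|ji] := eqVneq j i.
    exists 0%N, 1, (TC 0), [::]; split=> // e x; exists e; split=> // [k|x' _].
      by rewrite addn0 leqNgt andNb.
    by rewrite /= ji /upd eqxx; ring.
  exists 0%N, 0, (TV R j), [::]; split; first by split; rewrite ?addn0//=.
  move=> e x; exists e; split=> // [k|x' _]; first by rewrite addn0 leqNgt andNb.
  by rewrite /= /upd (negbTE ji) mul0r add0r.
- move=> _; exists 0%N, 0, (TC c), [::]; split=> // e x; exists e; split=> // [k|x' _].
    by rewrite addn0 leqNgt andNb.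
  by rewrite mul0r add0r.
(* The new variables of [u] are placed after those of [t], so neither set overwrites the other. *)
- move=> /andP[bt bu].
  have [k1 [a1 [s1 [T1 [[bs1 bT1] h1]]]]] := IHt N bt.
  have Nk : (N <= N + k1)%N := leq_addr _ _.
  have [k2 [a2 [s2 [T2 [[bs2 bT2] h2]]]]] := IHu (N + k1)%N (below_leq Nk bu).
  have le12 : (N + k1 <= N + k1 + k2)%N := leq_addr _ _.
  exists (k1 + k2)%N, (a1 + a2), (TA s1 s2), (T1 ++ T2); rewrite addnA; split.
    split=> /=; first by rewrite bs2 (below_leq le12 bs1).
    by rewrite all_cat bT2 andbT; apply: sub_all bT1 => w; apply: below_leq.
  move=> e x; have [v1 [e1 P1 H1]] := h1 e x; have [v2 [e2 P2 H2]] := h2 v1 x.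
  have ev12 w : below (N + k1) w -> ev v2 w = ev v1 w.
    by move=> bw; apply: (ev_below _ bw) => j hj; rewrite e2//; move: hj; clear; lia.
  exists v2; split=> [j hj|j hj|x' sp].
  + by rewrite e2 ?e1//; move: hj; clear; lia.
  + have [hj'|hj'] := ltnP j (N + k1); last by apply: P2; move: hj hj'; clear; lia.
    by rewrite e2; [apply: P1|]; move: hj hj'; clear; lia.
  + rewrite H1; last first.
      rewrite (_ : evs v1 T1 = evs v2 T1); last first.
        by apply/eq_in_map => w wT; rewrite ev12// (allP bT1).
      by apply: same_pos_sub sp => y; rewrite map_cat mem_cat => ->.
    rewrite (@ev_below _ _ N u _ (upd v1 i x')) ?bu//; last first.
      by move=> j jN; rewrite /upd; case: eqP => // _; rewrite e1//; move: jN; clear; lia.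
    rewrite H2; last by apply: same_pos_sub sp => y; rewrite map_cat mem_cat orbC => ->.
    by rewrite /= (ev12 s1)//; ring.
- move=> bt; have [k [a [s [T [[bs bT] h]]]]] := IH N bt.
  exists k, (c * a), (TM c s), T; split=> // e x.
  have [v [h1 h2 h3]] := h e x; exists v; split=> // x' sp.
  by rewrite /= h3//; ring.
- move=> bt; have [k [a [s [T [[bs bT] h]]]]] := IH N bt.
  pose w := TV R (N + k).
  (* The new variable [w] holds [lam y]. These thresholds fix the sign of [y] and the inequalities
     [w <= y < rho * w], so [lam] is constant on the cell. *)
  pose T' := [:: threshold a s; threshold a (TA s (TM (-1) w));
                 threshold a (TA s (TM (- rho) w))].
  have lek : (N + k <= N + k.+1)%N by rewrite leq_add2l.
  have ltk : (N + k < N + k.+1)%N by rewrite ltn_add2l.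
  exists k.+1, 0, w, (T ++ T'); split.
    split=> //=.
    rewrite all_cat /= !(below_leq lek bs) !ltk !andbT.
    by apply: sub_all bT => z; apply: below_leq.
  move=> e x; have [v [h1 h2 h3]] := h e x.
  pose y := a * x + ev v s.
  pose v' := upd v (N + k) (lam y).
  have evv z : below (N + k) z -> ev v' z = ev v z.
    by move=> bz; apply: (ev_below _ bz) => j hj; rewrite /v' /upd; case: eqP hj => // ->; rewrite ltnn.
  exists v'; split=> [j hj|j hj|x' sp].
  + by rewrite /v' /upd; case: eqP hj => [->|_ hj]; [rewrite leq_addr ltk|apply: h1; move: hj; clear; lia].
  + rewrite /v' /upd; case: eqP => [_|hj']; last by apply: h2; move: hj hj'; clear; lia.
    by case: (ltP 0 y) => y0; [right; case: (lamP rho_ge2 y0)|left; rewrite lam_le0].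
  + have vw : v' (N + k)%N = lam y by rewrite /v' /upd eqxx.
    rewrite h3; last first.
      rewrite (_ : evs v T = evs v' T); last first.
        by apply/eq_in_map => z zT; rewrite evv// (allP bT).
      by apply: same_pos_sub sp => z; rewrite map_cat mem_cat => ->.
    rewrite mul0r add0r /= vw.
    have tin z : z \in T' -> z \in T ++ T' by rewrite mem_cat orbC => ->.
    have [|c1 _] := same_pos_threshold (tin (threshold a s) _) sp.
      by rewrite inE eqxx.
    have [|_ c2] := same_pos_threshold (tin (threshold a (TA s (TM (-1) w))) _) sp.
      by rewrite !inE eqxx orbT.
    have [|_ c3] := same_pos_threshold (tin (threshold a (TA s (TM (- rho) w))) _) sp.
      by rewrite !inE eqxx !orbT.
    move: c1 c2 c3; rewrite /= !evv// vw -/y => c1 c2 c3.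
    have [y0|y0] := ltP 0 y; last first.
      by rewrite (lam_le0 _ y0) lam_le0// leNgt -c1 -leNgt.
    have [Pl /andP[l1 l2]] := lamP rho_ge2 y0.
    rewrite /y in l1 l2 c2 c3 *.
    apply: lam_unique => //; apply/andP; split.
      rewrite leNgt; apply/negP => l3.
      have : a * x' + (ev v s + -1 * lam (a * x + ev v s)) < 0 by lra.
      by rewrite -c2; lra.
    have : a * x' + (ev v s + - rho * lam (a * x + ev v s)) < 0 by rewrite -c3; lra.
    lra.
Qed.

Lemma qf_real_normal i q N : qbelow N q ->
  exists k (T : seq tm), all (below (N + k)) T /\ forall e x, exists v,
    [/\ forall j, ~~ (N <= j < N + k)%N -> v j = e j,
        forall j, (N <= j < N + k)%N -> is_power0 (v j) &
        forall x', same_pos (evs v T) x x' ->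
          qs (upd e i x) q = qs (upd e i x') q].
Proof.
elim: q N => [|t|q1 IH1 q2 IH2] N /=.
- move=> _; exists 0%N, [::]; split=> // e x; exists e; split=> // j; by rewrite addn0 leqNgt andNb.
- move=> bt; have [k [a [s [T [[bs bT] h]]]]] := term_real_normal i bt.
  exists k, (threshold a s :: T); split=> /=; rewrite ?bs// => e x.
  have [v [h1 h2 h3]] := h e x; exists v; split=> // x' sp.
  have [h4 _] := same_pos_threshold (mem_head (threshold a s) T) sp.
  by rewrite !h3//; apply: same_pos_sub sp => z; rewrite inE orbC => ->.
- move=> /andP[bt bu].
  have [k1 [T1 [bT1 h1]]] := IH1 N bt.
  have Nk : (N <= N + k1)%N := leq_addr _ _.
  have [k2 [T2 [bT2 h2]]] := IH2 (N + k1)%N (qbelow_leq Nk bu).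
  have le12 : (N + k1 <= N + k1 + k2)%N := leq_addr _ _.
  exists (k1 + k2)%N, (T1 ++ T2); rewrite addnA; split.
    by rewrite all_cat bT2 andbT; apply: sub_all bT1 => w; apply: below_leq.
  move=> e x; have [v1 [e1 P1 H1]] := h1 e x; have [v2 [e2 P2 H2]] := h2 v1 x.
  exists v2; split=> [j hj|j hj|x' sp].
  + by rewrite e2 ?e1//; move: hj; clear; lia.
  + have [hj'|hj'] := ltnP j (N + k1); last by apply: P2; move: hj hj'; clear; lia.
    by rewrite e2; [apply: P1|]; move: hj hj'; clear; lia.
  + rewrite (H1 x'); last first.
      rewrite (_ : evs v1 T1 = evs v2 T1); last first.
        apply/eq_in_map => w wT; apply: (ev_below _ (allP bT1 _ wT)) => j hj.
        by rewrite e2//; move: hj; clear; lia.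
      by apply: same_pos_sub sp => y; rewrite map_cat mem_cat => ->.
    have e12 y : qs (upd e i y) q2 = qs (upd v1 i y) q2.
      apply: (qs_below _ bu) => j jN.
      by rewrite /upd; case: eqP => // _; rewrite e1//; move: jN; clear; lia.
    rewrite !e12 (H2 x')//.
    by apply: same_pos_sub sp => y; rewrite map_cat mem_cat orbC => ->.
Qed.

(** First the powers [v] are guessed, then a test point, which is a term in [v]. Any guess is sound:
    [B] is evaluated at the test point itself and depends only on the variables below [N], where [v]
    and [e] agree. The true values of [lam] make the guess complete. *)
Lemma def_ex i B : def B -> def (fun e => exists x, B (upd e i x)).
Proof.
move=> [q hq]; have [N bN] := exists_qbelow q.
have [k [T [_ h]]] := qf_real_normal i bN.
pose tests := TC 0 :: T ++ [seq TM 2^-1 (TA t u) | t <- T, u <- T] ++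
  [seq TA t (TC 1) | t <- T] ++ [seq TA t (TC (-1)) | t <- T].
have evt v : evs v tests = real_tests (evs v T).
  rewrite /tests /real_tests map_cons !map_cat map_allpairs allpairs_mapl allpairs_mapr.
  rewrite -!map_comp; congr (_ :: _ ++ _ ++ _).
  by apply: eq_allpairs => t u /=; rewrite mulrC.
have dt : def (fun v => exists2 u, u \in tests & B (upd v i (ev v u))).
  by apply: def_bigor => u _; apply: def_upd; exists q.
apply: def_ext (def_ex_powers N k dt) => e; split.
  move=> [v [ve _ [u _ Bu]]]; exists (ev v u); apply/hq; move/hq: Bu.
  rewrite (qs_below _ bN (e' := upd e i (ev v u)))// => j jN.
  by rewrite /upd; case: eqP => // _; rewrite ve//; move: jN; clear; lia.
move=> [x /hq Bx]; have [v [ve Pv hv]] := h e x; exists v; split=> //.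
have [c cT sc] := real_testsP (evs v T) x.
move: cT; rewrite -evt => /mapP[u uT cu]; subst c.
exists u => //; apply/hq; move: Bx; rewrite (hv _ sc) => Bx.
rewrite (qs_below _ bN (e' := upd e i (ev v u)))// => j jN.
by rewrite /upd; case: eqP => // _; rewrite ve//; move: jN; clear; lia.
Qed.

Lemma def_all i B : def B -> def (fun e => forall x, B (upd e i x)).
Proof.
move=> /def_not/(def_ex i)/def_not; apply: def_ext => e; split=> [h x|h [x]].
  by apply: contrapT => k; apply: h; exists x.
by apply.
Qed.

End Elimination.

(** * Definable sets are d-minimal *)

Lemma split_lshift m n (i : 'I_m) : fintype.split (lshift n i) = inl i.
Proof. exact: (unsplitK (inl i)). Qed.

Lemma split_rshift m n (i : 'I_n) : fintype.split (rshift m i) = inr i.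
Proof. exact: (unsplitK (inr i)). Qed.

Section Discrete.
Variable R : realType.
Implicit Types X Y : set R.

(** An inclusion passes to subsets and unions more easily than an equality. Since subsets of
    discrete sets are discrete, [discrete_cover_union] restores the equality. *)
Definition discrete_cover (N : nat) X : Prop :=
  exists D : 'I_N -> set R, (forall k, discrete_set (D k)) /\
    X `<=` \bigcup_k D k.

Lemma discrete_setI X Y : discrete_set X -> discrete_set (X `&` Y).
Proof.
move=> dX x [Xx Yx]; have [a [b h]] := dX x Xx; exists a, b.
by rewrite setIAC h; apply/seteqP; split=> [y []//|y ->].
Qed.

Lemma discrete_cover_sub N X Y : X `<=` Y -> discrete_cover N Y -> discrete_cover N X.
Proof. by move=> XY [D [h1 h2]]; exists D; split=> // x /XY/h2. Qed.

Lemma discrete_coverU N M X Y : discrete_cover N X -> discrete_cover M Y ->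
  discrete_cover (N + M) (X `|` Y).
Proof.
move=> [D [d1 d2]] [E [e1 e2]].
exists (fun k => match fintype.split k with inl i => D i | inr j => E j end).
split=> [k|x [/d2[i _ Dx]|/e2[i _ Ex]]]; first by case: fintype.split.
  by exists (lshift M i) => //; rewrite split_lshift.
by exists (rshift N i) => //; rewrite split_rshift.
Qed.

Lemma discrete_cover1 X : discrete_set X -> discrete_cover 1 X.
Proof. by move=> h; exists (fun=> X); split=> // x Xx; exists ord0. Qed.

Lemma discrete_cover_union N X : discrete_cover N X ->
  exists D : 'I_N -> set R, (forall k, discrete_set (D k)) /\ X = \bigcup_k D k.
Proof.
move=> [D [h1 h2]]; exists (fun k => D k `&` X); split=> [k|].
  exact: discrete_setI.
apply/seteqP; split=> [x Xx|x [k _ []//]].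
by have [k _ Dx] := h2 _ Xx; exists k.
Qed.

Lemma discrete_set_ball X : (forall x, X x -> exists2 e, 0 < e &
    forall y, X y -> `|y - x| < e -> y = x) -> discrete_set X.
Proof.
move=> h x Xx; have [e e0 he] := h x Xx; exists (x - e), (x + e).
apply/seteqP; split=> [y [Xy]|y ->].
  by rewrite /= in_itv /= -ltr_distl => /(he _ Xy).
by split=> //=; rewrite in_itv /=; apply/andP; split; lra.
Qed.

End Discrete.

Section DMinimal.
Variables (R : realType) (rho : R).
Hypothesis rho_ge2 : 2 <= rho.

Local Notation ev := (ev rho).
Local Notation qs := (qs rho).
Local Notation lam := (lam rho).
Local Notation is_power := (is_power rho).

Definition affine_near (f : R -> R) (a b x : R) : Prop :=
  exists2 e, 0 < e & forall y, `|y - x| < e -> f y = a * y + b.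

Lemma affine_nearP f a b x : affine_near f a b x -> f x = a * x + b.
Proof. by move=> [e e0]; apply; rewrite subrr normr0. Qed.

Lemma affine_sign (a b x : R) : a * x + b != 0 -> exists2 e, 0 < e &
  forall y, `|y - x| < e -> (0 < a * y + b) = (0 < a * x + b).
Proof.
move=> h; have n0 : 0 < `|a * x + b| by rewrite normr_gt0.
have a1 : 0 < `|a| + 1 by rewrite ltr_pwDr.
(* The summand 1 keeps the denominator positive when [a = 0]. *)
exists (`|a * x + b| / (`|a| + 1)); first by rewrite divr_gt0.
move=> y; rewrite ltr_pdivlMr// => hy.
have : `|a * (y - x)| < `|a * x + b|.
  rewrite normrM mulrC; apply: le_lt_trans hy.
  by rewrite ler_wpM2l// lerDl.
rewrite (_ : a * y + b = a * (y - x) + (a * x + b)); last by ring.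
move: (a * (y - x)) (a * x + b) => u v.
rewrite ltr_norml; case: (ltrgt0P v) => v0 /andP[h1 h2].
- by apply/idP; lra.
- by apply/negbTE; rewrite -leNgt; lra.
- by move: h1 h2; rewrite v0; lra.
Qed.

Lemma affine_locally_const_sign f a b x : affine_near f a b x ->
  (a = 0 \/ f x != 0) ->
  exists2 e, 0 < e & forall y, `|y - x| < e -> (0 < f y) = (0 < f x).
Proof.
move=> fab; have fx := affine_nearP fab; case: fab => e e0 he.
have [z|h] := eqVneq (a * x + b) 0; last first.
  move=> _; have [e' e'0 he'] := affine_sign h.
  exists (Num.min e e'); first by rewrite lt_min e0.
  by move=> y; rewrite lt_min fx => /andP[/he -> /he'].
case=> [a0|]; last by rewrite fx z eqxx.
by exists e => // y /he ->; rewrite fx a0 !mul0r.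
Qed.

Definition kinks (t : tm R) (e : nat -> R) (i : nat) : set R :=
  [set x | ~ exists a b, affine_near (fun y => ev (upd e i y) t) a b x].

(** Where [f] is affine, [lam f] can have a kink only if the slope is nonzero and [f x] is 0 ([Z0])
    or a power ([Z1]). Both sets are discrete: near such a point an affine function of nonzero slope
    takes each value once. *)
Lemma kinks_cover i t : exists N, forall e, discrete_cover N (kinks t e i).
Proof.
have none (S : set R) : (forall x, ~ S x) -> discrete_cover 0 S.
  by move=> h; exists (fun=> set0); split=> [[]//|x /h].
elim: t => [j|c|t [N hN] u [M hM]|c t [N hN]|t [N hN]].
- exists 0%N => e; apply: none => x []; have [ji|ji] := eqVneq j i.
    exists 1, 0, 1 => // y _ /=; by rewrite ji /upd eqxx mul1r addr0.
  by exists 0, (e j), 1 => // y _ /=; rewrite /upd (negbTE ji) mul0r add0r.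
- by exists 0%N => e; apply: none => x []; exists 0, c, 1 => // y _ /=; rewrite mul0r add0r.
- exists (N + M)%N => e; apply: discrete_cover_sub (discrete_coverU (hN e) (hM e)).
  move=> x kx; apply: contrapT => /not_orP[/contrapT [a [b [d d0 hd]]] /contrapT [a' [b' [d' d'0 hd']]]].
  apply: kx; exists (a + a'), (b + b'), (Num.min d d'); first by rewrite lt_min d0.
  by move=> y; rewrite lt_min => /andP[/hd /= -> /hd' /= ->]; ring.
- exists N => e; apply: discrete_cover_sub (hN e) => x kx [a [b [d d0 hd]]].
  by apply: kx; exists (c * a), (c * b), d => // y /hd /= ->; ring.
- exists (N + (1 + 1))%N => e.
  pose f y := ev (upd e i y) t.
  pose Z0 := [set x | exists a b, [/\ affine_near f a b x, a != 0 & f x = 0]].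
  pose Z1 := [set x | exists a b, [/\ affine_near f a b x, a != 0 & is_power (f x)]].
  apply: (@discrete_cover_sub _ _ _ (kinks t e i `|` (Z0 `|` Z1))); last first.
    apply: discrete_coverU => //; apply: discrete_coverU; apply: discrete_cover1;
        apply: discrete_set_ball => x [a [b [fab a0 fx]]]; have fx' : f x = a * x + b := affine_nearP fab;
        case: fab => d d0 hd.
      exists d => // y [_ [_ [_ _ fy]]] /hd; rewrite -/(f y) fy => fy'.
      by apply: (mulfI a0); apply: (addIr b); rewrite -fy' -fx' fx.
    have fx0 := is_power_gt0 rho_ge2 fx.
    have r0 : 0 < rho by apply: lt_le_trans rho_ge2.
    (* Near [x] the values of [f] differ from [f x] by less than a factor [rho], which leaves no
       room for another power. *)
    have [d' d'0 hd'] : exists2 d', 0 < d' & forall y, `|y - x| < d' ->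
        f x < rho * f y /\ f y < rho * f x.
      have k1 : 0 < rho * a * x + (rho * b - f x).
        have -> : rho * a * x + (rho * b - f x) = rho * (a * x + b) - f x by ring.
        by rewrite -fx' subr_gt0 ltr_pMl//; apply: lt_le_trans rho_ge2; rewrite ltr1n.
      have k2 : 0 < - a * x + (rho * f x - b).
        have -> : - a * x + (rho * f x - b) = rho * f x - (a * x + b) by ring.
        by rewrite -fx' subr_gt0 ltr_pMl//; apply: lt_le_trans rho_ge2; rewrite ltr1n.
      have [d1 d10 h1] := affine_sign (lt0r_neq0 k1).
      have [d2 d20 h2] := affine_sign (lt0r_neq0 k2).
      exists (Num.min d (Num.min d1 d2)); first by rewrite !lt_min d0 d10.
      move=> y; rewrite !lt_min => /and3P[hy hy1 hy2].
      move: (h1 _ hy1) (h2 _ hy2); rewrite k1 k2 (hd _ hy) => g1 g2.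
      by split; lra.
    exists (Num.min d d'); first by rewrite lt_min d0.
    move=> y [_ [_ [_ _ fy]]]; rewrite lt_min => /andP[hy /hd' [g1 g2]].
    apply: (mulfI a0); apply: (addIr b); rewrite -hd// -fx'.
    case: (ltgtP (f y) (f x)) => // h.
      by have := is_power_lt rho_ge2 fy fx h; lra.
    by have := is_power_lt rho_ge2 fx fy h; lra.
  move=> x kx; apply: contrapT => /not_orP[/contrapT [a [b fab]]] /not_orP[nz0 nz1].
  apply: kx; have [a0|a0] := eqVneq a 0.
    case: fab => d d0 hd; exists 0, (lam b), d => // y /hd /=.
    by rewrite a0 !mul0r !add0r => ->.
  have fx0 : f x != 0 by apply/eqP => fx0; apply: nz0; exists a, b.
  have fxP : ~ is_power (f x) by move=> fxP; apply: nz1; exists a, b.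
  have fx' : f x = a * x + b := affine_nearP fab; case: fab => d d0 hd.
  move: (fx0); rewrite fx' => sx0.
  have [d1 d10 h1] := affine_sign sx0.
  have [fp|fn] := ltP 0 (f x); last first.
    exists 0, 0, (Num.min d d1); first by rewrite lt_min d0.
    move=> y; rewrite lt_min => /andP[/hd /= -> /h1 h1y].
    by rewrite mul0r addr0 lam_le0// leNgt h1y -fx' -leNgt.
  have [Pl /andP[l1 l2]] := lamP rho_ge2 fp.
  have l1' : lam (f x) < f x.
    by rewrite lt_neqAle l1 andbT; apply/eqP => h; apply: fxP; rewrite -h.
  have k1 : 0 < a * x + (b - lam (f x)) by rewrite addrA -fx' subr_gt0.
  have k2 : 0 < - a * x + (rho * lam (f x) - b).
    have -> : - a * x + (rho * lam (f x) - b) = rho * lam (f x) - (a * x + b) by ring.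
    by rewrite -fx' subr_gt0.
  have [d2 d20 h2] := affine_sign (lt0r_neq0 k1).
  have [d3 d30 h3] := affine_sign (lt0r_neq0 k2).
  exists 0, (lam (f x)), (Num.min d (Num.min d2 d3)); first by rewrite !lt_min d0 d20.
  move=> y; rewrite !lt_min => /and3P[/hd /= -> /h2 g2 /h3 g3].
  rewrite mul0r add0r; apply: lam_unique => //.
  by move: g2 g3; rewrite k1 k2 => g2 g3; apply/andP; split; lra.
Qed.

(** The truth value of [0 < t] can change only at a kink of [t] or at a zero where [t] has nonzero
    slope. *)
Lemma qf_jumps_cover i q : exists N, forall e, discrete_cover N
  [set x | ~ exists2 d, 0 < d &
     forall y, `|y - x| < d -> qs (upd e i y) q = qs (upd e i x) q].
Proof.
elim: q => [|t|q1 [N hN] q2 [M hM]].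
- exists 0%N => e; exists (fun=> set0); split=> [[]//|x []].
  by exists 1.
- have [N hN] := kinks_cover i t; exists (N + 1)%N => e.
  pose f y := ev (upd e i y) t.
  pose Z0 := [set x | exists a b, [/\ affine_near f a b x, a != 0 & f x = 0]].
  apply: (@discrete_cover_sub _ _ _ (kinks t e i `|` Z0)); last first.
    apply: discrete_coverU => //; apply: discrete_cover1.
    apply: discrete_set_ball => x [a [b [fab a0 fx]]]; have fx' : f x = a * x + b := affine_nearP fab;
        case: fab => d d0 hd.
    exists d => // y [_ [_ [_ _ fy]]] /hd; rewrite -/(f y) fy => fy'.
    by apply: (mulfI a0); apply: (addIr b); rewrite -fy' -fx' fx.
  move=> x kx; apply: contrapT => /not_orP[/contrapT [a [b fab]]] nz0.
  apply: kx; apply: (affine_locally_const_sign fab).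
  have [a0|a0] := eqVneq a 0; [by left|right].
  by apply/eqP => fx0; apply: nz0; exists a, b.
- exists (N + M)%N => e; apply: discrete_cover_sub (discrete_coverU (hN e) (hM e)).
  move=> x kx; apply: contrapT => /not_orP[/contrapT [d d0 hd] /contrapT [d' d'0 hd']].
  apply: kx; exists (Num.min d d'); first by rewrite lt_min d0.
  by move=> y; rewrite lt_min => /andP[/hd /= -> /hd' /= ->].
Qed.

(** A point of the fibre at which the truth value is locally constant is interior, so a fibre
    without interior consists of jumps. *)
Lemma def_fiber_d_minimal i B : def rho B -> exists N, forall e,
  let F := [set x : R | B (upd e i x)] in
  interior F !=set0 \/
  exists D : 'I_N -> set R, (forall k, discrete_set (D k)) /\ F = \bigcup_k D k.
Proof.
move=> [q hq]; have [N hN] := qf_jumps_cover i q; exists N => e F.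
have [|ni] := EM (interior F !=set0); first by left.
right; apply: discrete_cover_union; apply: discrete_cover_sub (hN e) => x Fx [d d0 hd].
apply: ni; exists x; rewrite /interior /=; apply/nbhs_ballP; exists d => //= y.
rewrite /ball /= distrC => /hd h; apply/hq; rewrite h; exact/hq.
Qed.

End DMinimal.

(** * Polynomially many patterns *)

Section PolynomialBounds.
Local Open Scope nat_scope.
Implicit Types f g : nat -> nat.

Definition pbounded f := exists C K, forall n, f n <= C * n.+1 ^ K.

Lemma pbounded_le f g : (forall n, f n <= g n) -> pbounded g -> pbounded f.
Proof. by move=> fg [C [K h]]; exists C, K => n; exact: leq_trans (h n). Qed.

Lemma pbounded_const c : pbounded (fun=> c).
Proof. by exists c, 0 => n; rewrite expn0 muln1. Qed.

Lemma pbounded_id : pbounded id.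
Proof. by exists 1, 1 => n; rewrite mul1n expn1. Qed.

Lemma pboundedM f g : pbounded f -> pbounded g -> pbounded (fun n => f n * g n).
Proof.
move=> [C [K h]] [C' [K' h']]; exists (C * C'), (K + K') => n.
by rewrite expnD mulnACA leq_mul.
Qed.

Lemma pboundedD f g : pbounded f -> pbounded g -> pbounded (fun n => f n + g n).
Proof.
move=> [C [K h]] [C' [K' h']]; exists (C + C'), (K + K') => n.
rewrite mulnDl leq_add// ?(leq_trans (h n))// ?(leq_trans (h' n))//;
  by rewrite leq_mul2l leq_pexp2l ?orbT// ?leq_addr ?leq_addl.
Qed.

Lemma pboundedS f : pbounded f -> pbounded (fun n => (f n).+1).
Proof.
move=> pf; apply: pbounded_le (pboundedD pf (pbounded_const 1)) => n.
by rewrite addn1.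
Qed.

Lemma pboundedX f k : pbounded f -> pbounded (fun n => f n ^ k).
Proof.
move=> pf; elim: k => [|k IH]; first by apply: pbounded_le (pbounded_const 1).
by apply: pbounded_le (pboundedM pf IH) => n; rewrite expnS.
Qed.

Lemma leq_expr m n k : m <= n -> m ^ k <= n ^ k.
Proof. by case: k => [//|k] mn; rewrite leq_exp2r. Qed.

Lemma poly_lt_exp C K : exists n, C * n.+1 ^ K < 2 ^ n.
Proof.
(* With [n.+1 = 2 ^ t] it suffices that [C + t * K < 2 ^ t], and [2 ^ t] is at least
   [s.+1 * s.+1]. *)
pose s := C + 2 * K + 1; pose t := s + s; exists (2 ^ t).-1.
rewrite prednK ?expn_gt0//; apply: (@leq_trans (2 ^ (C + t * K))).
  rewrite expnD expnM ltn_mul2r ltn_expl// andbT expn_gt0.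
  by rewrite expn_gt0.
rewrite leq_exp2l// -ltnS prednK ?expn_gt0// /t expnD.
have h : s.+1 * s.+1 <= 2 ^ s * 2 ^ s by rewrite leq_mul// ltn_expl.
apply: leq_trans h; have : (C + 2 * K) * s <= s * s by rewrite leq_mul2r /s leq_addr orbT.
have : 1 <= s by rewrite /s addn1.
move: s {t} => s; nia.
Qed.

Lemma pbounded_lt_exp f : pbounded f -> exists n, f n < 2 ^ n.
Proof.
move=> [C [K h]]; have [n hn] := poly_lt_exp C K.
by exists n; exact: leq_ltn_trans hn.
Qed.

End PolynomialBounds.

Section PositionCode.
Variables (R : realType) (I : finType) (tau : I -> R).

(** The sets of thresholds below [s] form a chain as [s] varies, so their cardinalities determine
    them. This gives quadratically many codes, where arbitrary sets of thresholds would be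
    exponentially many. *)
Definition position_code (s : R) : 'I_(#|I|).+1 * 'I_(#|I|).+1 :=
  (inord #|[set i | tau i < s]%SET|, inord #|[set i | tau i <= s]%SET|).

Lemma position_codeP s s' : position_code s = position_code s' ->
  forall i, (tau i < s) = (tau i < s') /\ (tau i <= s) = (tau i <= s').
Proof.
wlog ss' : s s' / s <= s'.
  move=> h e i; have [l|l] := leP s s'; first exact: h.
  by have [-> ->] := h _ _ (ltW l) (esym e) i.
have card_lt (A : {set I}) : (#|A| < #|I|.+1)%N by rewrite ltnS max_card.
move=> [] /(congr1 val) /=; rewrite !inordK ?card_lt// => e1 /(congr1 val) /=.
rewrite !inordK ?card_lt// => e2 i.
have e1' : [set i | tau i < s]%SET = [set i | tau i < s']%SET.
  apply/eqP; rewrite eqEcard e1 leqnn andbT; apply/fintype.subsetP => k.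
  by rewrite !inE => /lt_le_trans; apply.
have e2' : [set i | tau i <= s]%SET = [set i | tau i <= s']%SET.
  apply/eqP; rewrite eqEcard e2 leqnn andbT; apply/fintype.subsetP => k.
  by rewrite !inE => /le_trans; apply.
by move/setP/(_ i): e1'; move/setP/(_ i): e2'; rewrite !inE.
Qed.

End PositionCode.

Section Counting.
Variables (R : realType) (rho : R).
Hypothesis rho_ge2 : 2 <= rho.
Variable inX : pred nat.

Local Notation ev := (ev rho).
Local Notation qs := (qs rho).
Local Notation lam := (lam rho).
Local Notation steps := (steps rho).

Definition mix (T : Type) (x y : nat -> T) (j : nat) : T := if inX j then x j else y j.

(* The constants [c] depend on [x] only through one of polynomially many codes,
   and the number of functions [z] does not depend on [N]. *)
Definition coded_term (t : tm R) := exists (F : finType) (f : nat -> nat),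
  pbounded f /\ forall N (y : 'I_N -> nat -> R),
  exists (M : finType) (code : (nat -> R) -> M) (z : (nat -> R) -> F -> R)
    (l : M -> 'I_N -> F) (c : M -> 'I_N -> R),
  (#|M| <= f N)%N /\
  forall x j, ev (mix x (y j)) t = z x (l (code x) j) + c (code x) j.

Definition step (k : 'I_3) : R := nth 0 steps k.

Lemma stepP c : c \in steps -> exists k, step k = c.
Proof.
move=> cs; have h : (index c steps < 3)%N by rewrite -[3%N]/(size steps) index_mem.
by exists (Ordinal h); rewrite /step nth_index.
Qed.

Lemma step_power k : is_power rho (step k).
Proof. by apply: steps_power; rewrite /step mem_nth. Qed.

(** By the triangle inequality [|e|] and [|c - c0|] are at most twice [s + c], and the larger of
    them is at least half of it. *)
Lemma lam_shift_cases (s c c0 : R) (e := s + c0) : `|e| <= `|s + c| -> 0 < s + c ->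
  exists k, lam (s + c) = step k * lam `|c - c0| \/ lam (s + c) = step k * lam `|e|.
Proof.
move=> h sc; have h0 : 0 <= `|e| by [].
have r2 (t : R) : 0 < t -> 2 * t <= rho * t by move=> t0; rewrite ler_pM2r.
rewrite (gtr0_norm sc) in h.
have h1 : s + c <= `|c - c0| + `|e|.
  have -> : s + c = (c - c0) + e by rewrite /e; ring.
  by apply: lerD; apply: ler_norm.
have h2 : `|c - c0| <= (s + c) + `|e|.
  have -> : c - c0 = (s + c) - e by rewrite /e; ring.
  by apply: le_trans (ler_normB _ _) _; rewrite (gtr0_norm sc).
have r2sc := r2 _ sc.
have [le|lt] := leP `|c - c0| `|e|.
  have e0 : 0 < `|e| by lra.
  have [| |d ds hd] := @lam_close _ _ rho_ge2 (s + c) `|e| sc e0.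
  - by have := r2 _ e0; lra.
  - by lra.
  by have [k kd] := stepP ds; exists k; right; rewrite kd.
have d0 : 0 < `|c - c0| by lra.
have [| |d ds hd] := @lam_close _ _ rho_ge2 (s + c) `|c - c0| sc d0.
- by have := r2 _ d0; lra.
- by lra.
by have [k kd] := stepP ds; exists k; left; rewrite kd.
Qed.

(* For each [g], let [c0] be the constant closest to [- z x g]. Then [z x g + c] is
   comparable with the larger of [|c - c0|], which no longer depends on [x], and
   [|z x g + c0|], which no longer depends on [c]. *)
Lemma coded_lam t : coded_term t -> coded_term (TL t).
Proof.
move=> [F [f [pf h]]].
pose e n := (f n * n).+1.
pose i1 n := (e n * (e n * 3 * 2).+1)%N.
pose f' n := (f n * (e n ^ #|F|) * (((i1 n).+1 * (i1 n).+1) ^ #|F|) *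
   (((e n).+1 * (e n).+1) ^ (#|F| * 3 * 2)))%N.
have pe : pbounded e by apply/pboundedS/pboundedM => //; exact: pbounded_id.
have pi1 : pbounded i1.
  apply: pboundedM => //; apply: pboundedS; apply: pboundedM (pbounded_const _).
  exact: pboundedM (pbounded_const _).
exists (option (F * 'I_3)%type), f'; split.
  apply: pboundedM; first apply: pboundedM; first apply: pboundedM => //.
  - exact: pboundedX.
  - by apply: pboundedX; apply: pboundedM; apply: pboundedS.
  - by apply: pboundedX; apply: pboundedM; apply: pboundedS.
move=> N y; have [M [code [z [l [c [cM hz]]]]]] := h N y.
(* The extra element, with constant 0, makes the index set nonempty, so that a closest constant
   exists even for [N = 0]. *)
pose E : finType := option (M * 'I_N)%type.
pose cE (i : E) : R := if i is Some (m, j) then c m j else 0.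
have cardE : (#|E| <= e N)%N.
  by rewrite /E card_option card_prod card_ord /e ltnS leq_mul2r cM orbT.
pose near x g : E := [arg min_(i < None : E) `|z x g + cE i|]%O.
have nearP x g i : `|z x g + cE (near x g)| <= `|z x g + cE i|.
  by rewrite /near; case: Order.TotalTheory.arg_minP => // i0 _; apply.
pose eps x g := z x g + cE (near x g).
pose I1 : finType := (E * option (E * 'I_3 * bool))%type.
pose fac (b : bool) : R := if b then rho else 1.
(* The first kind of threshold decides the sign of [z + c_i]. The second decides [K <= z + c_i] and
   [rho * K <= z + c_i] for each possible value [K] of [lam] that does not depend on [x]. *)
pose tau1 (i : I1) : R := match i with
  | (i, None) => - cE i
  | (i, Some (i0, k, b)) => fac b * (step k * lam `|cE i - cE i0|) - cE i
  end.
pose tau2 (i : E) : R := - cE i.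
have cardI1 : (#|I1| <= i1 N)%N.
  have cI1 (A : finType) : #|{: A * option (A * 'I_3 * bool)}| = (#|A| * (#|A| * 3 * 2).+1)%N.
    by rewrite card_prod card_option !card_prod card_ord card_bool.
  rewrite /I1 cI1 /i1.
  by rewrite leq_mul// ltnS !leq_mul2r cardE.
pose P1 : finType := ('I_(#|I1|).+1 * 'I_(#|I1|).+1)%type.
pose P2 : finType := ('I_(#|E|).+1 * 'I_(#|E|).+1)%type.
pose M' : finType := (M * {ffun F -> E} * {ffun F -> P1} *
   {ffun F * 'I_3 * bool -> P2})%type.
(* The last component treats the values [K = step k * lam |eps x g|], which depend on [x]: the
   position of [z - K] and [z - rho * K] among the numbers [- c_i] decides
   [K <= z + c_i < rho * K]. *)
pose code' x : M' := (code x, [ffun g => near x g],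
  [ffun g => position_code tau1 (z x g)],
  [ffun g => position_code tau2 (z x g.1.1 - fac g.2 * (step g.1.2 * lam `|eps x g.1.1|))]).
pose z' x (o : option (F * 'I_3)) : R :=
  if o is Some (g, k) then step k * lam `|eps x g| else 0.
have code'P x x' : code' x = code' x' ->
  [/\ code x = code x', forall g, near x g = near x' g,
   forall g i, (tau1 i < z x g) = (tau1 i < z x' g) /\
               (tau1 i <= z x g) = (tau1 i <= z x' g) &
   forall g k b i,
     (tau2 i <= z x g - fac b * (step k * lam `|eps x g|)) =
     (tau2 i <= z x' g - fac b * (step k * lam `|eps x' g|))].
  move=> [-> /ffunP e1 /ffunP e2 /ffunP e3]; split=> //.
  - by move=> g; have := e1 g; rewrite !ffunE.
  - by move=> g i; have := e2 g; rewrite !ffunE => /position_codeP/(_ i).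
  - move=> g k b i; have := e3 (g, k, b); rewrite !ffunE /=.
    by move=> /position_codeP/(_ i)[].
(* One representative [x0] of the code selects the case. Every comparison involved is part of the
   code, so the same case applies to all [x] with this code. *)
have key (mj : M' * 'I_N) : exists lc : option (F * 'I_3) * R, forall x,
    code' x = mj.1 -> ev (mix x (y mj.2)) (TL t) = z' x lc.1 + lc.2.
  case: mj => m j /=.
  have [[x0 x0m]|nox] := EM (exists x, code' x = m); last first.
    by exists (None, 0) => x xm; exfalso; apply: nox; exists x.
  pose i : E := Some (code x0, j); pose g := l (code x0) j.
  have ci : cE i = c (code x0) j by [].
  have val x : code' x = m -> ev (mix x (y j)) t = z x g + cE i.
    by rewrite -x0m => /code'P[e1 _ _ _]; rewrite hz e1.
  have [pos|npos] := ltP 0 (z x0 g + cE i); last first.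
    exists (None, 0) => x xm; rewrite val// addr0 /=; apply: lam_le0.
    have [_ _ /(_ g (i, None)) [+ _] _] := code'P _ _ (etrans xm (esym x0m)).
    rewrite /= => hc; rewrite leNgt; apply/negP => k.
    have : - cE i < z x0 g by rewrite -hc; lra.
    by rewrite ltNge => /negP; apply; lra.
  have [k [hk|hk]] := lam_shift_cases (nearP x0 g i) pos.
    exists (None, step k * lam `|cE i - cE (near x0 g)|) => x xm.
    rewrite val// add0r /= -/(step k * _).
    have [Pl /andP[l1 l2]] := lamP rho_ge2 pos.
    have [_ _ hc _] := code'P _ _ (etrans xm (esym x0m)).
    have [_ c1] := hc g (i, Some (near x0 g, k, false)).
    have [_ c2] := hc g (i, Some (near x0 g, k, true)).
    rewrite hk in Pl l1 l2; apply: lam_unique => //; move: c1 c2 Pl l1 l2.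
    rewrite /= /fac mul1r; move: (step k * _) => K c1 c2 Pl l1 l2.
    apply/andP; split.
      have : K - cE i <= z x g by rewrite c1; lra.
      lra.
    rewrite ltNge; apply/negP => l3.
    have : rho * K - cE i <= z x0 g by rewrite -c2; lra.
    lra.
  exists (Some (g, k), 0) => x xm.
  rewrite val// addr0 /=.
  have [Pl /andP[l1 l2]] := lamP rho_ge2 pos.
  have [_ _ _ hc] := code'P _ _ (etrans xm (esym x0m)).
  have c1 := hc g k false i; have c2 := hc g k true i.
  rewrite hk -/(eps x0 g) in l1 l2; move: c1 c2 l1 l2.
  rewrite /= /fac /tau2 !mul1r.
  have : 0 <= step k * lam `|eps x g|.
    by rewrite mulr_ge0 ?lam_ge0// ltW//; apply: is_power_gt0 (step_power k).
  have : 0 < step k * lam `|eps x g| -> is_power rho (step k * lam `|eps x g|).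
    move=> p; apply: is_powerM => //; first exact: step_power.
    apply: lam_gt0P => //; rewrite lt_neqAle lam_ge0// andbT eq_sym.
    by apply: contraTneq p => ->; rewrite mulr0 ltxx.
  move: (step k * lam `|eps x g|) (step k * lam `|eps x0 g|) => K K0 PK K_ge0 c1 c2 l1 l2.
  have h1 : - cE i <= z x g - K by rewrite c1; lra.
  have h2 : z x g + cE i < rho * K.
    rewrite ltNge; apply/negP => l3.
    have : - cE i <= z x0 g - rho * K0 by rewrite -c2; lra.
    lra.
  apply: lam_unique => //; last by apply/andP; split; lra.
  apply: PK; rewrite lt_neqAle K_ge0 andbT; apply/eqP => K0'; move: h1 h2.
  by rewrite -K0' mulr0; lra.
have [lc hlc] := choice key.
exists M', code', z', (fun m j => (lc (m, j)).1), (fun m j => (lc (m, j)).2); split.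
  have cM' (A B D P Q : finType) :
      #|{: A * {ffun D -> B} * {ffun D -> P} * {ffun D * 'I_3 * bool -> Q}}| =
      (#|A| * #|B| ^ #|D| * #|P| ^ #|D| * #|Q| ^ (#|D| * 3 * 2))%N.
    by rewrite !card_prod !card_ffun !card_prod card_ord card_bool.
  have cP (n : nat) : #|{: 'I_n * 'I_n}| = (n * n)%N by rewrite card_prod card_ord.
  rewrite /M' cM' /P1 /P2 !cP /f'.
  apply: leq_mul; first apply: leq_mul; first apply: leq_mul => //; apply: leq_expr => //.
    by apply: leq_mul; rewrite ltnS.
  by apply: leq_mul; rewrite ltnS.
by move=> x j; apply: (hlc (code' x, j)).
Qed.

Lemma coded_termP t : coded_term t.
Proof.
elim: t => [i|c|t [F [f [pf h]]] u [F' [f' [pf' h']]]|a t [F [f [pf h]]]|t]; last exact: coded_lam.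
- exists bool, (fun=> 1%N); split; first exact: pbounded_const.
  move=> N y; exists unit, (fun=> tt), (fun x b => if b then x i else 0),
    (fun _ _ => inX i), (fun _ j => if inX i then 0 else y j i).
  rewrite card_unit; split=> // x j /=; rewrite /mix.
  by case: ifP; rewrite ?addr0 ?add0r.
- exists unit, (fun=> 1%N); split; first exact: pbounded_const.
  move=> N y; exists unit, (fun=> tt), (fun _ _ => 0), (fun _ _ => tt), (fun _ _ => c).
  by rewrite card_unit; split=> // x j /=; rewrite add0r.
- exists (F * F')%type, (fun n => f n * f' n)%N; split; first exact: pboundedM.
  move=> N y; have [M [code [z [l [c [cM hz]]]]]] := h N y.
  have [M' [code' [z' [l' [c' [cM' hz']]]]]] := h' N y.
  exists (M * M')%type, (fun x => (code x, code' x)),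
    (fun x g => z x g.1 + z' x g.2), (fun m j => (l m.1 j, l' m.2 j)),
    (fun m j => c m.1 j + c' m.2 j).
  split; first by rewrite card_prod leq_mul.
  by move=> x j; rewrite /= hz hz'; ring.
- exists F, f; split=> // N y; have [M [code [z [l [c [cM hz]]]]]] := h N y.
  exists M, code, (fun x g => a * z x g), l, (fun m j => a * c m j); split=> // x j.
  by rewrite /= hz mulrDr.
Qed.

Definition few_patterns (B : (nat -> R) -> Prop) := exists f : nat -> nat,
  pbounded f /\ forall N (y : 'I_N -> nat -> R),
  exists (M : finType) (code : (nat -> R) -> M), (#|M| <= f N)%N /\
  forall x x', code x = code x' -> forall j, B (mix x (y j)) <-> B (mix x' (y j)).

(** By [coded_termP] an atom reads [0 < z + c], so beyond the code of the term only the position of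
    each [z] among the numbers [- c] is recorded. *)
Lemma def_few_patterns B : def rho B -> few_patterns B.
Proof.
move=> [q hq].
suff [f [pf h]] : few_patterns (fun e => qs e q).
  exists f; split=> // N y; have [M [code [cM hc]]] := h N y.
  by exists M, code; split=> // x x' /hc e j; rewrite !hq.
elim: q {B hq} => [|t|q1 [f [pf h]] q2 [f' [pf' h']]].
- exists (fun=> 1%N); split; first exact: pbounded_const.
  by move=> N y; exists unit, (fun=> tt); rewrite card_unit.
- have [F [f [pf h]]] := coded_termP t.
  have pg : pbounded (fun n => (f n * n).+1) := pboundedS (pboundedM pf pbounded_id).
  exists (fun n => f n * ((f n * n).+1 * (f n * n).+1) ^ #|F|)%N; split.
    by apply: pboundedM => //; apply: pboundedX; exact: pboundedM.
  move=> N y; have [M [code [z [l [c [cM hz]]]]]] := h N y.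
  pose I : finType := (M * 'I_N)%type.
  pose tau (i : I) : R := - c i.1 i.2.
  exists (M * {ffun F -> 'I_(#|I|).+1 * 'I_(#|I|).+1})%type,
    (fun x => (code x, [ffun g => position_code tau (z x g)])); split.
    have cI : (#|I|.+1 <= (f N * N).+1)%N.
      by rewrite /I card_prod card_ord ltnS leq_mul2r cM orbT.
    rewrite card_prod card_ffun card_prod !card_ord leq_mul// leq_expr//.
    exact: leq_mul.
  move=> x x' [e1 /ffunP e2] j; rewrite /= !hz e1.
  have := e2 (l (code x') j); rewrite !ffunE => /position_codeP/(_ (code x', j))[+ _].
  rewrite /tau /= => h1.
  by rewrite -(ltrBlDr 0) sub0r h1 -(ltrBlDr 0) sub0r.
- exists (fun n => f n * f' n)%N; split; first exact: pboundedM.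
  move=> N y; have [M [code [cM hc]]] := h N y; have [M' [code' [cM' hc']]] := h' N y.
  exists (M * M')%type, (fun x => (code x, code' x)); split.
    by rewrite card_prod leq_mul.
  move=> x x' [e1 e2] j /=.
  have := hc _ _ e1 j; have := hc' _ _ e2 j => h2 h1.
  by split=> /implyP h3; apply/implyP => /h1 /h3 /h2.
Qed.

Lemma few_patterns_no_shattering B : few_patterns B -> exists N,
  forall (y : 'I_N -> nat -> R) (x : {set 'I_N} -> nat -> R),
  ~ forall J i, B (mix (x J) (y i)) <-> i \in J.
Proof.
move=> [f [pf h]]; have [N hN] := pbounded_lt_exp pf; exists N => y x sh.
have [M [code [cM hc]]] := h N y.
have inj : injective (fun J => code (x J)).
  by move=> J J' /hc e; apply/setP => i; apply/idP/idP => /sh/e/sh.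
have := leq_card _ inj; rewrite leqNgt => /negP; apply.
have := card_powerset [set: 'I_N]%SET; rewrite powersetT !cardsT card_ord => ->.
exact: leq_ltn_trans hN.
Qed.

End Counting.

(** * Words and their values *)

Section Words.
Variable T : Type.
Implicit Types (w : word T) (u : seq T).

Definition wcons (a : T) w : word T := fun n => if n is k.+1 then w k else a.
Definition wcat u w : word T := foldr wcons w u.
Definition wtake n w : seq T := mkseq w n.
Definition wdrop n w : word T := fun i => w (n + i)%N.
Definition upow u n : seq T := flatten (nseq n u).

Lemma size_wtake n w : size (wtake n w) = n. Proof. exact: size_mkseq. Qed.

Lemma wtakeS n w : wtake n.+1 w = w 0%N :: wtake n (wdrop 1 w).
Proof.
by rewrite /wtake /mkseq /= (iotaDl 1 0 n) -map_comp.
Qed.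

Lemma wcons_drop w : wcons (w 0%N) (wdrop 1 w) = w.
Proof. by apply: funext => -[|n]. Qed.

Lemma wdropD m n w : wdrop m (wdrop n w) = wdrop (n + m) w.
Proof. by apply: funext => i; rewrite /wdrop addnA. Qed.

Lemma wcat_take_drop n w : wcat (wtake n w) (wdrop n w) = w.
Proof.
elim: n w => [|n IH] w; first by apply: funext.
by rewrite wtakeS /= -[X in _ = X]wcons_drop -[in RHS](IH (wdrop 1 w)) wdropD.
Qed.

Lemma wcat_cat u v w : wcat (u ++ v) w = wcat u (wcat v w).
Proof. exact: foldr_cat. Qed.

Lemma wcatE u w x0 n : wcat u w n = if (n < size u)%N then nth x0 u n else w (n - size u)%N.
Proof.
by elim: u n => [|a u IH] [|n] //=.
Qed.

Lemma wtake_cat u w n : (n <= size u)%N -> wtake n (wcat u w) = take n u.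
Proof.
elim: u n => [|a u IH] [|n] //.
by rewrite ltnS wtakeS /= => nu; rewrite -IH//; congr (_ :: wtake _ _); apply: funext.
Qed.

Lemma wtake_cat_size u w : wtake (size u) (wcat u w) = u.
Proof. by rewrite wtake_cat// take_size. Qed.

Lemma wdrop_cat u w : wdrop (size u) (wcat u w) = w.
Proof.
elim: u => [|a u IH]; first by apply: funext.
by rewrite -[in RHS]IH; apply: funext.
Qed.

Lemma wtake_eq n w w' : wtake n w = wtake n w' <-> forall i, (i < n)%N -> w i = w' i.
Proof.
split=> [h i ilt|h]; last first.
  apply: (@eq_from_nth _ (w 0%N)); rewrite ?size_wtake// => i ilt.
  by rewrite !nth_mkseq// h.
by have := congr1 (fun s => nth (w 0%N) s i) h; rewrite !nth_mkseq.
Qed.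

Lemma wtake_wtake m n w : (m <= n)%N -> take m (wtake n w) = wtake m w.
Proof. by move=> mn; rewrite -{2}(wcat_take_drop n w) wtake_cat ?size_wtake. Qed.

Lemma wtake_add n m w : wtake (n + m) w = wtake n w ++ wtake m (wdrop n w).
Proof. by rewrite /wtake /mkseq iotaD map_cat (addnC 0 n) iotaDl -map_comp. Qed.

Lemma wtakeSr n w : wtake n.+1 w = rcons (wtake n w) (w n).
Proof. by rewrite -addn1 wtake_add cats1 /wdrop addn0. Qed.

Lemma upowS u n : upow u n.+1 = u ++ upow u n. Proof. by []. Qed.

Lemma size_upow u n : size (upow u n) = (n * size u)%N.
Proof. by elim: n => [|n IH] //; rewrite upowS size_cat IH mulSn. Qed.

End Words.

Lemma wcat_map (T T' : Type) (f : T -> T') u (w : word T) :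
  (fun i => f (wcat u w i)) = wcat [seq f a | a <- u] (fun i => f (w i)).
Proof. by elim: u => //= a u <-; apply: funext => -[]. Qed.

Lemma wtake_map (T T' : Type) (f : T -> T') n (w : word T) :
  wtake n (fun i => f (w i)) = [seq f a | a <- wtake n w].
Proof. by rewrite /wtake /mkseq -map_comp. Qed.

Section Nu.
Variables (R : realType) (r : nat).
Hypothesis r_gt1 : (1 < r)%N.
Implicit Types (w : word 'I_r) (u : seq 'I_r).

Local Notation rr := (r%:R : R).

Let r0 : 0 < rr. Proof. by rewrite ltr0n; apply: ltn_trans r_gt1. Qed.

Lemma digit_le (a : 'I_r) : (a%:R : R) + 1 <= rr.
Proof. by rewrite natr1 ler_nat. Qed.

Let term w (i : nat) : R := (w i)%:R * rr ^- i.+1.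

Let term_ge0 w i : 0 <= term w i.
Proof. by rewrite mulr_ge0// invr_ge0 exprn_ge0// ltW. Qed.

Let series_ub w n : series (term w) n <= 1 - rr ^- n.
Proof.
elim: n => [|n IH]; first by rewrite /series /= big_geq// expr0 invr1 subrr.
rewrite seriesSr; apply: le_trans (lerD IH (lexx _)) _.
have d := digit_le (w n).
have -> : rr ^- n = rr * rr ^- n.+1 by rewrite exprS invfM mulVKf ?gt_eqF.
rewrite /term; have : 0 < rr ^- n.+1 by rewrite invr_gt0 exprn_gt0.
move: (rr ^- n.+1) => x x0.
have : ((w n)%:R + 1) * x <= rr * x by rewrite ler_pM2r.
lra.
Qed.

Lemma nu_is_cvg w : cvgn (series (term w)).
Proof.
apply: nondecreasing_is_cvgn.
  by apply/nondecreasing_seqP => n; rewrite seriesSr lerDl.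
exists 1 => _ [n _ <-]; apply: le_trans (series_ub _ _) _.
by rewrite gerBl invr_ge0 exprn_ge0// ltW.
Qed.

Lemma nu_ge0 w : 0 <= nu R w.
Proof.
apply: limr_ge; first exact: nu_is_cvg.
by apply: nearW => n; rewrite sumr_ge0.
Qed.

Lemma nu_le1 w : nu R w <= 1.
Proof.
apply: limr_le; first exact: nu_is_cvg.
apply: nearW => n; apply: le_trans (series_ub _ _) _.
by rewrite gerBl invr_ge0 exprn_ge0// ltW.
Qed.

Lemma nu_cons a w : nu R (wcons a w) = (a%:R + nu R w) / rr.
Proof.
rewrite /nu -/(term w) -/(term (wcons a w)).
have h : series (term (wcons a w)) \o S =
    (fun n => (a%:R + series (term w) n) / rr).
  apply: funext => n /=; rewrite /series /= big_nat_recl// /term /= expr1 mulrDl.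
  congr (_ + _); rewrite mulr_suml; apply: eq_bigr => i _.
  by rewrite -mulrA -invfM -exprSr.
apply: cvg_lim => //; rewrite -cvg_shiftS.
rewrite [X in X @ _ --> _](_ : _ = (fun n => (a%:R + series (term w) n) / rr)); last exact: h.
apply: cvgMl; apply: cvgD; first exact: cvg_cst.
exact: nu_is_cvg.
Qed.

Fixpoint wval u : R := if u is a :: u' then (a%:R + wval u') / rr else 0.

Lemma nu_cat u w : nu R (wcat u w) = wval u + rr ^- size u * nu R w.
Proof.
elim: u => [|a u IH] /=; first by rewrite expr0 invr1 mul1r add0r.
by rewrite nu_cons IH exprS invfM; field; rewrite ?expf_neq0 ?gt_eqF.
Qed.

Lemma wval_cat u v : wval (u ++ v) = wval u + rr ^- size u * wval v.
Proof.
elim: u => [|a u IH] /=; first by rewrite expr0 invr1 mul1r add0r.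
by rewrite IH exprS invfM; field; rewrite ?expf_neq0 ?gt_eqF.
Qed.

Lemma nu_split n w : nu R w = wval (wtake n w) + rr ^- n * nu R (wdrop n w).
Proof. by rewrite -{1}(wcat_take_drop n w) nu_cat size_wtake. Qed.

Lemma scale_gt0 n : 0 < rr ^- n.
Proof. by rewrite invr_gt0 exprn_gt0. Qed.

Lemma nu_wtake n w w' : wtake n w = wtake n w' -> `|nu R w - nu R w'| <= rr ^- n.
Proof.
move=> h; rewrite (nu_split n w) (nu_split n w') h.
have := nu_ge0 (wdrop n w); have := nu_ge0 (wdrop n w').
have := nu_le1 (wdrop n w); have := nu_le1 (wdrop n w').
move: (nu R _) (nu R _) => x y x1 y1 x0 y0.
rewrite opprD addrACA subrr add0r -mulrBr normrM gtr0_norm ?scale_gt0//.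
by rewrite ger_pMr ?scale_gt0// ler_norml; apply/andP; split; lra.
Qed.

Lemma wval_ge0 u : 0 <= wval u.
Proof. by elim: u => //= a u IH; rewrite divr_ge0 ?addr_ge0// ltW. Qed.

Lemma wval_ub u : wval u + rr ^- size u <= 1.
Proof.
elim: u => [|a u IH] /=; first by rewrite expr0 invr1 add0r.
rewrite exprS invfM mulrC -mulrDr mulrC ler_pdivrMr// mul1r.
by have := digit_le a; lra.
Qed.

Lemma scale_small (e : R) : 0 < e -> exists n, rr ^- n < e.
Proof.
move=> e0; have r1 : `|rr^-1| < 1.
  by rewrite gtr0_norm ?invr_gt0// invf_lt1// ltr1n.
have := cvg_expr r1 => /cvgrPdist_lt /(_ _ e0) [n _ /(_ n (leqnn n))] /=.
rewrite sub0r normrN exprVn ger0_norm => [h|]; last by rewrite invr_ge0 exprn_ge0// ltW.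
by exists n.
Qed.

(** The strict bounds matter: an end of the cylinder can have a second expansion that does not start
    with [u]. *)
Lemma nu_prefix u w : wval u < nu R w < wval u + rr ^- size u ->
  wtake (size u) w = u.
Proof.
elim: u w => [|a u IH] w //=.
rewrite wtakeS -{1 2}(wcons_drop w) nu_cons exprS invfM.
have -> : (a%:R + wval u) / rr + rr^-1 / rr ^+ size u = (a%:R + (wval u + rr ^- size u)) / rr.
  by field; rewrite ?expf_neq0 ?gt_eqF.
rewrite !ltr_pM2r ?invr_gt0// => /andP[h1 h2].
have := nu_ge0 (wdrop 1 w); have := nu_le1 (wdrop 1 w).
have := wval_ge0 u; have := wval_ub u => u1 u0 n1 n0.
have le1 : (a%:R : R) < (w 0%N).+1%:R by rewrite -natr1; lra.
have le2 : ((w 0%N)%:R : R) < a.+1%:R by rewrite -natr1; lra.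
have e : w 0%N = a.
  by apply/val_inj/eqP; move: le1 le2; rewrite !ltr_nat !ltnS eqn_leq /= => -> ->.
by rewrite e; congr cons; apply: IH; rewrite e in h1 h2; apply/andP; split; lra.
Qed.

(** Values of words of length [n] are integers divided by [r ^ n]. *)
Lemma wval_lt_separated u v : size u = size v -> wval u < wval v ->
  wval u + rr ^- size u <= wval v.
Proof.
elim: u v => [|a u IH] [|b v] //=; first by rewrite ltxx.
move=> [e]; rewrite ltr_pM2r ?invr_gt0// => h.
rewrite exprS invfM mulrC -mulrDr mulrC ler_pM2r ?invr_gt0//.
have := wval_ge0 u; have := wval_ub u; have := wval_ge0 v; have := wval_ub v => v1 v0 u1 u0.
have s0 := scale_gt0 (size v).
case: (ltngtP a b) => ab.
- have : a.+1%:R <= b%:R :> R by rewrite ler_nat.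
  by rewrite -natr1; lra.
- have : b.+1%:R <= a%:R :> R by rewrite ler_nat.
  by rewrite -natr1; lra.
- rewrite ab in h *; have : wval u + rr ^- size u <= wval v by apply: IH => //; lra.
  by lra.
Qed.

Lemma wval_inj u v : size u = size v -> wval u = wval v -> u = v.
Proof.
elim: u v => [|a u IH] [|b v] //= [e].
move/(mulIf (lt0r_neq0 _)) => /(_ _) h.
have {}h : a%:R + wval u = b%:R + wval v.
  by apply: h; rewrite invr_gt0.
have := wval_ge0 u; have := wval_ub u; have := wval_ge0 v; have := wval_ub v => v1 v0 u1 u0.
have s0 := scale_gt0 (size v); have s1 := scale_gt0 (size u).
case: (ltngtP a b) => ab.
- have : a.+1%:R <= b%:R :> R by rewrite ler_nat.
  by rewrite -natr1 => ?; exfalso; clear e; lra.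
- have : b.+1%:R <= a%:R :> R by rewrite ler_nat.
  by rewrite -natr1 => ?; exfalso; clear e; lra.
- have ab' : a = b by apply: ord_inj.
  by rewrite ab' in h *; congr cons; apply: IH => //; clear e; lra.
Qed.

End Nu.

(** * Sparse sets are definable *)

Section Runs.
Variables (Sigma : finType) (B : buchi Sigma).
Local Notation Q := (state B).
Implicit Types (S : {set Q}) (q : Q) (u : seq Sigma) (w : word Sigma).

(** Only the states entered have to lie in [S]; this set shrinks in the induction on runs. *)
Fixpoint rpath S q u q' : Prop :=
  if u is a :: u' then exists q1, [/\ q1 \in S, trans q a q1 & rpath S q1 u' q']
  else q = q'.

Definition accepted S q w : Prop := exists rho : nat -> Q,
  [/\ rho 0%N = q, forall n, trans (rho n) (w n) (rho n.+1), forall n, rho n \in S &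
      forall n, exists2 k, (n <= k)%N & rho k \in accept B].

Lemma rpath_cat S q u q1 v q2 : rpath S q u q1 -> rpath S q1 v q2 ->
  rpath S q (u ++ v) q2.
Proof.
elim: u q => [|a u IH] q /=; first by move=> ->.
by move=> [q' [q'S t p]] p2; exists q'; split=> //; apply: IH p2.
Qed.

Lemma rpath_sub S S' q u q' : S \subset S' -> rpath S q u q' -> rpath S' q u q'.
Proof.
move=> /fintype.subsetP sub; elim: u q => [|a u IH] q //= [q1 [qS t p]].
by exists q1; split; [exact: sub|exact: t|exact: IH].
Qed.

Lemma rpath_upow S q u n : rpath S q u q -> rpath S q (upow u n) q.
Proof. by move=> p; elim: n => [|n IH] //; rewrite upowS; exact: rpath_cat IH. Qed.

Lemma rpath_run S (rho : nat -> Q) w n :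
  (forall n, trans (rho n) (w n) (rho n.+1)) -> (forall n, rho n \in S) ->
  rpath S (rho 0%N) (wtake n w) (rho n).
Proof.
elim: n rho w => [|n IH] rho w t m; rewrite ?wtakeS //=.
exists (rho 1%N); split=> //; exact: (IH (fun i => rho i.+1) (wdrop 1 w)).
Qed.

Lemma accepted_start S q w : accepted S q w -> q \in S.
Proof. by move=> [rho [<- _ h _]]. Qed.

Lemma accepted_sub S S' q w : S \subset S' -> accepted S q w -> accepted S' q w.
Proof.
move=> /fintype.subsetP sub [rho [r0 t m a]]; exists rho; split=> // n.
by apply: sub.
Qed.

Lemma accepted_cons S q a q1 w : q \in S -> trans q a q1 -> accepted S q1 w ->
  accepted S q (wcons a w).
Proof.
move=> qS t [rho [r0 h m acc]]; exists (fun n => if n is k.+1 then rho k else q).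
split=> // [[|n]|[|n]|n] //=; first by rewrite r0.
by have [k nk ak] := acc n; exists k.+1; rewrite // ltnW.
Qed.

Lemma accepted_cat S q u q1 w : q \in S -> rpath S q u q1 -> accepted S q1 w ->
  accepted S q (wcat u w).
Proof.
elim: u q => [|a u IH] q /= qS; first by move=> ->.
by move=> [q' [q'S t p]] acc; apply: (accepted_cons qS t); exact: IH.
Qed.

Lemma accepted_drop S q w n : accepted S q w -> exists q',
  rpath S q (wtake n w) q' /\ accepted S q' (wdrop n w).
Proof.
move=> [rho [<- t m a]]; exists (rho n); split; first exact: rpath_run.
exists (fun i => rho (n + i)%N); split=> // [|i|i]; first by rewrite addn0.
  by rewrite addnS; exact: t.
have [k ik ak] := a (n + i)%N; exists (k - n)%N; first lia.
by rewrite subnKC//; lia.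
Qed.

Definition recurrent S q w : Prop :=
  accepted S q w /\ forall n, exists2 m, (n <= m)%N & rpath S q (wtake m w) q.

(** After the last visit the state [q] is no longer available, which permits induction on the size
    of [S]. *)
Lemma accepted_last_visit S q w : accepted S q w ->
  recurrent S q w \/ exists n q1, [/\ rpath S q (wtake n w) q, trans q (w n) q1 &
    accepted (S :\ q) q1 (wdrop n.+1 w)].
Proof.
move=> acc; have [rho [r0 t m a]] := acc.
have [inf|fin] := EM (forall n, exists2 k, (n <= k)%N & rho k = q).
  left; split=> // n; have [k nk rk] := inf n; exists k => //.
  by rewrite -{1}r0 -rk; exact: rpath_run.
right; have [N hN] : exists N, forall k, (N <= k)%N -> rho k != q.
  apply: contrapT => h; apply: fin => n; apply: contrapT => h'; apply: h.
  by exists n => k nk; apply/eqP => rk; apply: h'; exists k.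
have ex : exists n, rho n == q by exists 0%N; rewrite r0.
have ub n : rho n == q -> (n <= N)%N.
  by rewrite leqNgt => rn; apply/negP => /ltnW/hN; rewrite rn.
case: (ex_maxnP ex ub) => n /eqP rn nmax; exists n, (rho n.+1); split.
- by rewrite -{1}r0 -rn; exact: rpath_run.
- by rewrite -rn.
- exists (fun i => rho (n.+1 + i)%N); split=> // [|i|i|i].
  + by rewrite addn0.
  + by rewrite addnS; exact: t.
  + rewrite in_setD1 m andbT; apply/negP => /nmax; lia.
  + have [k ik ak] := a (n.+1 + i)%N; exists (k - n.+1)%N; first lia.
    by rewrite subnKC//; lia.
Qed.

Definition unique_cycles S := forall q u v, q \in S -> size u = size v ->
  rpath S q u q -> rpath S q v q -> u = v.

Lemma unique_cycles_sub S S' : S \subset S' -> unique_cycles S' -> unique_cycles S.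
Proof.
move=> sub U q u v qS e p1 p2; apply: (U q) => //; first exact: (fintype.subsetP sub).
  exact: rpath_sub p1.
exact: rpath_sub p2.
Qed.

(** The product of one loop length for each pair [(S, q)]. A common length is needed so that a
    single base [r ^ l] serves all states. *)
Lemma common_cycle_length : exists2 l, (0 < l)%N & forall S q u,
  u != [::] -> rpath S q u q -> exists2 z, size z = l & rpath S q z q.
Proof.
have h (Sq : {set Q} * Q) : exists n, (0 < n)%N /\ forall u, u != [::] ->
    rpath Sq.1 Sq.2 u Sq.2 -> exists2 z, size z = n & rpath Sq.1 Sq.2 z Sq.2.
  have [[u [u0 p]]|no] := EM (exists u, u != [::] /\ rpath Sq.1 Sq.2 u Sq.2).
    exists (size u); split; first by case: (u) u0.
    by move=> _ _ _; exists u.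
  by exists 1%N; split=> // u u0 p; exfalso; apply: no; exists u.
have [f hf] := choice h.
exists (\prod_Sq f Sq)%N; first by rewrite prodn_gt0// => Sq; case: (hf Sq).
move=> S q u u0 p; have [f0 /(_ u u0 p) [z sz pz]] := hf (S, q).
have /dvdnP[k ->] : (f (S, q) %| \prod_Sq f Sq)%N.
  by rewrite (bigD1 (S, q))//= dvdn_mulr.
by exists (upow z k); [rewrite size_upow sz|exact: rpath_upow].
Qed.

End Runs.

(** Applied to the loop lengths at a state: each is a multiple of [l] plus a bounded loop length. In
    every residue class one member [n0] is fixed; members up to [n0] represent themselves, and
    larger ones are reduced to it. *)
Lemma residues_bounded (l : nat) (G : nat -> Prop) : (0 < l)%N -> exists N, forall n, G n ->
  exists m k, [/\ G m, (m <= N)%N & n = (k * l + m)%N].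
Proof.
move=> l0.
have h (s : 'I_l) : exists N, forall n, G n -> (n %% l = s)%N ->
    exists m k, [/\ G m, (m <= N)%N & n = (k * l + m)%N].
  have [[n0 [g0 s0]]|no] := EM (exists n, G n /\ (n %% l = s)%N); last first.
    by exists 0%N => n gn sn; exfalso; apply: no; exists n.
  exists n0 => n gn sn; have [le|lt] := leqP n n0.
    by exists n, 0%N; rewrite mul0n.
  exists n0, (n %/ l - n0 %/ l)%N; split=> //.
  have le : (n0 %/ l <= n %/ l)%N by rewrite leq_div2r// ltnW.
  have := divn_eq n l; have := divn_eq n0 l; rewrite s0 sn mulnBl.
  have : (n0 %/ l * l <= n %/ l * l)%N by rewrite leq_mul2r le orbT.
  move: (n0 %/ l * l)%N (n %/ l * l)%N (s : nat) => a b c; clear; lia.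
have [f hf] := choice h.
exists (\max_s f s)%N => n gn.
have [m [k [gm mN e]]] := hf (Ordinal (ltn_pmod n l0)) n gn erefl.
by exists m, k; split=> //; apply: leq_trans mN _; exact: leq_bigmax.
Qed.

Lemma words_upto (T : finType) n : exists s : seq (seq T), forall u, (size u <= n)%N -> u \in s.
Proof.
exists (flatten [seq [seq tval t | t <- enum {: k.-tuple T}] | k <- iota 0 n.+1]) => u un.
apply/flatten_mapP; exists (size u); first by rewrite mem_iota.
by apply/mapP; exists (in_tuple u) => //; rewrite mem_enum.
Qed.

Section SparseDefinable.
Variables (R : realType) (r d : nat).
Hypothesis r_gt1 : (1 < r)%N.
Variable B : buchi (digits r d).
Local Notation Q := (state B).
Local Notation rr := (r%:R : R).
Implicit Types (S : {set Q}) (q : Q).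

Let rr_gt0 : 0 < rr. Proof. by rewrite ltr0n; apply: ltn_trans r_gt1. Qed.

Variable l : nat.
Hypothesis l_gt0 : (0 < l)%N.
Hypothesis cycle_l : forall S q u, u != [::] -> rpath S q u q ->
  exists2 z, size z = l & rpath S q z q.

Let rho : R := rr ^+ l.

Lemma base_ge2 : 2 <= rho.
Proof.
apply: (@le_trans _ _ rr); first by rewrite ler_nat.
by rewrite /rho -[leLHS]expr1 ler_eXn2l// ltr1n.
Qed.

Definition coordw (j : 'I_d) (w : word (digits r d)) : word 'I_r := fun i => w i j.
Definition coords (j : 'I_d) (u : seq (digits r d)) : seq 'I_r := [seq a j | a : digits r d <- u].
Local Notation cval j u := (wval R (coords j u)).

Lemma nu_coord_cat j u w :
  nu R (coordw j (wcat u w)) = cval j u + rr ^- size u * nu R (coordw j w).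
Proof. by rewrite /coordw (wcat_map (fun a : digits r d => a j)) nu_cat// size_map. Qed.

(* The set of values is homogenised: [e 0] is a power [p], and [e 1, ..., e d] are
   the coordinates of [p * x]. Reading a loop then amounts to changing [p]. *)
Definition scaled_values S q (e : nat -> R) : Prop :=
  is_power rho (e 0%N) /\ exists2 w, accepted S q w &
    forall j : 'I_d, e j.+1 = e 0%N * nu R (coordw j w).

Lemma def_forall_ord n (P : 'I_n -> (nat -> R) -> Prop) :
  (forall j, def rho (P j)) -> def rho (fun e => forall j, P j e).
Proof.
move=> h; have : def rho (fun e => ~ exists2 j, j \in enum 'I_n & ~ P j e).
  apply: def_not; apply: def_bigor => j _; apply: def_not; exact: h.
apply: def_ext => e; split=> [k j|k [j _]]; last by apply.
by apply: contrapT => nP; apply: k; exists j; rewrite ?mem_enum.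
Qed.

Lemma def_const (P : Prop) : def rho (fun=> P).
Proof.
have [p|np] := EM P; first by apply: def_ext (def_true rho) => e.
by apply: def_ext (def_false rho) => e.
Qed.

(* From [p = e 0], [p' = e i] and the coordinates [v] of [p * x], where
   [v = c0 * p + (ci + y / m) * p'], computes [p'] and [p' * y]. *)
Definition lin_subst (i : nat) (m : R) (c0 ci : 'I_d -> R) (k : nat) : tm R :=
  if k is j.+1 then
    if insub j is Some j' then
      TM m (TA (TV R j.+1) (TA (TM (- c0 j') (TV R 0)) (TM (- ci j') (TV R i))))
    else TC 0
  else TV R i.

Lemma scaled_values_subst S q i m c0 ci e :
  scaled_values S q (fun k => ev rho e (lin_subst i m c0 ci k)) <->
  is_power rho (e i) /\ exists2 w, accepted S q w &
    forall j : 'I_d, m * (e j.+1 - c0 j * e 0%N - ci j * e i) = e i * nu R (coordw j w).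
Proof.
have val (j : 'I_d) : ev rho e (lin_subst i m c0 ci j.+1) =
    m * (e j.+1 - c0 j * e 0%N - ci j * e i).
  by rewrite /= valK /=; ring.
split=> -[Pi [w acc h]]; split=> //; exists w => // j.
  by rewrite -val h.
by rewrite val h.
Qed.

(* A run from [q] is split at its last visit of [q]. Since loops at [q] are determined
   by their lengths, the part before it is [upow z k ++ c] with [z] fixed and finitely
   many [c], and a run that visits [q] infinitely often reads the word [z z z ...],
   of value [zeta]. *)
Lemma def_scaled_values S q : unique_cycles S -> def rho (scaled_values S q).
Proof.
have [n] := ubnP #|S|; elim: n S q => // n IH S q Sn U.
have [qS|qS] := boolP (q \in S); last first.
  apply: def_ext (def_false rho) => e; split=> // -[_ [w /accepted_start]].
  by rewrite (negbTE qS).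
have {}IH q1 : def rho (scaled_values (S :\ q) q1).
  apply: IH; last by apply: unique_cycles_sub U; exact: subD1set.
  by move: Sn; rewrite (cardsD1 q) qS.
have [[u0 [u0n p0]]|nocycle] := EM (exists u, u != [::] /\ rpath S q u q); last first.
  (* Without a loop the run is at [q] only at time 0, so one letter [a] is split off: [p] is kept
     and [p * x] becomes [r * (p * x - (a / r) * p)]. *)
  have stay m (w : word (digits r d)) : rpath S q (wtake m w) q -> m = 0%N.
    move=> p; case: m p => // m p; exfalso; apply: nocycle.
    by exists (wtake m.+1 w); split=> //; rewrite wtakeS.
  apply: (@def_ext _ _ (fun e => exists2 a, a \in enum (digits r d) & exists2 q1, q1 \in enum Q &
      trans q a q1 /\ scaled_values (S :\ q) q1
        (fun k => ev rho e (lin_subst 0 rr (fun j => (a j)%:R / rr) (fun=> 0) k)))); last first.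
    apply: def_bigor => a _; apply: def_bigor => q1 _.
    apply: def_and; first exact: def_const.
    exact: def_sub.
  move=> e; split=> [[a _ [q1 _ [t /scaled_values_subst[P0 [w acc h]]]]]|[P0 [w acc h]]].
    split=> //; exists (wcons a w).
      by apply: (accepted_cons qS t); apply: accepted_sub acc; exact: subD1set.
    move=> j; rewrite -[wcons a w]/(wcat [:: a] w) nu_coord_cat /= expr1.
    rewrite addr0 mulrDr [e 0%N * (rr^-1 * _)]mulrCA -h.
    by field; rewrite gt_eqF.
  have [[_ rec]|[m [q1 [p t acc1]]]] := accepted_last_visit acc.
    by have [k k1 /stay k0] := rec 1%N; rewrite k0 in k1.
  have m0 := stay _ _ p; subst m.
  exists (w 0%N); first by rewrite mem_enum.
  exists q1; first by rewrite mem_enum.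
  split=> //; apply/scaled_values_subst; split=> //.
  exists (wdrop 1 w) => // j; rewrite h -{1}(wcons_drop w).
  rewrite -[wcons (w 0%N) _]/(wcat [:: w 0%N] _) nu_coord_cat /= expr1 addr0.
  by field; rewrite gt_eqF.
have [z sz pz] := cycle_l u0n p0.
have rho_ge2 := base_ge2; have rho0 : 0 < rho by apply: lt_le_trans rho_ge2.
pose zeta j := cval j z / (1 - rho^-1).
have rhoV1 : 1 - rho^-1 != 0.
  rewrite subr_eq0 eq_sym invr_eq1 gt_eqF//; apply: lt_le_trans rho_ge2.
  by rewrite ltr1n.
have zetaE j : zeta j = cval j z + rho^-1 * zeta j.
  have : zeta j * (1 - rho^-1) = cval j z by rewrite /zeta mulfVK.
  by move=> <-; ring.
have nu_zpow j k w : nu R (coordw j (wcat (upow z k) w)) =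
    zeta j + rho ^- k * (nu R (coordw j w) - zeta j).
  elim: k => [|k IHk]; first by rewrite expr0 invr1 mul1r addrC subrK.
  rewrite upowS wcat_cat nu_coord_cat IHk [X in _ = X + _]zetaE sz -/rho exprS invfM.
  by ring.
(* Both sides are loops at [q] of length [l * size u]. *)
have cyc u : rpath S q u q -> upow u l = upow z (size u).
  move=> p; apply: (U q); rewrite ?size_upow ?sz//; first by rewrite mulnC.
    exact: rpath_upow.
  exact: rpath_upow.
(* At a return time [m], the first [m] letters of [w] agree with those of [z^m w] by [cyc]. The
   values of [w] and [z^m w] then differ by at most [r ^- m], while the latter is within
   [rho ^- m * |D|] of [zeta], where [D] is the supposed error. *)
have nu_rec w j : recurrent S q w -> nu R (coordw j w) = zeta j.
  move=> [_ rec]; apply/eqP; rewrite -subr_eq0 -normr_le0 leNgt; apply/negP => pos.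
  have [n0 hn0] := scale_small r_gt1 (divr_gt0 pos (ltr0n R 2)).
  have [m m0 pm] := rec (maxn n0 1); move: m0; rewrite geq_max => /andP[n0m m1].
  have e : wtake m (wcat (upow z m) w) = wtake m w.
    have sw := size_wtake m w; have := cyc _ pm; rewrite sw => <-.
    rewrite wtake_cat; last by rewrite size_upow sw leq_pmull.
    by rewrite -(prednK l_gt0) upowS -{1}sw take_size_cat.
  have e' : wtake m (coordw j (wcat (upow z m) w)) = wtake m (coordw j w).
    by rewrite !(wtake_map (fun a : digits r d => a j)) e.
  have := nu_wtake R r_gt1 e'; rewrite nu_zpow.
  set D := nu R (coordw j w) - zeta j in pos hn0 *.
  rewrite (_ : zeta j + _ - _ = - ((1 - rho ^- m) * D)); last first.
    by rewrite /D; ring.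
  have h2 : rho ^- m <= 2^-1.
    rewrite lef_pV2 ?posrE ?exprn_gt0//; apply: (le_trans rho_ge2).
    by rewrite -[leLHS]expr1 ler_eXn2l//; apply: lt_le_trans rho_ge2; rewrite ltr1n.
  have h3 : rr ^- m <= rr ^- n0.
    by rewrite lef_pV2 ?posrE ?exprn_gt0// ler_eXn2l// ltr1n.
  rewrite normrN normrM ger0_norm; last by lra.
  have : 2^-1 * `|D| <= (1 - rho ^- m) * `|D| by rewrite ler_pM2r//; lra.
  lra.
have power_le (p p' : R) : is_power rho p -> is_power rho p' -> p' <= p ->
    exists k, p' = p * rho ^- k.
  move=> [x ->] [y ->]; rewrite ler_eXz2l; last first.
    by apply: lt_le_trans rho_ge2; rewrite ltr1n.
  move=> yx; exists `|x - y|%N; rewrite exprnN -expfzDr ?gt_eqF//; congr (_ ^ _).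
  by rewrite abszE ger0_norm ?subr_ge0// opprB addrC subrK.
have [N hN] := residues_bounded (fun n => exists u, size u = n /\ rpath S q u q) l_gt0.
have [s hs] := words_upto (digits r d) N.
pose i := d.+1.
(* For the word [z^k c a w'] and [p' = p * rho ^- k] the identity is [p * x = zeta * p + (cval (c a)
   - zeta + y / m) * p'], with [y] the value of [w']. *)
pose m (c : seq (digits r d)) := rr ^+ (size c).+1.
pose sub (c : seq (digits r d)) (a : digits r d) :=
  lin_subst i (m c) zeta (fun j => cval j (rcons c a) - zeta j).
apply: (@def_ext _ _ (fun e => is_power rho (e 0%N) /\
  (((exists w, recurrent S q w) /\ forall j : 'I_d, e j.+1 = zeta j * e 0%N) \/
   exists2 c, c \in s & exists2 a, a \in enum (digits r d) & exists2 q1, q1 \in enum Q &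
     (rpath S q c q /\ trans q a q1) /\ exists p', is_power rho p' /\
       ((upd e i p') i <= (upd e i p') 0%N /\
        scaled_values (S :\ q) q1 (fun k => ev rho (upd e i p') (sub c a k)))))); last first.
  apply: def_and; first exact: (def_is_power rho_ge2 (TV R 0)).
  apply: def_or.
    apply: def_and; first exact: def_const.
    by apply: def_forall_ord => j; apply: (def_eq rho (TV R j.+1) (TM (zeta j) (TV R 0))).
  apply: def_bigor => c _; apply: def_bigor => a _; apply: def_bigor => q1 _.
  apply: def_and; first exact: def_const.
  apply: (def_ex_power rho_ge2 i (B := fun e => e i <= e 0%N /\
    scaled_values (S :\ q) q1 (fun k => ev rho e (sub c a k)))).
  apply: def_and; first exact: (def_le rho (TV R i) (TV R 0)).
  exact: def_sub.
have updi (e : nat -> R) x : upd e i x i = x by rewrite /upd eqxx.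
have updj (e : nat -> R) x k : (k <= d)%N -> upd e i x k = e k.
  by move=> kd; rewrite /upd /i; case: eqP => // kd'; rewrite kd' ltnn in kd.
have nu_snoc j c a w : nu R (coordw j (wcat c (wcons a w))) =
    cval j (rcons c a) + (m c)^-1 * nu R (coordw j w).
  by rewrite -[wcons a w]/(wcat [:: a] w) -wcat_cat cats1 nu_coord_cat size_rcons.
have m0 c : m c != 0 by rewrite expf_neq0// gt_eqF.
move=> e; split.
  move=> [P0 [[[w rec] h]|]].
    split=> //; exists w; first by case: rec.
    by move=> j; rewrite h (nu_rec _ _ rec) mulrC.
  move=> [c _ [a _ [q1 _ [[pc t] [p' [Pp' [le /scaled_values_subst[_ [w acc h]]]]]]]]].
  split=> //; move: le; rewrite updi updj// => le.
  have [k pk] := power_le _ _ P0 Pp' le.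
  exists (wcat (upow z k) (wcat c (wcons a w))).
    apply: accepted_cat (rpath_upow k pz) _ => //; apply: accepted_cat pc _ => //.
    by apply: (accepted_cons qS t); apply: accepted_sub acc; exact: subD1set.
  move=> j; rewrite nu_zpow nu_snoc.
  have := h j; rewrite updi !updj// => hj.
  have : e j.+1 - zeta j * e 0%N - (cval j (rcons c a) - zeta j) * p' =
      p' * ((m c)^-1 * nu R (coordw j w)).
    by rewrite mulrCA -hj mulKf.
  have -> : e 0%N * (zeta j + rho ^- k * (cval j (rcons c a) + (m c)^-1 *
      nu R (coordw j w) - zeta j)) = e 0%N * zeta j + (e 0%N * rho ^- k) *
      (cval j (rcons c a) + (m c)^-1 * nu R (coordw j w) - zeta j) by ring.
  rewrite -pk => hj'; apply/eqP; rewrite -subr_eq0; apply/eqP.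
  move/eqP: hj'; rewrite -subr_eq0 => /eqP <-; ring.
move=> [P0 [w acc h]]; split=> //.
have [rec|[n0 [q1 [p t acc1]]]] := accepted_last_visit acc.
  left; split; first by exists w.
  by move=> j; rewrite h (nu_rec _ _ rec) mulrC.
right; have [|n1 [k [[c [sc pc]] n1N nk]]] := hN n0.
  by exists (wtake n0 w); rewrite size_wtake.
have wc : wtake n0 w = upow z k ++ c.
  apply: (U q) => //; first by rewrite size_wtake size_cat size_upow sz sc.
  by apply: rpath_cat pc; exact: rpath_upow.
have we : w = wcat (upow z k) (wcat c (wcons (w n0) (wdrop n0.+1 w))).
  rewrite -wcat_cat -wc -{1}(wcat_take_drop n0 w) -(wcons_drop (wdrop n0 w)).
  by rewrite wdropD addn1 /wdrop addn0.
exists c; first by apply: hs; rewrite sc.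
exists (w n0); first by rewrite mem_enum.
exists q1; first by rewrite mem_enum.
split=> //; have rk : is_power rho (rho ^- k) by exists (- k%:Z); rewrite exprnN.
have Pp' : is_power rho (e 0%N * rho ^- k) by exact: is_powerM.
exists (e 0%N * rho ^- k); split=> //.
rewrite updi updj//; split.
  rewrite ger_pMr ?(is_power_gt0 rho_ge2 P0)// invf_le1 ?exprn_gt0//.
  by apply: exprn_ege1; apply: le_trans rho_ge2; rewrite ler1n.
apply/scaled_values_subst; rewrite updi; split=> //.
exists (wdrop n0.+1 w) => // j; rewrite !updj// h {1}we nu_zpow nu_snoc.
have := m0 c; move: (rho ^- k) (nu R (coordw j _)) => K y /= mc.
by field.
Qed.

End SparseDefinable.

(** * Pumping in sparse languages *)

Definition blocks (T : Type) (u v : seq T) (b : seq bool) : seq T :=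
  flatten [seq if x then u else v | x <- b].

Lemma size_blocks (T : Type) (u v : seq T) b : size u = size v ->
  size (blocks u v b) = (size b * size u)%N.
Proof.
by move=> suv; elim: b => //= x b IH; rewrite size_cat IH mulSn; case: x; rewrite ?suv.
Qed.

Lemma blocks_inj (T : eqType) (u v : seq T) b b' : size u = size v -> u != v ->
  size b = size b' -> blocks u v b = blocks u v b' -> b = b'.
Proof.
move=> suv uv; elim: b b' => [|x b IH] [|y b'] //= [sb] /eqP.
rewrite /blocks /= eqseq_cat; last by case: x; case: y.
move=> /andP[/eqP xy /eqP /(IH _ sb) ->]; congr cons.
by case: x y xy => -[] // e; move: uv; rewrite e eqxx.
Qed.

Section SparseLanguages.
Variables (Sigma : finType) (B : buchi Sigma).
Local Notation Q := (state B).
Local Notation L := (buchi_language B).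

Definition useful : {set Q} := [set q | `[< (exists u, rpath [set: Q] (init B) u q) /\
  exists w, accepted [set: Q] q w >]]%SET.

Lemma usefulP q : q \in useful <->
  (exists u, rpath [set: Q]%SET (init B) u q) /\ exists w, accepted [set: Q]%SET q w.
Proof. by rewrite inE; split=> /asboolP. Qed.

Lemma buchi_languageP w : L w <-> accepted [set: Q]%SET (init B) w.
Proof.
split=> [[rho [[r0 t] a]]|[rho [r0 t _ a]]]; exists rho; split=> // n; rewrite inE.
Qed.

Lemma accepted_useful w : L w <-> accepted useful (init B) w.
Proof.
rewrite buchi_languageP; split=> acc; last exact: accepted_sub (finset.subsetT _) acc.
have [rho [r0 t m a]] := acc; exists rho; split=> // n; apply/usefulP.
rewrite -r0; split; first by exists (wtake n w); exact: rpath_run.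
exists (wdrop n w), (fun i => rho (n + i)%N); split=> [|i|i|i]; rewrite ?addn0//.
- by rewrite addnS; exact: t.
- have [k ik ak] := a (n + i)%N; exists (k - n)%N; first lia.
  by rewrite subnKC//; lia.
Qed.

Lemma prefixes_mem (M : set (word Sigma)) n (t : n.-tuple Sigma) :
  t \in prefixes M n <-> exists2 w, M w & wtake n w = t.
Proof.
rewrite inE; split=> [/asboolP[w Mw h]|[w Mw h]].
  exists w => //; apply: (@eq_from_nth _ (w 0%N)) => [|i].
    by rewrite size_wtake size_tuple.
  rewrite size_wtake => ilt; rewrite nth_mkseq// -[i]/(val (Ordinal ilt)) -h.
  by rewrite (tnth_nth (w 0%N)).
apply/asboolP; exists w => // i.
by rewrite (tnth_nth (w 0%N)) -h nth_mkseq.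
Qed.

(** Two different loops of equal length at a useful state can be concatenated in [2 ^ n] ways, which
    gives as many prefixes of a length linear in [n]. *)
Lemma sparse_unique_cycles : sparse_language L -> unique_cycles useful.
Proof.
move=> [_ [c [k hck]]] q u v qU suv pu pv; apply/eqP/contraT => uv; exfalso.
have [[p pp] [w acc]] := (usefulP q).1 qU.
have sT : useful \subset [set: Q]%SET := finset.subsetT _.
have pb n : rpath [set: Q]%SET q (blocks u v n) q.
  elim: n => [|x n IH] //=; apply: rpath_cat IH.
  by case: x; exact: rpath_sub sT _.
pose len n := (size p + n * size u)%N.
have lb n : (2 ^ n <= #|prefixes L (len n)|)%N.
  rewrite -card_bool -(card_tuple n bool) -cardsT.
  have st (b : n.-tuple bool) : size (p ++ blocks u v b) == len n.
    by rewrite size_cat size_blocks// size_tuple.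
  rewrite -(card_imset _ (f := fun b => Tuple (st b))); last first.
    move=> b b' /(congr1 val) /= /eqP; rewrite eqseq_cat// eqxx => /eqP e.
    by apply/val_inj/(blocks_inj suv uv) => //; rewrite !size_tuple.
  apply: subset_leq_card; apply/fintype.subsetP => _ /imsetP[b _ ->].
  apply/prefixes_mem; exists (wcat (p ++ blocks u v b) w) => /=.
    apply/buchi_languageP; rewrite wcat_cat.
    apply: accepted_cat pp _; rewrite ?inE//.
    by apply: accepted_cat (pb b) acc; rewrite inE.
  by rewrite -[in X in wtake X](eqP (st b)) wtake_cat_size.
have pl : pbounded (fun n => c * (len n).+1 ^ k)%N.
  apply: pboundedM (pbounded_const c) _; apply: pboundedX.
  exact: pboundedS (pboundedD (pbounded_const (size p))
    (pboundedM pbounded_id (pbounded_const (size u)))).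
have [n hn] := pbounded_lt_exp pl.
by move: (leq_trans (lb n) (hck (len n))); rewrite leqNgt hn.
Qed.

End SparseLanguages.

Lemma sparse_def (R : realType) (r d : nat) (A : set 'rV[R]_d) : (1 < r)%N ->
  sparse_set r A ->
  exists rho : R, 2 <= rho /\ def rho (fun e => A (\row_(j < d) e j)).
Proof.
move=> r1 [L sL AL]; have [[B LB] _] := sL; subst L.
have U := sparse_unique_cycles sL.
have [l l0 cl] := common_cycle_length B.
exists (r%:R ^+ l); split; first exact: base_ge2.
have := def_scaled_values R r1 l0 cl (init B) U.
(* The homogenised set is cut at [p = 1]. *)
move=> /(def_sub (fun k => if k is j.+1 then TV R j else TC 1)); apply: def_ext => e.
rewrite /scaled_values /= AL; split=> [[_ [w acc h]]|[w Lw h]].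
  exists w; first exact/accepted_useful.
  by apply/rowP => j; rewrite !mxE h mul1r.
split; first exact: is_power1.
exists w => [|j]; first exact/accepted_useful.
by move/rowP/(_ j): h; rewrite !mxE => <-; rewrite mul1r.
Qed.

(** * Formulas of the language in the real structure *)

Section Environments.
Variables (T : Type) (x0 : T).

Definition env n (v : 'I_n -> T) (k : nat) : T := if insub k is Some i then v i else x0.

Lemma envK n (v : 'I_n -> T) : (fun i : 'I_n => env v i) = v.
Proof. by apply: funext => i; rewrite /env valK. Qed.

Lemma fcat_lshift m n (x : 'I_m -> T) (y : 'I_n -> T) i : fcat x y (lshift n i) = x i.
Proof. by rewrite /fcat split_lshift. Qed.

Lemma fcat_rshift m n (x : 'I_m -> T) (y : 'I_n -> T) i : fcat x y (rshift m i) = y i.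
Proof. by rewrite /fcat split_rshift. Qed.

Lemma ord_split m n (P : 'I_(m + n) -> Prop) :
  (forall i, P (lshift n i)) -> (forall i, P (rshift m i)) -> forall i, P i.
Proof. by move=> h1 h2 i; rewrite -(splitK i); case: fintype.split. Qed.

Lemma fcat_upd n (e : nat -> T) (a : T) :
  fcat (fun i : 'I_n => e i) (fun _ : 'I_1 => a) = (fun i : 'I_(n + 1) => upd e n a i).
Proof.
apply: funext; apply: ord_split => i; rewrite ?fcat_lshift ?fcat_rshift /upd /=.
  by case: eqP => // h; have := ltn_ord i; rewrite h ltnn.
by rewrite (ord1 i) addn0 eqxx.
Qed.

End Environments.

Section Translation.
Variables (R : realType) (d : nat) (A : set 'rV[R]_d) (rho : R).
Hypothesis rho_ge2 : 2 <= rho.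
Hypothesis defA : def rho (fun e => A (\row_(j < d) e j)).
Local Notation S := (structure_A A).

Lemma eval_tm n (t : term (lang_A d) n) : exists u : tm R, forall e : nat -> R,
  Defs.eval S (fun i : 'I_n => e i) t = ev rho e u.
Proof.
elim: t => [i|[] ts IH].
- by exists (TV R i).
- have [u hu] := IH (@Ordinal 2 0 isT); have [v hv] := IH (@Ordinal 2 1 isT).
  by exists (TA u v) => e /=; rewrite -hu -hv.
- by exists (TC 0).
- by exists (TC 1).
Qed.

Lemma sat_def n (phi : formula (lang_A d) n) :
  def rho (fun e => sat S phi (fun i : 'I_n => e i)).
Proof.
elim: phi => {n} [n|n t u|n [] ts|n f IHf g IHg|n f IH].
- exact: def_false.
- have [t' ht] := eval_tm t; have [u' hu] := eval_tm u.
  by apply: def_ext (def_eq rho t' u') => e /=; rewrite ht hu.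
- have [t ht] := eval_tm (ts (@Ordinal 2 0 isT)).
  have [u hu] := eval_tm (ts (@Ordinal 2 1 isT)).
  by apply: def_ext (def_lt rho t u) => e /=; rewrite ht hu.
- have [u hu] := choice (fun k => eval_tm (ts k)).
  have := def_sub (fun k => if insub k is Some j then u j else TC 0) defA.
  apply: def_ext => e /=.
  rewrite (_ : \row_j ev _ _ _ = \row_(i < d) Defs.eval S (fun i : 'I_n => e i) (ts i))//.
  by apply/rowP => j; rewrite !mxE valK hu.
- exact: def_imp.
- apply: def_ext (def_all rho_ge2 n IH) => e /=.
  by split=> h a; have := h a; rewrite fcat_upd.
Qed.

Lemma def_d_minimal : d_minimal S.
Proof.
move=> m B [p [phi [c ->]]].
have [N hN] := def_fiber_d_minimal rho_ge2 m (sat_def phi).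
exists N => x fiber.
have := hN (env 0 (fcat (fcat x (fun _ : 'I_1 => 0)) c)).
rewrite (_ : [set _ | _] = fiber)//.
apply/seteqP; suff h t : (fun i : 'I_(m + 1 + p) =>
    upd (env 0 (fcat (fcat x (fun _ : 'I_1 => 0)) c)) m t i) = fcat (fcat x (fun=> t)) c.
  by split=> t; rewrite /fiber /= h.
apply: funext; apply: ord_split => i; rewrite /upd /env valK !(fcat_lshift, fcat_rshift).
  move: i; apply: ord_split => i; rewrite !(fcat_lshift, fcat_rshift) /=.
    by case: eqP => // h; have := ltn_ord i; rewrite h ltnn.
  by rewrite (ord1 i) addn0 eqxx.
by rewrite /= -addnA; case: eqP => //; lia.
Qed.

(** The tuples [b J] are the ones to be counted, so the coded variables are those from [m] on. *)
Lemma def_no_shattering m n (phi : formula (lang_A d) (m + n)) : exists N,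
  forall (a : 'I_N -> 'I_m -> R) (b : {set 'I_N} -> 'I_n -> R),
  ~ forall i J, sat S phi (fcat (a i) (b J)) <-> i \in J.
Proof.
have [N hN] := few_patterns_no_shattering (def_few_patterns rho_ge2
  (fun k => (m <= k)%N) (sat_def phi)).
exists N => a b h; apply: (hN (fun i => env 0 (fcat (a i) (fun _ : 'I_n => 0)))
  (fun J => env 0 (fcat (fun _ : 'I_m => 0) (b J)))) => J i.
rewrite -h (_ : (fun _ => _) = fcat (a i) (b J))//.
apply: funext; apply: ord_split => k; rewrite /mix /env !valK !(fcat_lshift, fcat_rshift) /=.
  by rewrite leqNgt ltn_ord.
by rewrite leq_addr.
Qed.

End Translation.

(** * Renaming, ultrapowers and compactness *)

Section Renaming.
Variable L : language.

Fixpoint ren_term n k (f : 'I_n -> 'I_k) (t : term L n) : term L k :=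
  match t with
  | Var i => @Var L k (f i)
  | App g ts => App (fun j => ren_term f (ts j))
  end.

Definition lift_ren n k (f : 'I_n -> 'I_k) (i : 'I_(n + 1)) : 'I_(k + 1) :=
  match fintype.split i with inl j => lshift 1 (f j) | inr j => rshift k j end.

Fixpoint ren n (phi : formula L n) : forall k, ('I_n -> 'I_k) -> formula L k :=
  match phi with
  | Bot => fun k _ => Bot L k
  | Equal t u => fun k f => Equal (ren_term f t) (ren_term f u)
  | Rel p ts => fun k f => Rel (fun j => ren_term f (ts j))
  | Imp g h => fun k f => Imp (ren g f) (ren h f)
  | Forall g => fun k f => Forall (ren g (lift_ren f))
  end.

Variables (M : Type) (S : structure L M).

Lemma eval_ren n k (f : 'I_n -> 'I_k) (t : term L n) v :
  Defs.eval S v (ren_term f t) = Defs.eval S (fun i => v (f i)) t.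
Proof.
elim: t => //= g ts IH; congr fun_interp.
by apply: funext => j; exact: IH.
Qed.

Lemma sat_ren n (phi : formula L n) k (f : 'I_n -> 'I_k) v :
  sat S (ren phi f) v <-> sat S phi (fun i => v (f i)).
Proof.
elim: phi k f v => {n} [n|n t u|n p ts|n g IHg h IHh|n g IH] k f v //=.
- by rewrite !eval_ren.
- by rewrite (_ : (fun _ => _) = fun j => Defs.eval S (fun i => v (f i)) (ts j))//;
    apply: funext => j; exact: eval_ren.
- by rewrite IHg IHh.
- suff e a : (fun i => fcat v (fun _ : 'I_1 => a) (lift_ren f i)) =
      fcat (fun i => v (f i)) (fun _ : 'I_1 => a).
    by split=> sa a; move: (sa a); rewrite IH e.
  apply: funext; apply: ord_split => i; rewrite /lift_ren.
    by rewrite split_lshift !fcat_lshift.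
  by rewrite split_rshift !fcat_rshift.
Qed.

Definition Not n (phi : formula L n) := Imp phi (Bot L n).
Definition And n (phi psi : formula L n) := Not (Imp phi (Not psi)).

Lemma sat_Not n (phi : formula L n) v : sat S (Not phi) v <-> ~ sat S phi v.
Proof. by []. Qed.

Lemma sat_And n (phi psi : formula L n) v :
  sat S (And phi psi) v <-> sat S phi v /\ sat S psi v.
Proof.
rewrite /And /Not /=; split=> [h|[p q] h]; last exact: h.
by split; apply: contrapT => k; apply: h => p q; exact: k.
Qed.

Lemma sat_conj n (I : eqType) (s : seq I) (F : I -> formula L n) v :
  sat S (foldr (fun i => And (F i)) (Not (Bot L n)) s) v <->
  forall i, i \in s -> sat S (F i) v.
Proof.
elim: s => [|a s IH]; first by split=> [_ i|_ []]; rewrite ?in_nil.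
rewrite [foldr _ _ _]/= sat_And IH; split=> [[h1 h2] i|h].
  by rewrite inE => /orP[/eqP ->|/h2].
by split=> [|i si]; apply: h; rewrite inE ?eqxx// si orbT.
Qed.

Lemma addnS1 n k : (n + k.+1 = n + k + 1)%N. Proof. by rewrite addn1 addnS. Qed.

(** The casts are renamings, since [n + k.+1] and [n + k + 1] are not convertible. *)
Fixpoint All n k : formula L (n + k) -> formula L n :=
  match k return formula L (n + k) -> formula L n with
  | 0 => fun phi => ren phi (cast_ord (addn0 n))
  | k'.+1 => fun phi => All (Forall (ren phi (cast_ord (addnS1 n k'))))
  end.

Lemma sat_All n k (phi : formula L (n + k)) v :
  sat S (All phi) v <-> forall w : 'I_k -> M, sat S phi (fcat v w).
Proof.
elim: k phi => [|k IH] phi /=.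
  rewrite sat_ren; suff e w : (fun i => v (cast_ord (addn0 n) i)) = fcat v w.
    split=> [h w|]; first by rewrite -e.
    by move=> /(_ (fun i : 'I_0 => v (cast_ord (addn0 n) (rshift n i)))); rewrite -e.
  apply: funext; apply: ord_split => [i|[]//].
  by rewrite fcat_lshift; congr v; apply: val_inj.
rewrite IH /=.
have e w a w' : (forall i : 'I_k, w' (widen_ord (leqnSn k) i) = w i) -> w' ord_max = a ->
   (fun i => fcat (fcat v w) (fun _ : 'I_1 => a) (cast_ord (addnS1 n k) i)) =
   fcat v w'.
  move=> h1 h2; apply: funext; apply: ord_split => i.
    rewrite fcat_lshift.
    rewrite (_ : cast_ord _ _ = lshift 1 (lshift k i)) ?fcat_lshift//.
    exact: val_inj.
  rewrite fcat_rshift; have [ik|ik] := ltnP i k.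
    rewrite (_ : cast_ord _ _ = lshift 1 (rshift n (Ordinal ik))).
      by rewrite fcat_lshift fcat_rshift -h1; congr w'; exact: val_inj.
    exact: val_inj.
  have ek : i = ord_max by apply: val_inj => /=; apply/eqP; rewrite eqn_leq ik -ltnS ltn_ord.
  rewrite ek h2 (_ : cast_ord _ _ = rshift (n + k) ord0) ?fcat_rshift//.
  by apply: val_inj => /=; rewrite addn0.
split=> h.
  move=> w'; have := h (fun i => w' (widen_ord (leqnSn k) i)) (w' ord_max).
  by rewrite sat_ren (e _ _ w').
move=> w a; rewrite sat_ren.
rewrite (e _ _ (fun i : 'I_k.+1 => if insub (val i) is Some j then w j else a))//.
- by move=> i /=; rewrite valK.
- by rewrite insubF//= ltnn.
Qed.

End Renaming.

Section Transfer.
Variables (L : language) (M : Type) (S : structure L M).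

(** Otherwise the universal closure of the negation would belong to the theory of [S]. *)
Lemma sat_transfer (M' : Type) (S' : structure L M') k (phi : formula L k) :
  is_model S' (theory_of S) -> (exists v, sat S' phi v) -> exists v, sat S phi v.
Proof.
move=> mod [v' sv']; apply: contrapT => no.
pose psi : formula L (0 + k) := Not phi.
have e (T : Type) (x : 'I_0 -> T) (w : 'I_k -> T) : fcat x w = w :> ('I_(0 + k) -> T).
  by apply: funext; apply: ord_split => [[]//|i]; rewrite fcat_rshift; congr w; apply: val_inj.
have /mod : theory_of S (All psi).
  by apply/sat_All => w; rewrite e => sw; apply: no; exists w.
by move=> /sat_All /(_ v'); rewrite e; apply.
Qed.

(** Shattering of [N] points by all their subsets involves finitely many elements and is expressed
    by one conjunction, whose variables are indexed by [V]. *)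
Lemma has_IP_finite m n (phi : formula L (m + n)) : has_IP (theory_of S) phi ->
  forall N, exists (a : 'I_N -> 'I_m -> M) (b : {set 'I_N} -> 'I_n -> M),
    forall i J, sat S phi (fcat (a i) (b J)) <-> i \in J.
Proof.
move=> [M' [S' [mod [a' [b' h]]]]] N.
pose V : finType := ('I_N * 'I_m + {set 'I_N} * 'I_n)%type.
pose var (iJ : 'I_N * {set 'I_N}) (x : 'I_(m + n)) : 'I_#|V| := enum_rank
  (match fintype.split x with inl j => inl (iJ.1, j) | inr j => inr (iJ.2, j) end : V).
pose lit (iJ : 'I_N * {set 'I_N}) : formula L #|V| :=
  if iJ.1 \in iJ.2 then ren phi (var iJ) else Not (ren phi (var iJ)).
have satlit T (S1 : structure L T) (v : 'I_#|V| -> T) iJ : sat S1 (lit iJ) v <->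
    (sat S1 phi (fcat (fun j => v (enum_rank (inl (iJ.1, j) : V)))
                      (fun j => v (enum_rank (inr (iJ.2, j) : V)))) <-> iJ.1 \in iJ.2).
  have e : (fun x => v (var iJ x)) = fcat (fun j => v (enum_rank (inl (iJ.1, j) : V)))
                      (fun j => v (enum_rank (inr (iJ.2, j) : V))).
    apply: funext; apply: ord_split => i; rewrite ?fcat_lshift ?fcat_rshift /var.
      by rewrite split_lshift.
    by rewrite split_rshift.
  rewrite /lit; case: ifP => iJ'; rewrite ?sat_Not sat_ren e.
    by split=> [s|[_]]; [split|apply].
  by split=> [s|[s _ /s]//]; split.
have [v hv] : exists v, sat S (foldr (fun i => And (lit i)) (Not (Bot L #|V|))
    (enum {: 'I_N * {set 'I_N}})) v.
  apply: (sat_transfer mod).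
  pose up (J : {set 'I_N}) : set nat := [set i | exists2 k : 'I_N, k \in J & val k = i].
  exists (fun x : 'I_#|V| => match (enum_val x : V) with
    | inl p => a' (nat_of_ord p.1) p.2 | inr p => b' (up p.1) p.2 end).
  apply/sat_conj => -[i J] _; apply/satlit.
  rewrite (_ : (fun j => _) = a' i); last by apply: funext => j; rewrite enum_rankK.
  rewrite (_ : (fun j => _) = b' (up J)); last by apply: funext => j; rewrite enum_rankK.
  rewrite h; split=> /= [[k kJ /ord_inj <-]|iJ]//.
  by exists i.
exists (fun i j => v (enum_rank (inl (i, j) : V))), (fun J j => v (enum_rank (inr (J, j) : V))).
move=> i J; have /sat_conj/(_ (i, J)) := hv; rewrite mem_enum => /(_ isT).
by move/satlit.
Qed.

End Transfer.

Section Ultrapower.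
Variables (L : language) (M : Type) (S : structure L M).
Variable U : set_system nat.
Hypothesis UU : UltraFilter U.
Hypothesis U_free : forall n, U [set k | (n <= k)%N].

Let U_proper : ProperFilter U. Proof. by case: UU. Qed.
Let U_filter : Filter U. Proof. by have [PF _] := UU; exact: filter_filter. Qed.

Lemma ultra_not (X : set nat) : U (~` X) <-> ~ U X.
Proof.
split=> [nX uX|nX]; last by case: (in_ultra_setVsetC X UU).
by apply: (@filter_not_empty _ U); rewrite -(setICr X); exact: filterI.
Qed.

Lemma ultra_imp (X Y : set nat) : U [set n | X n -> Y n] <-> (U X -> U Y).
Proof.
split=> [h uX|h]; first by apply: filterS (filterI h uX) => n [] h1 /h1.
have [uX|/ultra_not nX] := EM (U X); first by apply: filterS (h uX) => n Yn _.
by apply: filterS nX => n nX /nX.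
Qed.

Lemma ultra_forall n (X : 'I_n -> set nat) : (forall i, U (X i)) ->
  U [set k | forall i, X i k].
Proof.
move=> h; suff hs (s : seq 'I_n) : U [set k | forall i, i \in s -> X i k].
  by apply: filterS (hs (enum 'I_n)) => k hk i; apply: hk; rewrite mem_enum.
elim: s => [|i s IH]; first exact: filterS (U_free 0%N).
apply: filterS (filterI (h i) IH) => k [h1 h2] j; rewrite inE => /orP[/eqP -> //|].
exact: h2.
Qed.

Definition class_of (f : nat -> M) : set (nat -> M) := [set g | U [set n | f n = g n]].

(** The elements are the classes themselves, so that [Equal] is interpreted by actual equality. *)
Definition ultrapower := {X : set (nat -> M) | exists f, X = class_of f}.

Lemma ultrapower_ext (x y : ultrapower) : sval x = sval y -> x = y.
Proof.
case: x y => [x px] [y py] /= e; subst y.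
by congr exist; exact: Prop_irrelevance.
Qed.

Definition uclass f : ultrapower := exist _ (class_of f) (ex_intro _ f erefl).
Definition urep (x : ultrapower) : nat -> M := projT1 (cid (svalP x)).

Lemma urepK x : uclass (urep x) = x.
Proof.
by apply: ultrapower_ext; rewrite /= /urep; case: cid.
Qed.

Lemma uclass_eq f g : uclass f = uclass g <-> U [set n | f n = g n].
Proof.
split=> [/(congr1 sval) /= e|fg].
  have : class_of g g by apply: filterS (U_free 0%N).
  by rewrite -e.
apply: ultrapower_ext; apply/seteqP; split=> h /= hh.
  by apply: filterS (filterI fg hh) => n /= [<- <-].
by apply: filterS (filterI fg hh) => n /= [-> <-].
Qed.

Lemma urep_uclass f : U [set n | urep (uclass f) n = f n].
Proof. by apply/uclass_eq; rewrite urepK. Qed.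

Definition ultra_structure : structure L ultrapower :=
  @Structure L ultrapower
    (fun f x => uclass (fun n => fun_interp S (fun k => urep (x k) n)))
    (fun p x => U [set n | rel_interp S (fun k => urep (x k) n)]).

Lemma eval_ultra k (v : nat -> 'I_k -> M) (t : term L k) :
  Defs.eval ultra_structure (fun i => uclass (v ^~ i)) t =
  uclass (fun n => Defs.eval S (v n) t).
Proof.
elim: t => //= f ts IH; apply/uclass_eq.
have := ultra_forall (fun i => urep_uclass (fun n => Defs.eval S (v n) (ts i))).
apply: filterS => n h; congr fun_interp; apply: funext => i.
by rewrite IH h.
Qed.

(** The theorem of Los. For [Forall], a counterexample is chosen at each index, and these form an
    element of the ultrapower. *)
Lemma sat_ultra k (phi : formula L k) (v : nat -> 'I_k -> M) :
  sat ultra_structure phi (fun i => uclass (v ^~ i)) <-> U [set n | sat S phi (v n)].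
Proof.
elim: phi v => {k} [k|k t u|k p ts|k f IHf g IHg|k f IH] v /=.
- by split=> // /(@filter_not_empty _ U).
- by rewrite !eval_ultra uclass_eq.
- have h := ultra_forall (fun i => urep_uclass (fun n => Defs.eval S (v n) (ts i))).
  have e n : (forall i, urep (uclass (fun n => Defs.eval S (v n) (ts i))) n =
      Defs.eval S (v n) (ts i)) ->
      (fun i => urep (Defs.eval ultra_structure (fun j => uclass (v ^~ j)) (ts i)) n) =
      (fun i => Defs.eval S (v n) (ts i)).
    by move=> en; apply: funext => i; rewrite eval_ultra en.
  by split=> s; apply: filterS (filterI h s) => n /= [/e ->].
- by rewrite IHf IHg -ultra_imp.
have step (a : nat -> M) :
    fcat (fun i => uclass (v ^~ i)) (fun _ : 'I_1 => uclass a) =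
    (fun i => uclass ((fun n => fcat (v n) (fun _ : 'I_1 => a n)) ^~ i)).
  apply: funext; apply: ord_split => i.
    by rewrite fcat_lshift; congr uclass; apply: funext => n; rewrite fcat_lshift.
  by rewrite fcat_rshift; congr uclass; apply: funext => n; rewrite fcat_rshift.
split=> [h|h a]; last first.
  rewrite -(urepK a) step IH; apply: filterS h => n; exact.
apply: contrapT => /ultra_not nU.
(* Counterexamples cannot be chosen in an empty [M], but there every universal formula holds. *)
have [[x0 _]|noM] := EM (exists x : M, True); last first.
  apply: (filter_not_empty U); apply: filterS nU => n; apply=> a.
  by exfalso; apply: noM; exists a.
have wit n : exists a, ~ (forall x, sat S f (fcat (v n) (fun _ : 'I_1 => x))) ->
    ~ sat S f (fcat (v n) (fun _ : 'I_1 => a)).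
  have [|] := EM (forall x, sat S f (fcat (v n) (fun _ : 'I_1 => x))).
    by exists x0.
  by move=> /existsNP[x hx]; exists x.
have [a ha] := choice wit.
have := h (uclass a); rewrite step IH => ua.
apply: (filter_not_empty U); apply: filterS (filterI ua nU) => n [s1 s2].
exact: (ha n).
Qed.

Lemma ultra_model T : is_model S T -> is_model ultra_structure T.
Proof.
move=> mod phi /mod; rewrite /theory_of /= => s.
have := sat_ultra phi (fun=> tnth [tuple]).
rewrite (_ : (fun i => _) = tnth [tuple]); last by apply: funext => -[].
by move=> ->; apply: filterS (U_free 0%N).
Qed.

End Ultrapower.

Lemma free_ultrafilter : exists U : set_system nat,
  UltraFilter U /\ forall n, U [set k | (n <= k)%N].
Proof.
have [U [UU h]] := ultraFilterLemma (eventually_filter : ProperFilter \oo).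
by exists U; split=> // n; apply: h; exists n.
Qed.

Section Compactness.
Variables (L : language) (M : Type) (S : structure L M) (T : set (sentence L)).
Hypothesis mod : is_model S T.

Lemma fcat_uclass U m n (x : nat -> 'I_m -> M) (y : nat -> 'I_n -> M) :
  fcat (fun i => uclass U (x ^~ i)) (fun i => uclass U (y ^~ i)) =
  (fun i => uclass U ((fun k => fcat (x k) (y k)) ^~ i)).
Proof.
apply: funext; apply: ord_split => i.
  by rewrite fcat_lshift; congr uclass; apply: funext => k; rewrite fcat_lshift.
by rewrite fcat_rshift; congr uclass; apply: funext => k; rewrite fcat_rshift.
Qed.

Lemma has_IP_compact m n (phi : formula L (m + n)) :
  (forall N, exists (a : nat -> 'I_m -> M) (b : set nat -> 'I_n -> M),
    forall i J, (i < N)%N -> sat S phi (fcat (a i) (b J)) <-> J i) ->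
  has_IP T phi.
Proof.
move=> h; have [U [UU Uf]] := free_ultrafilter; have PU := @ultra_proper _ _ UU.
have [a ha] := choice h; have [b hb] := choice ha.
exists (ultrapower M U), (ultra_structure S U); split; first exact: ultra_model.
exists (fun i k => uclass U (fun N => a N i k)), (fun J k => uclass U (fun N => b N J k)).
move=> i J; rewrite (fcat_uclass U (fun N => a N i) (fun N => b N J)) sat_ultra//.
have [Ji|nJi] := EM (J i).
  by split=> // _; apply: filterS (Uf i.+1) => N iN; apply/hb.
split=> // s; exfalso; apply: (@filter_not_empty _ U).
by apply: filterS (filterI (Uf i.+1) s) => N [iN /(hb N i J iN)/nJi].
Qed.

Lemma has_TP2_compact m n (phi : formula L (m + n)) :
  (forall N, exists b : nat -> nat -> 'I_n -> M,
    (forall i j k, (i < N)%N -> (j < N)%N -> (k < N)%N -> j <> k ->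
      ~ exists a, sat S phi (fcat a (b i j)) /\ sat S phi (fcat a (b i k))) /\
    (forall f : nat -> nat, (forall i, (i < N)%N -> (f i < N)%N) ->
      exists a, forall i, (i < N)%N -> sat S phi (fcat a (b i (f i))))) ->
  has_TP2 T phi.
Proof.
move=> h; have [U [UU Uf]] := free_ultrafilter; have PU := @ultra_proper _ _ UU.
have [b hb] := choice h.
exists (ultrapower M U), (ultra_structure S U); split; first exact: ultra_model.
exists (fun i j k => uclass U (fun N => b N i j k)); split=> [i j k jk [a [s1 s2]]|f N].
  pose a' N x := urep (a x) N.
  have ea : a = (fun x => uclass U (a' ^~ x)).
    by apply: funext => x; rewrite [in RHS](_ : a' ^~ x = urep (a x))// urepK.
  rewrite ea (fcat_uclass U a' (fun N => b N i j)) sat_ultra// in s1.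
  rewrite ea (fcat_uclass U a' (fun N => b N i k)) sat_ultra// in s2.
  apply: (@filter_not_empty _ U).
  apply: filterS (filterI (filterI s1 s2) (Uf (maxn i (maxn j k)).+1)) => N [[t1 t2]].
  rewrite /= !gtn_max => /and3P[iN jN kN].
  by have [+ _] := hb N => /(_ i j k iN jN kN jk); apply; exists (a' N).
(* From index [N1] on, the finite array contains all the cells [(i, f i)] with [i < N]. *)
pose K := \max_(i < N) f i.
pose N1 := maxn N K.+1.
have good N' : (N1 <= N')%N -> exists a, forall i, (i < N)%N ->
    sat S phi (fcat a (b N' i (f i))).
  rewrite geq_max => /andP[NN' KN'].
  (* Beyond row [N] the path is sent to column 0, to keep it inside the array. *)
  have [_ /(_ (fun i => if (i < N)%N then f i else 0%N))] := hb N'; case.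
    move=> i iN'; case: (ltnP i N) => iN; last exact: leq_ltn_trans (leq0n i) iN'.
    by apply: leq_ltn_trans KN'; exact: (leq_bigmax (Ordinal iN)).
  by move=> a ha; exists a => i iN; have := ha i (leq_trans iN NN'); rewrite iN.
have [a0 _] := good N1 (leqnn _).
have wit N' : exists a, (N1 <= N')%N -> forall i, (i < N)%N ->
    sat S phi (fcat a (b N' i (f i))).
  have [/good [a ha]|lt] := leqP N1 N'; first by exists a.
  by exists a0.
have [a ha] := choice wit.
exists (fun x => uclass U (a ^~ x)) => i iN.
rewrite (fcat_uclass U a (fun N => b N i (f i))) sat_ultra//.
by apply: filterS (Uf N1) => N' N1N'; exact: ha.
Qed.

End Compactness.

(** A set [J] is realised by the path through column 0 in the rows of [J] and column 1 elsewhere; by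
    inconsistency of the rows it meets column 0 nowhere else. The points are the parameters of
    column 0, hence the exchange of variables. *)
Lemma TP2_IP L (T : set (sentence L)) m n (phi : formula L (m + n)) :
  has_TP2 T phi -> exists psi : formula L (n + m), has_IP T psi.
Proof.
pose swap (i : 'I_(m + n)) : 'I_(n + m) :=
  match fintype.split i with inl j => rshift n j | inr j => lshift m j end.
move=> [M [S [mod [b [incons cons]]]]]; exists (ren phi swap).
apply: (has_IP_compact mod) => N.
have h (J : set nat) : exists a : 'I_m -> M, forall i, (i < N)%N ->
    sat S phi (fcat a (b i (if `[< J i >] then 0 else 1)%N)).
  exact: (cons (fun i => if `[< J i >] then 0 else 1)%N N).
have [a ha] := choice h.
exists (fun i => b i 0%N), a => i J iN; rewrite sat_ren.
have -> : (fun k => fcat (b i 0%N) (a J) (swap k)) = fcat (a J) (b i 0%N).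
  apply: funext; apply: ord_split => k; rewrite /swap.
    by rewrite split_lshift fcat_lshift fcat_rshift.
  by rewrite split_rshift fcat_lshift fcat_rshift.
have := ha J i iN; case: asboolP => // nJ s1; split=> // s0; exfalso.
by apply: (incons i 0%N 1%N) => //; exists (a J).
Qed.

Lemma NIP_NTP2 L (T : set (sentence L)) : NIP T -> NTP2 T.
Proof. by move=> nip m n phi /TP2_IP[psi]; exact: nip. Qed.

Lemma def_NIP (R : realType) d (A : set 'rV[R]_d) rho : 2 <= rho ->
  def rho (fun e => A (\row_(j < d) e j)) -> NIP (theory_of (structure_A A)).
Proof.
move=> rho2 defA m n phi /has_IP_finite fin.
have [N hN] := def_no_shattering rho2 defA phi.
by have [a [b]] := fin N; exact: hN.
Qed.

(** * Growth of automata *)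

Section Automaton.
Variables (r : nat) (D : finType) (delta : D -> 'I_r -> D) (live : pred D).
Hypothesis live_prefix : forall q a, live (delta q a) -> live q.
Hypothesis live_next : forall q, live q -> exists a, live (delta q a).

Definition after (q : D) (u : seq 'I_r) : D := foldl delta q u.

Lemma after_cat q u v : after q (u ++ v) = after (after q u) v.
Proof. exact: foldl_cat. Qed.

Lemma after_upow q u n : after q u = q -> after q (upow u n) = q.
Proof. by move=> e; elim: n => // n IH; rewrite upowS after_cat e. Qed.

Lemma after_blocks q u v b : after q u = q -> after q v = q ->
  after q (blocks u v b) = q.
Proof. by move=> eu ev; elim: b => //= x b IH; rewrite after_cat; case: x; rewrite ?eu ?ev. Qed.

Lemma live_after q u : live (after q u) -> live q.
Proof. by elim: u q => [|a u IH] q //= /IH /live_prefix. Qed.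

Definition live_words (q : D) : set (word 'I_r) :=
  [set w | forall n, live (after q (wtake n w))].

Lemma live_words_cat q u w : live_words q (wcat u w) <-> live_words (after q u) w.
Proof.
split=> h n.
  have := h (size u + n)%N; rewrite wtake_add after_cat wtake_cat_size wdrop_cat.
  by [].
have [le|lt] := leqP n (size u).
  rewrite wtake_cat//; apply: (@live_after _ (drop n u)).
  rewrite -after_cat cat_take_drop; exact: (h 0%N).
rewrite -(subnKC (ltnW lt)) wtake_add after_cat wtake_cat_size wdrop_cat.
exact: h.
Qed.

Lemma live_words_exists q : live q -> exists w, live_words q w.
Proof.
move=> lq.
have [f hf] : {f : D -> 'I_r & forall q, live q -> live (delta q (f q))}.
  have h q' : exists a, live q' -> live (delta q' a).
    have [lq'|nlq'] := boolP (live q'); first by have [a la] := live_next lq'; exists a.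
    by have [a _] := live_next lq; exists a.
  by have [f hf] := choice h; exists f.
pose st := fix st n := if n is k.+1 then delta (st k) (f (st k)) else q.
have lst n : live (st n) by elim: n => [|n IH] //=; exact: hf.
exists (fun n => f (st n)) => n.
suff -> : after q (wtake n (fun n => f (st n))) = st n by exact: lst.
elim: n => [|n IH] //; rewrite wtakeSr -cats1 after_cat IH //.
Qed.

Definition stays (S : {set D}) (q : D) (u : seq 'I_r) : Prop :=
  forall k, (k <= size u)%N -> after q (take k u) \in S.

Definition unique_loops (S : {set D}) := forall q u v, q \in S -> size u = size v ->
  after q u = q -> after q v = q -> u = v.

(* A word is determined by the last visit of [q], at position [m] say, the letter
   read there and the rest, which avoids [q]: its first [m] letters form the only
   loop of length [m] at [q]. *)
Lemma coded_words (S0 : {set D}) : unique_loops S0 -> exists f, pbounded f /\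
  forall N, exists (M : finType) (code : {set D} -> D -> seq 'I_r -> M), (#|M| <= f N)%N /\
  forall (S : {set D}) q u v, S \subset S0 -> (size u <= N)%N -> size u = size v ->
    stays S q u -> stays S q v -> code S q u = code S q v -> u = v.
Proof.
move=> U.
suff [f [pf h]] : exists f, pbounded f /\
  forall N, exists (M : finType) (code : {set D} -> D -> seq 'I_r -> M), (#|M| <= f N)%N /\
  forall (S : {set D}) q u v, (#|S| <= #|D|)%N -> S \subset S0 -> (size u <= N)%N -> size u = size v ->
    stays S q u -> stays S q v -> code S q u = code S q v -> u = v.
  exists f; split=> // N; have [M [code [cM hc]]] := h N.
  exists M, code; split=> // S q u v; apply: hc; exact: max_card.
elim: #|D| => [|k [f [pf h]]].
  exists (fun=> 1%N); split; first exact: pbounded_const.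
  move=> N; exists unit, (fun _ _ _ => tt); rewrite card_unit; split=> // S q u v.
  by rewrite leqn0 cards_eq0 => /eqP -> _ _ _ /(_ 0%N isT); rewrite inE.
exists (fun n => n.+1 * (r * f n).+1)%N; split.
  apply: pboundedM; apply: pboundedS; first exact: pbounded_id.
  by apply: pboundedM => //; exact: pbounded_const.
move=> N; have [M [code [cM hc]]] := h N.
pose visit q u m := (m <= size u)%N && (after q (take m u) == q).
have ex q u : exists m, visit q u m by exists 0%N; rewrite /visit take0 eqxx.
have ub q u m : visit q u m -> (m <= size u)%N by case/andP.
pose last q u := ex_maxn (ex q u) (ub q u).
pose tail S q s : option ('I_r * M) :=
  if s is a :: s' then Some (a, code (S :\ q) (delta q a) s') else None.
exists ('I_N.+1 * option ('I_r * M))%type,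
  (fun S q u => (inord (last q u), tail S q (drop (last q u) u))).
split; first by rewrite card_prod card_option card_prod !card_ord leq_mul// ltnS leq_mul2l cM orbT.
move=> S q u v cS SS0 uN suv stu stv [].
rewrite /last; case: ex_maxnP => m /andP[mu /eqP qm] mmax.
case: ex_maxnP => m' /andP[mv /eqP qm'] mmax' /(congr1 val) /=.
rewrite !inordK ?ltnS ?(leq_trans mu)// ?(leq_trans mv) -?suv// => e; subst m'.
have qS : q \in S by have := stu 0%N isT; rewrite take0.
have e1 : take m u = take m v.
  apply: (U q) => //; first exact: (fintype.subsetP SS0).
  by rewrite !size_takel.
rewrite -{2}(cat_take_drop m u) -{2}(cat_take_drop m v) e1 => e2.
congr (_ ++ _); have sd : size (drop m u) = size (drop m v) by rewrite !size_drop suv.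
have tailst w : (m <= size w)%N -> after q (take m w) = q ->
    (forall n, visit q w n -> (n <= m)%N) -> stays S q w ->
    forall a s, drop m w = a :: s -> stays (S :\ q) (delta q a) s.
  move=> mw qw wmax stw a s ds j js.
  have ws : (m + j.+1 <= size w)%N.
    by rewrite -(cat_take_drop m w) size_cat ds size_takel//= leq_add2l.
  have e3 : after (delta q a) (take j s) = after q (take (m + j.+1) w).
    rewrite takeD ds /= after_cat qw //.
  rewrite e3 in_setD1 stw// andbT; apply/negP => /eqP e4.
  by have := wmax (m + j.+1)%N; rewrite /visit ws e4 eqxx => /(_ isT); lia.
have tu := tailst u mu qm mmax stu; have tv := tailst v mv qm' mmax' stv.
have sdu : (size (drop m u) <= N)%N by rewrite size_drop; lia.
move: tu tv e2 sd sdu; case: (drop m u) => [|a s]; case: (drop m v) => [|b t] //=.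
move=> /(_ _ _ erefl) tu /(_ _ _ erefl) tv [ab e2] [st] sN.
subst b; congr cons; apply: hc e2 => //.
- by move: cS; rewrite (cardsD1 q) qS.
- by apply: fintype.subset_trans SS0; exact: subD1set.
- exact: ltnW.
Qed.

Lemma unique_loops_polynomial (S0 : {set D}) q : unique_loops S0 ->
  exists f, pbounded f /\ forall N (X : {set N.-tuple 'I_r}),
    (forall t : N.-tuple 'I_r, t \in X -> stays S0 q t) -> (#|X| <= f N)%N.
Proof.
move=> /coded_words[f [pf h]]; exists f; split=> // N X hX.
have [M [code [cM hc]]] := h N; apply: leq_trans cM.
rewrite -(@card_in_imset _ _ (fun t : N.-tuple 'I_r => code S0 q t) X).
  exact: max_card.
move=> t t' tX t'X e; apply: val_inj; apply: hc (e) => //=; rewrite ?size_tuple//;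
  exact: hX.
Qed.

Definition reachable_live (q0 : D) : {set D} :=
  [set q | live q && `[< exists u, after q0 u = q >]]%SET.

(** All states along a live word are reachable and live, so unique loops at these states would give
    a polynomial bound. *)
Lemma exponential_loops q0 :
  ~ (exists f, pbounded f /\ forall N (X : {set N.-tuple 'I_r}),
      (forall t : N.-tuple 'I_r, t \in X -> live (after q0 t)) -> (#|X| <= f N)%N) ->
  exists q p u v, [/\ live q, after q0 p = q & [/\ after q u = q, after q v = q,
    size u = size v & u <> v]].
Proof.
move=> nf; apply: contrapT => no; apply: nf.
have U : unique_loops (reachable_live q0).
  move=> q u v; rewrite inE => /andP[lq /asboolP[p pq]] suv eu ev.
  by apply: contrapT => uv; apply: no; exists q, p, u, v.
have [f [pf h]] := unique_loops_polynomial q0 U.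
exists f; split=> // N X hX; apply: h => t /hX lt k kt.
rewrite inE; apply/andP; split; last by apply/asboolP; exists (take k t).
by apply: (@live_after _ (drop k t)); rewrite -after_cat cat_take_drop.
Qed.

Section Values.
Variable R : realType.
Hypothesis r_gt1 : (1 < r)%N.
Local Notation rr := (r%:R : R).

Definition live_values (q : D) : set R := [set nu R w | w in live_words q].

(** Compactness of the space of words: approximating words have a digitwise limit along a free
    ultrafilter, and each prefix of the limit is a prefix of some of them. *)
Lemma live_values_closed q : closed (live_values q).
Proof.
move=> x clx.
have h n : exists w, live_words q w /\ `|x - nu R w| < rr ^- n.
  have [_ [[w lw <-]]] := clx _ (nbhsx_ballx x _ (scale_gt0 R r_gt1 n)).
  by exists w.
have [w hw] := choice h.
have [U [UU Uf]] := free_ultrafilter; have PU := @ultra_proper _ _ UU.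
have dig k : exists a, U [set n | w n k = a].
  apply: contrapT => /forallNP no.
  have hU : U [set n | forall a, w n k <> a].
    apply: (ultra_forall UU Uf (X := fun a => [set n | w n k <> a])) => a.
    exact/(ultra_not UU [set n | w n k = a]).
  by have [n /(_ (w n k))] := filter_ex hU.
have [ws hws] := choice dig.
have pre k : U [set n | wtake k (w n) = wtake k ws].
  have := ultra_forall UU Uf (X := fun i : 'I_k => [set n | w n i = ws i]) (fun i => hws i).
  apply: filterS => n /= e; apply/wtake_eq => i ik; exact: (e (Ordinal ik)).
exists ws.
  by move=> k; have [n /= <-] := filter_ex (pre k); case: (hw n).
apply/eqP; rewrite -subr_eq0 -normr_le0 leNgt; apply/negP => pos.
have [k hk] := scale_small r_gt1 (divr_gt0 pos (ltr0n R 2)).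
have [n [/= e kn]] := filter_ex (filterI (pre k) (Uf k)).
have [_ h1] := hw n; have h2 := nu_wtake R r_gt1 e.
have h3 : rr ^- n <= rr ^- k.
  have r0 : 0 < rr by rewrite ltr0n; apply: ltn_trans r_gt1.
  by rewrite lef_pV2 ?posrE ?exprn_gt0// ler_eXn2l// ltr1n.
have := ler_distD (nu R (w n)) (nu R ws) x.
by rewrite (distrC (nu R ws) (nu R (w n))) (distrC (nu R (w n)) x) => h4; lra.
Qed.

Lemma live_values_cat q p x : live_values (after q p) x ->
  live_values q (wval R p + rr ^- size p * x).
Proof.
move=> [w lw <-]; exists (wcat p w); first exact/live_words_cat.
by rewrite nu_cat.
Qed.

(** The ends of the cylinder are excluded, because a word outside the cylinder may have the same
    value. *)
Lemma live_values_cylinder q p x : 0 < x < 1 ->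
  live_values q (wval R p + rr ^- size p * x) -> live_values (after q p) x.
Proof.
move=> /andP[x0 x1] [w lw wx].
have s0 := scale_gt0 R r_gt1 (size p).
have e : wtake (size p) w = p.
  apply: (nu_prefix (R := R) r_gt1); rewrite wx ltrDl mulr_gt0//=.
  by rewrite ltrD2l gtr_pMr.
exists (wdrop (size p) w).
  by apply/live_words_cat; rewrite -{1}e wcat_take_drop.
move: wx; rewrite (nu_split _ r_gt1 (size p) w) e => /addrI.
exact: (mulfI (lt0r_neq0 s0)).
Qed.

End Values.

End Automaton.

(** * The subset automaton of a coordinate projection *)

Section Projection.
Variables (r d : nat) (B : buchi (digits r d)) (i : 'I_d).
Local Notation Q := (state B).
Local Notation L := (buchi_language B).

(** Forgetting the other digits creates nondeterminism, which the subsets remove. With useful states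
    only, a prefix is live exactly when it extends to a word of the projection. *)
Definition subset_step (X : {set Q}) (a : 'I_r) : {set Q} :=
  [set q' in useful B | [exists q, (q \in X) && (q \in useful B) &&
     [exists x : digits r d, (x i == a) && trans q x q']]]%SET.

Definition subset_live (X : {set Q}) : bool := [exists q, (q \in X) && (q \in useful B)].

Definition subset_init : {set Q} := [set init B]%SET.

Lemma subset_stepP X a q' : q' \in subset_step X a <-> q' \in useful B /\
  exists q (x : digits r d), [/\ q \in X, q \in useful B, x i = a & trans q x q'].
Proof.
rewrite inE; split=> [/andP[uq' /existsP[q /andP[/andP[qX uq] /existsP[x /andP[/eqP xa t]]]]]|].
  by split=> //; exists q, x.
move=> [-> [q [x [qX uq xa t]]]] /=; apply/existsP; exists q; rewrite qX uq /=.
by apply/existsP; exists x; rewrite xa eqxx.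
Qed.

Lemma subset_live_prefix X a : subset_live (subset_step X a) -> subset_live X.
Proof.
move=> /existsP[q' /andP[/subset_stepP[_ [q [x [qX uq _ _]]]] _]].
by apply/existsP; exists q; rewrite qX.
Qed.

Lemma useful_step q q1 x : q \in useful B -> trans q x q1 ->
  (exists w, accepted [set: Q]%SET q1 w) -> q1 \in useful B.
Proof.
move=> /usefulP[[u p] _] t acc; apply/usefulP; split=> //.
exists (rcons u x); rewrite -cats1; apply: rpath_cat p _.
by exists q1; rewrite inE.
Qed.

Lemma subset_live_next X : subset_live X -> exists a, subset_live (subset_step X a).
Proof.
move=> /existsP[q /andP[qX uq]]; have /usefulP[_ [w acc]] := uq.
have [q1 [p acc1]] := accepted_drop 1 acc.
move: p => [q1' [_ t e]]; subst q1'.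
have uq1 : q1 \in useful B by apply: useful_step uq t _; exists (wdrop 1 w).
exists (w 0%N i); apply/existsP; exists q1; rewrite uq1 andbT.
by apply/subset_stepP; split=> //; exists q, (w 0%N).
Qed.

Local Notation after := (after subset_step).
Local Notation live_words := (live_words subset_step subset_live).

Lemma mem_after X u q : q \in after X u <-> exists q0 v,
  [/\ q0 \in X, coords i v = u, rpath (useful B) q0 v q & (u = [::] \/ q0 \in useful B)].
Proof.
elim: u X => [|a u IH] X /=.
  split=> [qX|[q0 [v [q0X]]]]; first by exists q, [::]; split=> //; left.
  by case: v => //= _ <-.
rewrite IH; split=> [[q1 [v [/subset_stepP[uq1 [q0 [x [q0X uq0 xa t]]]] cv p _]]]|].
  by exists q0, (x :: v); split=> //=; [rewrite xa cv|exists q1|right].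
move=> [q0 [[|x v] [q0X]]] //= [xa cv] [q1 [uq1 t p]] [//|uq0].
exists q1, v; split=> //; last by right.
by apply/subset_stepP; split=> //; exists q0, x.
Qed.

Lemma subset_liveP u : subset_live (after subset_init u) <->
  exists w, L w /\ wtake (size u) (coordw i w) = u.
Proof.
split=> [/existsP[q /andP[/mem_after[q0 [v [q0i cv p _]]] /usefulP[_ [w acc]]]]|[w [Lw wu]]].
  move: q0i; rewrite inE => /eqP q0i; subst q0.
  exists (wcat v w); split.
    apply/buchi_languageP; apply: accepted_cat acc; first by rewrite inE.
    by apply: rpath_sub p; exact: finset.subsetT.
  have sv : size u = size v by rewrite -cv size_map.
  by rewrite sv (wtake_map (fun a : digits r d => a i)) wtake_cat_size.
have /accepted_useful acc := Lw.
have [q [p /accepted_start uq]] := accepted_drop (size u) acc.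
apply/existsP; exists q; rewrite uq andbT; apply/mem_after.
exists (init B), (wtake (size u) w); split=> //; first by rewrite inE.
  by rewrite -[RHS]wu (wtake_map (fun a : digits r d => a i)).
by right; exact: accepted_start acc.
Qed.

Lemma live_words_coordw w : L w -> live_words subset_init (coordw i w).
Proof. by move=> Lw n; apply/subset_liveP; exists w; rewrite size_wtake. Qed.

Variable R : realType.
Hypothesis r_gt1 : (1 < r)%N.

(** The closure forgets the acceptance condition: a word all of whose prefixes occur in the
    projected language is a limit of words of that language. *)
Lemma closure_coord_proj :
  closure (coord_proj i (@nu_vec R r d @` L)) =
  live_values (R := R) subset_step subset_live subset_init.
Proof.
apply/seteqP; split=> x.
  have := live_values_closed r_gt1 (q := subset_init) (R := R) (delta := subset_step)
    (live := subset_live).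
  rewrite closureE => cl; apply; split=> // _ [_ [w Lw <-] <-].
  by exists (coordw i w); [exact: live_words_coordw|rewrite mxE].
move=> [w lw <-] V /nbhs_ballP[e /= e0 eV].
have [n hn] := scale_small r_gt1 e0.
have /subset_liveP[w' [Lw' e']] := lw n.
exists (nu R (coordw i w')); split.
  by exists (nu_vec R w'); [exists w'|rewrite mxE].
apply: eV; apply: le_lt_trans hn.
by apply: nu_wtake => //; rewrite size_wtake in e'.
Qed.

End Projection.

Lemma pbounded_prod n (f : 'I_n -> nat -> nat) : (forall i, pbounded (f i)) ->
  pbounded (fun k => \prod_i f i k)%N.
Proof.
elim: n f => [|n IH] f pf.
  by apply: pbounded_le (pbounded_const 1) => k; rewrite big_ord0.
apply: pbounded_le (pboundedM (pf ord0) (IH (fun i => f (lift ord0 i)) _)) => [k|i].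
  by rewrite big_ord_recl.
exact: pf.
Qed.

(** A prefix is determined by its [d] coordinates, so polynomial bounds for all projections multiply
    to one for the language. *)
Lemma not_sparse_loops (r d : nat) (B : buchi (digits r d)) :
  ~ sparse_language (buchi_language B) -> exists i : 'I_d, exists q p u v,
  [/\ subset_live q, after (subset_step i) (subset_init B) p = q &
    [/\ after (subset_step i) q u = q, after (subset_step i) q v = q,
        size u = size v & u <> v]].
Proof.
move=> nsp; apply: contrapT => no; apply: nsp; split; first by exists B.
have h (i : 'I_d) : exists f, pbounded f /\ forall N (X : {set N.-tuple 'I_r}),
    (forall t : N.-tuple 'I_r, t \in X -> subset_live (after (subset_step i) (subset_init B) t)) ->
    (#|X| <= f N)%N.
  apply: contrapT => nf; apply: no; exists i.
  exact: (exponential_loops (@subset_live_prefix _ _ B i)) nf.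
have [f hf] := choice h.
have [c [k hck]] := pbounded_prod (fun i => (hf i).1).
exists c, k => n; apply: leq_trans (hck n).
pose X i : {set n.-tuple 'I_r} :=
  [set t : n.-tuple 'I_r | subset_live (after (subset_step i) (subset_init B) t)]%SET.
pose g (t : n.-tuple (digits r d)) : {ffun 'I_d -> n.-tuple 'I_r} :=
  [ffun i => [tuple of coords i t]].
have ginj : injective g.
  move=> t t' /ffunP e; apply/eq_from_tnth => j; apply/ffunP => i.
  have := e i; rewrite !ffunE => /(congr1 (fun t => tnth t j)).
  by rewrite !tnth_map.
rewrite -(card_imset _ ginj).
apply: leq_trans (leq_prod (fun i _ => (hf i).2 n (X i) _)); last first.
  by move=> i _ t; rewrite inE.
have -> : (\prod_i #|X i| = #|family (fun i => mem (X i))|)%N.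
  by rewrite card_family foldrE big_image.
apply: subset_leq_card; apply/fintype.subsetP => _ /imsetP[t + ->].
move=> /prefixes_mem[w Lw wt]; apply/familyP => i; rewrite ffunE inE /=.
apply/subset_liveP; exists w; split=> //.
by rewrite size_map size_tuple (wtake_map (fun a : digits r d => a i)) wt.
Qed.

(** * Hausdorff dimension *)

Section Dimension.
Variable R : realType.
Implicit Types (X C U : set R) (s : R).
Local Open Scope ereal_scope.

Lemma diameter_ge0 U : 0 <= diameter U.
Proof. by apply: ereal_sup_ubound; left. Qed.

Lemma diameter_dist U (x y : R) : U x -> U y -> `|x - y|%:E <= diameter U.
Proof. by move=> Ux Uy; apply: ereal_sup_ubound; right; exists x, y. Qed.

Lemma diameter_le U (a : R) : (0 <= a)%R ->
  (forall x y, U x -> U y -> (`|x - y| <= a)%R) -> diameter U <= a%:E.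
Proof.
move=> a0 h; apply: ge_ereal_sup => _ [-> |[x [y [Ux Uy ->]]]]; rewrite lee_fin//.
exact: h.
Qed.

Lemma diameter_pow_ge0 s U : 0 <= diameter_pow s U.
Proof. by rewrite /diameter_pow; case: ifP => // _; exact: poweR_ge0. Qed.

Lemma diameter_pow_dist s U (x y : R) : (0 <= s)%R -> U x -> U y ->
  (`|x - y| `^ s)%:E <= diameter_pow s U.
Proof.
move=> s0 Ux Uy; rewrite /diameter_pow; case: eqP => [U0|_].
  by move: Ux; rewrite U0.
rewrite -poweR_EFin; apply: gt0_ler_poweR => //.
- by rewrite in_itv /= leey andbT lee_fin.
- by rewrite in_itv /= leey andbT diameter_ge0.
- exact: diameter_dist.
Qed.

(** A cover of [X] by sets [U n] yields a cover of [[0, 1)] by intervals of length at most [2 * c]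
    times the [s]-th power of the diameter of [U n], which bounds the sum of these powers from
    below. *)
Lemma hausdorff_measure_holder X C (f : R -> R) s (c : R) : (0 <= s)%R -> (0 <= c)%R ->
  C `<=` X ->
  (forall x y, C x -> C y -> (`|f x - f y| <= c * `|x - y| `^ s)%R) ->
  (forall y, (0 <= y < 1)%R -> exists2 x, C x & f x = y) ->
  hausdorff_measure s X <> 0.
Proof.
move=> s0 c0 CX fh fs H0.
have pm : hausdorff_premeasure s 1 X <= 0.
  rewrite -H0; apply: ereal_sup_ubound; exists 1%R => //=.
(* Chosen so that [2 * c * eps < 1]. *)
pose eps : R := (4^-1 / (c + 1))%R.
have c1 : (0 < c + 1)%R by rewrite ltr_wpDl.
have eps0 : (0 < eps)%R by rewrite divr_gt0// invr_gt0.
have [_ [U [XU _ ->]] Ueps] : exists2 y, [set v : \bar R | exists U : nat -> set R,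
    [/\ X `<=` \bigcup_n U n, forall n, diameter (U n) <= 1%:E &
        v = \sum_(0 <= n <oo) diameter_pow s (U n)]] y & y < eps%:E.
  by apply: ereal_inf_lt; apply: le_lt_trans pm _; rewrite lte_fin.
have dU0 n : 0 <= diameter_pow s (U n) := diameter_pow_ge0 s (U n).
have dUfin n : diameter_pow s (U n) \is a fin_num.
  rewrite ge0_fin_numE//; apply: le_lt_trans (ltry eps); apply: ltW.
  apply: le_lt_trans Ueps; apply: le_trans (nneseries_lim_ge n.+1 _) => //.
  by rewrite big_nat_recr//= leeDr// sume_ge0.
have h n : exists I : set R, [/\ measurable I,
    lebesgue_measure I <= (2 * c)%:E * diameter_pow s (U n) &
    forall x, U n x -> C x -> I (f x)].
  have [[x0 [Ux0 Cx0]]|no] := EM (exists x, U n x /\ C x); last first.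
    exists set0; split=> //.
    - by rewrite measure0 mule_ge0// lee_fin mulr_ge0.
    - by move=> x Ux Cx; apply: no; exists x.
  set dn := diameter_pow s (U n).
  have dnE : dn = (fine dn)%:E by rewrite fineK// dUfin.
  have fd0 : (0 <= fine dn)%R by apply: fine_ge0; exact: dU0.
  exists [set` `[(f x0 - c * fine dn)%R, (f x0 + c * fine dn)%R]]; split=> //.
    rewrite lebesgue_measure_itv /=; case: ifP => _; last first.
      by apply: mule_ge0; [rewrite lee_fin mulr_ge0|exact: dU0].
    by rewrite dnE -EFinD -EFinM lee_fin; lra.
  move=> x Ux Cx; rewrite /= in_itv /= -ler_distl.
  apply: le_trans (fh _ _ Cx Cx0) _; apply: ler_wpM2l => //.
  by rewrite -lee_fin -dnE; exact: diameter_pow_dist.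
have [I hI] := choice h.
have cov : [set` `[0%R, 1%R[] `<=` \bigcup_n I n.
  move=> y; rewrite /= in_itv /= => /fs[x Cx <-].
  by have [n _ Ux] := XU _ (CX _ Cx); exists n => //; have [_ _] := hI n; apply.
have mI n : measurable (I n) by case: (hI n).
have le1 : 1%:E <= \sum_(0 <= n <oo) lebesgue_measure (I n).
  have <- : lebesgue_measure [set` `[0%R, (1%R : R)[] = 1%:E.
    by rewrite lebesgue_measure_itv /= lte_fin ltr01 sube0.
  exact: (measure_sigma_subadditive (@lebesgue_measure R) mI (measurable_itv _) cov).
have : 1%:E <= (2 * c)%:E * eps%:E.
  apply: le_trans le1 _.
  apply: (@le_trans _ _ (\sum_(0 <= n <oo) ((2 * c)%:E * diameter_pow s (U n)))).
    by apply: lee_nneseries => // n _; have [_ + _] := hI n.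
  rewrite nneseriesZl//; apply: lee_wpmul2l; last exact: ltW.
  by rewrite lee_fin mulr_ge0.
rewrite -EFinM lee_fin /eps => le2.
have : (2 * c * (4^-1 / (c + 1)) < 1)%R by rewrite mulrA ltr_pdivrMr//; lra.
by rewrite ltNge le2.
Qed.

Lemma hausdorff_dim_lt X s : hausdorff_dim X < s%:E -> exists2 t,
  (0 <= t < s)%R & hausdorff_measure t X = 0.
Proof.
move=> /ereal_inf_lt[_ [t [t0 Ht] <-]]; rewrite lte_fin => ts.
by exists t; rewrite ?t0.
Qed.

Lemma hausdorff_dim_lt1_no_interior X (a b : R) : hausdorff_dim X < 1 -> (a < b)%R ->
  exists2 x, (a < x < b)%R & ~ X x.
Proof.
move=> /hausdorff_dim_lt[s /andP[s0 s1] Hs] ab; apply: contrapT => no.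
have abX x : (a < x < b)%R -> X x.
  by move=> xab; apply: contrapT => nX; apply: no; exists x.
(* On an interval of length at most 1, [|x - y| <= |x - y| ^ s] because [s < 1], so an affine map
   onto [[0, 1)] is Hoelder. *)
pose m := Num.min ((b - a) / 2)%R 1%R.
have m0 : (0 < m)%R by rewrite lt_min ltr01 andbT divr_gt0// subr_gt0.
have m1 : (m <= 1)%R by rewrite ge_min lexx orbT.
have mb : (a + m + m <= b)%R.
  have : (m <= (b - a) / 2)%R by rewrite ge_min lexx.
  lra.
pose x0 := (a + m / 2)%R.
apply: (@hausdorff_measure_holder X [set x | x0 <= x < x0 + m]%R
  (fun x => (x - x0) / m)%R s m^-1) Hs => //.
- by rewrite invr_ge0 ltW.
- move=> x /= /andP[h1 h2]; apply: abX; rewrite /x0 in h1 h2.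
  by apply/andP; split; lra.
- move=> x y /= /andP[x1 x2] /andP[y1 y2].
  rewrite -mulrBl opprB addrA subrK normrM [`|m^-1|%R]gtr0_norm ?invr_gt0// mulrC.
  rewrite ler_pM2l ?invr_gt0//.
  have [->|xy] := eqVneq `|x - y|%R 0%R; first exact: powR_ge0.
  have xy0 : (0 < `|x - y|)%R by rewrite lt_neqAle eq_sym xy /=.
  rewrite -[leLHS]powRr1//; apply: ger_powR; last exact: ltW.
  by rewrite xy0 /= ler_norml; apply/andP; split; lra.
- move=> y /andP[y0 y1]; exists (x0 + m * y)%R.
    rewrite /= lerDl mulr_ge0 ?(ltW m0)//= ltrD2l -{2}(mulr1 m).
    by rewrite ltr_pM2l.
  by rewrite addrC addKr mulrC mulKf// gt_eqF.
Qed.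

Lemma hausdorff_dim_eq0 X : (forall s, (0 < s)%R -> hausdorff_measure s X = 0) ->
  hausdorff_dim X = 0.
Proof.
move=> h; apply/eqP; rewrite eq_le; apply/andP; split.
  apply/lee_addgt0Pr => e e0; rewrite add0e; apply: ereal_inf_lbound.
  by exists e => //; split; [exact: ltW|exact: h].
by apply: le_ereal_inf_tmp => _ [s [s0 _] <-]; rewrite lee_fin.
Qed.

Lemma hausdorff_measure_finite_covers X s : (0 < s)%R ->
  (forall delta eps : R, (0 < delta)%R -> (0 < eps)%R ->
    exists (n : nat) (U : nat -> set R) (a : R), [/\ X `<=` \bigcup_(k in [set k | (k < n)%N]) U k,
      forall k x y, U k x -> U k y -> (`|x - y| <= a)%R,
      (0 <= a <= delta)%R & (n%:R * a `^ s <= eps)%R]) ->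
  hausdorff_measure s X = 0.
Proof.
move=> s0 h; apply/eqP; rewrite eq_le; apply/andP; split; last first.
  apply: (@le_trans _ _ (hausdorff_premeasure s 1 X)); last first.
    by apply: ereal_sup_ubound; exists 1%R => /=.
  apply: le_ereal_inf_tmp => _ [U [_ _ ->]]; apply: nneseries_ge0 => n _ _.
  exact: diameter_pow_ge0.
apply: ge_ereal_sup => _ [delta /= delta0 <-].
apply/lee_addgt0Pr => eps eps0; rewrite add0e.
have [n [U [a [XU Ua /andP[a0 ad] sm]]]] := h _ _ delta0 eps0.
(* Empty sets complete the sequence; they contribute 0 by the convention in [diameter_pow]. *)
pose V k := if (k < n)%N then U k else set0.
have dV k : diameter (V k) <= a%:E.
  by apply: diameter_le => // x y; rewrite /V; case: ifP => // _; exact: Ua.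
have pV k : diameter_pow s (V k) <= (a `^ s)%:E.
  rewrite /diameter_pow; case: ifP => _; first by rewrite lee_fin powR_ge0.
  rewrite -poweR_EFin; apply: gt0_ler_poweR (dV k); first exact: ltW.
    by rewrite in_itv /= leey andbT diameter_ge0.
  by rewrite in_itv /= leey andbT lee_fin.
apply: (@le_trans _ _ (\sum_(0 <= k <oo) diameter_pow s (V k))).
  apply: ereal_inf_lbound; exists V; split=> //.
    move=> x /XU[k /= kn Ux]; exists k => //; by rewrite /V kn.
  by move=> k; apply: le_trans (dV k) _; rewrite lee_fin.
rewrite (nneseries_split 0%N n) ?add0n; last by move=> *; exact: diameter_pow_ge0.
rewrite [X in _ + X]eseries0 ?adde0; last first.
  move=> k nk _; rewrite /diameter_pow /V ltnNge nk /=.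
  by rewrite eqxx.
apply: (@le_trans _ _ (\sum_(0 <= k < n) (a `^ s)%:E)).
  by apply: lee_sum => k _; exact: pV.
rewrite sumEFin lee_fin big_const_nat subn0 iter_addr_0 -mulr_natl.
by [].
Qed.

End Dimension.

Section PowR.
Variable R : realType.

Lemma powR_exprn (x s : R) n : 0 <= x -> (x ^+ n) `^ s = (x `^ s) ^+ n.
Proof.
move=> x0; elim: n => [|n IH]; first by rewrite !expr0 powR1.
by rewrite !exprS powRM ?exprn_ge0// IH.
Qed.

(** Some [t ^+ m] is at most 1/2. Along [n = m * (k + n0)] the claim then compares a polynomial in
    [k] with [2 ^ k]. *)
Lemma pbounded_mul_powR (f : nat -> nat) (t eps : R) (n0 : nat) : pbounded f ->
  0 <= t < 1 -> 0 < eps -> exists2 n, (n0 <= n)%N & (f n)%:R * t ^+ n <= eps.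
Proof.
move=> pf /andP[t0 t1] eps0.
have [m hm] : exists m, t ^+ m <= 2^-1.
  have nt : `|t| < 1 by rewrite ger0_norm.
  have h0 : (0 : R) < 2^-1 by rewrite invr_gt0.
  have := cvg_expr nt => /cvgrPdist_lt /(_ _ h0) [m _ /(_ m (leqnn m))] /=.
  rewrite sub0r normrN ger0_norm ?exprn_ge0// => h.
  by exists m; exact: ltW.
have [m0|m0] := posnP m.
  by move: hm; rewrite m0 expr0 => h; exfalso; move: h; lra.
pose M := (Num.truncn eps^-1).+1.
have MP : eps^-1 < M%:R by rewrite truncnS_gt.
have pg : pbounded (fun k => M * f (m * (k + n0)))%N.
  apply: pboundedM (pbounded_const M) _.
  have [C [K h]] := pf; apply: (pbounded_le (fun k => h (m * (k + n0))%N)).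
  apply: pboundedM (pbounded_const C) _; apply: pboundedX.
  apply: pboundedS.
  apply: pboundedM (pbounded_const m) _.
  exact: pboundedD pbounded_id (pbounded_const n0).
have [k hk] := pbounded_lt_exp pg.
exists (m * (k + n0))%N; first by apply: leq_trans (leq_addl k n0) _; rewrite leq_pmull.
rewrite exprM; apply: (@le_trans _ _ ((f (m * (k + n0)))%:R * 2^-1 ^+ k)).
  apply: ler_wpM2l => //; apply: (@le_trans _ _ (2^-1 ^+ (k + n0))).
    by apply: lerXn2r; rewrite ?nnegrE ?exprn_ge0 ?invr_ge0.
  rewrite exprD ler_piMr ?exprn_ge0 ?invr_ge0//.
  by apply: exprn_ile1; rewrite ?invr_ge0// invf_le1// ler1n.
rewrite exprVn ler_pdivrMr ?exprn_gt0//.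
have : (M * f (m * (k + n0)))%:R <= (2 ^ k)%:R :> R by rewrite ler_nat ltnW.
rewrite natrM natrX => h.
rewrite -ler_pdivrMl// ; apply: le_trans h.
by apply: ler_wpM2r => //; exact: ltW.
Qed.

End PowR.

Section SparseDimension.
Variables (R : realType) (r d : nat).
Hypothesis r_gt1 : (1 < r)%N.
Local Notation rr := (r%:R : R).

Let rr_gt0 : 0 < rr. Proof. by rewrite ltr0n; apply: ltn_trans r_gt1. Qed.

(** The cylinders of the prefixes of length [n] are polynomially many closed intervals of length
    [r ^- n]. A finite union of them is closed, so it covers the closure. *)
Lemma sparse_dim0 (A : set 'rV[R]_d) (i : 'I_d) : sparse_set r A ->
  hausdorff_dim (closure (coord_proj i A)) = 0%E.
Proof.
move=> [L [_ [c [k hck]]] ->].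
apply: hausdorff_dim_eq0 => s s0; apply: hausdorff_measure_finite_covers => // delta eps d0 e0.
have [n1 hn1] := scale_small r_gt1 d0.
pose f n := #|prefixes L n|; pose t := rr^-1 `^ s.
have t01 : 0 <= t < 1.
  rewrite powR_ge0 /= /t /powR gt_eqF ?invr_gt0//.
  rewrite -[ltRHS]expR0 ltr_expR pmulr_rlt0// lnV ?posrE// oppr_lt0 ln_gt0//.
  by rewrite ltr1n.
have pf : pbounded f by exists c, k.
have [n n1n hn] := pbounded_mul_powR n1 pf t01 e0.
pose l := [seq coords i (tval t) | t <- enum (prefixes L n)].
pose U j := [set` `[wval R (nth [::] l j), wval R (nth [::] l j) + rr ^- n]].
exists (f n), U, (rr ^- n); split.
- have cl : closed (\bigcup_(j in [set j | (j < f n)%N]) U j).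
    apply: closed_bigcup; first exact: finite_II.
    by move=> j _; exact: interval_closed.
  rewrite closureE => x; apply.
  split=> // _ [_ [w Lw <-] <-]; rewrite mxE.
  have st : size (wtake n w) == n by rewrite size_wtake.
  pose tw := Tuple st; have twL : tw \in prefixes L n by apply/prefixes_mem; exists w.
  exists (index tw (enum (prefixes L n))) => /=.
    by rewrite /f cardE index_mem mem_enum.
  rewrite /U (nth_map tw) ?index_mem ?mem_enum// nth_index ?mem_enum//=.
  rewrite in_itv /= /coords -(wtake_map (fun a : digits r d => a i)) (nu_split R r_gt1 n).
  have p0 := scale_gt0 R r_gt1 n.
  rewrite lerDl lerD2l mulr_ge0 ?nu_ge0 ?(ltW p0)//=.
  by rewrite ger_pMr// nu_le1.
- move=> j x y; rewrite /U /= !in_itv /= => /andP[x1 x2] /andP[y1 y2].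
  by rewrite ler_norml; apply/andP; split; lra.
- rewrite ltW ?scale_gt0//=; apply: le_trans (ltW hn1).
  by rewrite lef_pV2 ?posrE ?exprn_gt0// ler_eXn2l// ltr1n.
- by rewrite -exprVn powR_exprn// invr_ge0 ltW.
Qed.

End SparseDimension.

(** * Infinite products of two blocks and their dimension *)

Section InfiniteBlocks.
Variables (T : Type) (x0 : T) (u v : seq T).
Hypotheses (suv : size u = size v) (u_gt0 : (0 < size u)%N).

Definition wblocks (b : nat -> bool) : word T := fun i =>
  nth x0 (if b (i %/ size u)%N then u else v) (i %% size u).

Lemma wblocksE b :
  wblocks b = wcat (if b 0%N then u else v) (wblocks (fun i => b i.+1)).
Proof.
apply: funext => i; rewrite (wcatE _ _ x0).
have -> : size (if b 0%N then u else v) = size u by case: (b _).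
rewrite /wblocks; case: ltnP => h; first by rewrite divn_small// modn_small.
by rewrite -{1 2}(subnKC h) divnDl// divnn u_gt0 modnDl add1n.
Qed.

Lemma wtake_wblocks b n :
  wtake (n * size u) (wblocks b) = blocks u v (mkseq b n).
Proof.
elim: n b => [|n IH] b //; rewrite mulSn wtake_add wblocksE.
have -> : mkseq b n.+1 = b 0%N :: mkseq (fun i => b i.+1) n by exact: (wtakeS n b).
rewrite /blocks /= -/(blocks u v _) -IH.
have -> : size u = size (if b 0%N then u else v) by case: (b _).
by rewrite wtake_cat_size wdrop_cat.
Qed.

End InfiniteBlocks.

Lemma first_difference (b b' : nat -> bool) : b <> b' ->
  exists n, (forall i, (i < n)%N -> b i = b' i) /\ b n != b' n.
Proof.
move=> ne; have ex : exists n, b n != b' n.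
  apply: contrapT => no; apply: ne; apply: funext => n; apply/eqP/negPn/negP => h.
  by apply: no; exists n.
case: (ex_minnP ex) => n hn min; exists n; split=> // i ilt.
by apply/eqP/negPn/negP => /min; rewrite leqNgt ilt.
Qed.

Section Binary.
Variable R : realType.

Definition bits (b : nat -> bool) : word 'I_2 := fun i => inord (b i).

Lemma bits_nu_close (b b' : nat -> bool) n : (forall i, (i < n)%N -> b i = b' i) ->
  `|nu R (bits b) - nu R (bits b')| <= 2 ^- n.
Proof.
by move=> h; apply: nu_wtake => //; apply/wtake_eq => i ilt; rewrite /bits h.
Qed.

Lemma bits_nu_surj (y : R) : 0 <= y < 1 -> exists b, nu R (bits b) = y.
Proof.
move=> y01.
(* The greedy expansion: [st n] is the fractional part of [2 ^ n * y]. *)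
pose st := fix st n : R := if n is k.+1 then 2 * st k - (2^-1 <= st k)%R%:R else y.
have st01 n : 0 <= st n < 1.
  elim: n => [|n /andP[h1 h2]] //=; case: (leP _ (st n)) => h; rewrite /= ?mulr1n ?mulr0n; apply/andP; split; lra.
pose b n := 2^-1 <= st n; exists b.
have inv n : wval R (wtake n (bits b)) + 2 ^- n * st n = y.
  elim: n => [|n IH]; first by rewrite /= expr0 invr1 mul1r add0r.
  rewrite wtakeSr -cats1 wval_cat// size_wtake /= -[RHS]IH -addrA; congr (_ + _).
  rewrite exprS invfM /bits inordK; last by case: (b n).
  have -> : (b n : nat)%:R = (2^-1 <= st n)%R%:R :> R by [].
  by field; rewrite expf_neq0.
apply/eqP; rewrite -subr_eq0 -normr_le0 leNgt; apply/negP => pos.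
have [n hn] := @scale_small R 2 isT _ pos.
have := inv n; rewrite (@nu_split R 2 isT n (bits b)) in hn *.
have := @nu_ge0 R 2 isT (wdrop n (bits b)); have := @nu_le1 R 2 isT (wdrop n (bits b)).
move: hn; move: (wval R _) (nu R _) (st01 n) => V W; move: (st n) => S /andP[S0 S1].
move=> hn W1 W0 e; move: hn; rewrite -e.
have -> : V + 2 ^- n * W - (V + 2 ^- n * S) = 2 ^- n * (W - S) by ring.
have p : 0 < 2 ^- n :> R by rewrite invr_gt0 exprn_gt0.
rewrite normrM gtr0_norm// ltNge => /negP; apply.
by rewrite ger_pMr// ler_norml; apply/andP; split; lra.
Qed.

End Binary.

Section Separated.
Variables (R : realType) (r : nat).
Hypothesis r_gt1 : (1 < r)%N.
Local Notation rr := (r%:R : R).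
Variables (u v : seq 'I_r).
Hypotheses (suv : size u = size v) (u_gt0 : (0 < size u)%N).
Hypothesis sep : wval R u + 2 * rr ^- size u <= wval R v.
Variable x0 : 'I_r.

Let rr_gt0 : 0 < rr. Proof. by rewrite ltr0n; apply: ltn_trans r_gt1. Qed.

Local Notation W b := (nu R (wblocks x0 u v b)).
Local Notation sc := (rr ^- size u).

Lemma nu_wblocks b : W b = wval R (if b 0%N then u else v) + sc * W (fun i => b i.+1).
Proof.
rewrite {1}(wblocksE x0 suv u_gt0) nu_cat//.
by have -> : size (if b 0%N then u else v) = size u by case: (b _).
Qed.

(** The factor 2 in [sep] leaves a distance of at least [sc] between the cylinders of [u] and [v];
    each common block before them scales it by [sc]. *)
Lemma wblocks_separated b b' n : (forall i, (i < n)%N -> b i = b' i) -> b n != b' n ->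
  sc ^+ n.+1 <= `|W b - W b'|.
Proof.
have s0 : 0 < sc := scale_gt0 R r_gt1 _.
elim: n b b' => [|n IH] b b' h ne.
  rewrite (nu_wblocks b) (nu_wblocks b') expr1.
  have := nu_ge0 R r_gt1 (wblocks x0 u v (fun i => b i.+1)).
  have := nu_le1 R r_gt1 (wblocks x0 u v (fun i => b i.+1)).
  have := nu_ge0 R r_gt1 (wblocks x0 u v (fun i => b' i.+1)).
  have := nu_le1 R r_gt1 (wblocks x0 u v (fun i => b' i.+1)).
  move: (W _) (W _) => x y x1 x0' y1 y0.
  have xs : sc * x <= sc by rewrite ger_pMr.
  have ys : sc * y <= sc by rewrite ger_pMr.
  have xs0 : 0 <= sc * x by rewrite mulr_ge0// ltW.
  have ys0 : 0 <= sc * y by rewrite mulr_ge0// ltW.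
  move: (sc * x) (sc * y) xs ys xs0 ys0 => X Y xs ys xs0 ys0.
  have sep' := sep; case: (b 0%N) (b' 0%N) ne => -[] // _.
    by rewrite ler_normr; apply/orP; right; lra.
  by rewrite ler_normr; apply/orP; left; lra.
rewrite (nu_wblocks b) (nu_wblocks b') (h 0%N)//.
rewrite opprD addrACA subrr add0r -mulrBr normrM gtr0_norm// exprS ler_pM2l//.
by apply: IH => // i ilt; apply: h.
Qed.

Lemma wblocks_nu_inj : injective (fun b => W b).
Proof.
move=> b b' e; apply: contrapT => ne.
have [n [h1 h2]] := first_difference ne.
have := wblocks_separated h1 h2; rewrite e subrr normr0 leNgt => /negP; apply.
by rewrite exprn_gt0// scale_gt0.
Qed.

(** Sequences that first differ at [n] have values at distance at least [c * sc ^+ n.+1], and binary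
    values at distance at most [2 ^- n]. For [t] below [sl] one has [1/2 <= sc ^ t], so the map to
    binary values is Hoelder of exponent [t]. The 2 in its constant makes up for the shift from [n]
    to [n.+1]. *)
Lemma wblocks_dim_gt0 (X : set R) (a c : R) : 0 < c ->
  (forall b, X (a + c * W b)) -> hausdorff_dim X <> 0%E.
Proof.
move=> c0 hX dim0.
have s0 : 0 < sc := scale_gt0 R r_gt1 _.
have lr : 0 < ln rr by rewrite ln_gt0// ltr1n.
have l2 : 0 < ln (2 : R) by rewrite ln_gt0// ltr1n.
pose sl := ln 2 / ((size u)%:R * ln rr) : R.
have sl0 : 0 < sl by rewrite divr_gt0// mulr_gt0// ltr0n.
have [t /andP[t0 tsl] Ht] : exists2 t, 0 <= t < sl & hausdorff_measure t X = 0%E.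
  by apply: hausdorff_dim_lt; rewrite dim0 lte_fin.
have sct : 2^-1 <= sc `^ t.
  rewrite /powR gt_eqF// lnV ?posrE ?exprn_gt0// lnXn//.
  rewrite -[leLHS]lnK ?posrE ?invr_gt0// ler_expR lnV ?posrE// mulrN lerN2.
  by move: tsl; rewrite ltr_pdivlMr ?mulr_gt0 ?ltr0n// mulr_natl => /ltW.
have W_inj := wblocks_nu_inj.
pose dec (x : R) : nat -> bool := xget (fun=> false) [set b | x = a + c * W b].
have decK b : dec (a + c * W b) = b.
  rewrite /dec; case: xgetP => [b' _ /addrI/(mulfI (lt0r_neq0 c0))/W_inj -> //|].
  by move=> /(_ b) /=.
apply: (@hausdorff_measure_holder R X [set a + c * W b | b in setT]
  (fun x => nu R (bits (dec x))) t (2 / c `^ t)) Ht => //.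
- by rewrite divr_ge0// powR_ge0.
- by move=> _ [b _ <-].
- move=> _ _ [b _ <-] [b' _ <-]; rewrite !decK.
  have [->|ne] := EM (b = b').
    by rewrite subrr normr0 mulr_ge0 ?powR_ge0// divr_ge0// powR_ge0.
  have [n [h1 h2]] := first_difference ne.
  apply: le_trans (bits_nu_close R h1) _.
  have sepb := wblocks_separated h1 h2.
  have -> : a + c * W b - (a + c * W b') = c * (W b - W b') by ring.
  rewrite normrM (gtr0_norm c0) powRM ?(ltW c0)//.
  rewrite mulrA mulfVK; last by rewrite gt_eqF// powR_gt0.
  apply: (@le_trans _ _ (2 * (sc ^+ n.+1) `^ t)).
    rewrite powR_exprn ?(ltW s0)//; apply: (@le_trans _ _ (2 * 2^-1 ^+ n.+1)).
      by rewrite exprS mulrA mulfV// mul1r exprVn.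
    apply: ler_wpM2l => //; apply: lerXn2r; rewrite ?nnegrE ?powR_ge0 ?invr_ge0//.
  by apply: ler_wpM2l => //; apply: ge0_ler_powR => //; rewrite nnegrE.
- move=> y /bits_nu_surj[b hb]; exists (a + c * W b); first by exists b.
  by rewrite decK.
Qed.

End Separated.

(** * Cantor sets of values of words *)

Section Gaps.
Variable R : realType.
Implicit Types (K : set R) (e x y delta : R).

(** No point of [K] is required on the left: the least point of [K] ends a gap of every size. *)
Definition gap K e delta : Prop := forall y, K y -> y < e -> y + delta <= e.

Definition last_gap K e x delta : Prop :=
  [/\ K e, e <= x, gap K e delta &
      forall e', K e' -> e < e' -> e' <= x -> ~ gap K e' delta].

Lemma last_gap_unique K e e' x delta : last_gap K e x delta -> last_gap K e' x delta -> e = e'.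
Proof.
move=> [Ke ex ge me] [Ke' ex' ge' me']; case: (ltgtP e e') => // h.
  by have := me _ Ke' h ex' ge'.
by have := me' _ Ke h ex ge.
Qed.

Lemma closed_min K (b : R) : closed K -> (exists2 x, K x & b <= x) ->
  exists2 m, K m /\ b <= m & forall x, K x -> b <= x -> m <= x.
Proof.
move=> clK [x0 Kx0 bx0]; pose T := [set x | K x /\ b <= x].
have T0 : T !=set0 by exists x0.
have lb : lbound T b by move=> x [].
have hT : has_inf T by split=> //; exists b.
exists (inf T); last by move=> x Kx bx; apply: ge_inf => //; exists b.
split; last exact: lb_le_inf.
apply: clK => V /nbhs_ballP[eps /= eps0 epsV].
have [x [Kx bx] xlt] := inf_adherent eps0 hT.
exists x; split=> //; apply: epsV; rewrite /ball /=.
have : inf T <= x by apply: ge_inf => //; exists b.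
by move=> h; rewrite ler0_norm; lra.
Qed.

(** Right ends of gaps of size [g] are at least [g] apart, so one within [g] of the supremum is the
    largest. *)
Lemma last_gap_exists K (y0 e0 g : R) : 0 < g -> K e0 -> e0 <= y0 -> gap K e0 g ->
  exists2 e, e0 <= e & last_gap K e y0 g.
Proof.
move=> g0 Ke0 e0y ge0; pose G := [set e | [/\ K e, e <= y0 & gap K e g]].
have hG : has_sup G by split; [exists e0|exists y0 => e []].
have [e [Ke ey ge] es] := sup_adherent g0 hG.
have emax e' : G e' -> e' <= e.
  move=> Ge'; rewrite leNgt; apply/negP => ee'.
  have [Ke' ey' ge'] := Ge'.
  have : e' <= sup G by apply: ub_le_sup => //; case: hG.
  by have := ge' _ Ke ee'; lra.
exists e; first exact: emax.
split=> // e' Ke' ee' ey' ge'.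
by have := emax e' (And3 Ke' ey' ge'); rewrite leNgt ee'.
Qed.

End Gaps.

Section CantorSet.
Variables (R : realType) (r : nat) (D : finType) (delta : D -> 'I_r -> D) (live : pred D).
Hypothesis live_prefix : forall q a, live (delta q a) -> live q.
Hypothesis live_next : forall q, live q -> exists a, live (delta q a).
Hypothesis r_gt1 : (1 < r)%N.
Variables (q0 q : D) (p u v : seq 'I_r).
Hypotheses (pq : after delta q0 p = q) (uq : after delta q u = q) (vq : after delta q v = q).
Hypothesis live_q : live q.
Hypotheses (suv : size u = size v) (u_gt0 : (0 < size u)%N).

Local Notation rr := (r%:R : R).
Local Notation after := (after delta).
Local Notation K := (live_values delta live (R := R) q0).
Local Notation Kq := (live_values delta live (R := R) q).

Let rr_gt0 : 0 < rr. Proof. by rewrite ltr0n; apply: ltn_trans r_gt1. Qed.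

Lemma live_wblocks x0 b : live_words delta live q (wblocks x0 u v b).
Proof.
move=> n; have le : (n <= n * size u)%N by rewrite leq_pmulr.
rewrite -(wtake_wtake _ le) wtake_wblocks//.
apply: (live_after live_prefix (u := drop n (blocks u v (mkseq b n)))).
by rewrite -after_cat cat_take_drop after_blocks.
Qed.

Lemma K_wblocks x0 b : K (wval R p + rr ^- size p * nu R (wblocks x0 u v b)).
Proof.
apply: (live_values_cat live_prefix) => //; rewrite pq.
by exists (wblocks x0 u v b) => //; exact: live_wblocks.
Qed.

Hypothesis sep : wval R u + 2 * rr ^- size u <= wval R v.
Hypothesis thin : forall a b : R, a < b -> exists2 x, a < x < b & ~ K x.

(** A missing point of [K] inside the cylinder of [p] is rescaled, and closedness widens it to an
    interval. It is sought to the left of the cylinder of [v], so that words starting with [v] lie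
    beyond it. *)
Lemma Kq_gap : exists a b : R, [/\ 0 < a, a < b, b < wval R v & forall y, a < y < b -> ~ Kq y].
Proof.
have s0 := scale_gt0 R r_gt1 (size p).
have v0 : 0 < wval R v.
  by have := sep; have := wval_ge0 R u; have := scale_gt0 R r_gt1 (size u); lra.
have [|x /andP[x1 x2] nKx] := thin (a := wval R p) (b := wval R p + rr ^- size p * wval R v).
  by rewrite ltrDl mulr_gt0.
pose y := (x - wval R p) / rr ^- size p.
have yE : x = wval R p + rr ^- size p * y.
  by rewrite /y mulrC divfK ?gt_eqF// addrC subrK.
have y0 : 0 < y by rewrite divr_gt0// subr_gt0.
have yv : y < wval R v.
  by rewrite -(ltr_pM2l s0) -(ltrD2l (wval R p)) -yE.
have nKqy : ~ Kq y.
  by move=> Ky; apply: nKx; rewrite yE; apply: (live_values_cat live_prefix) => //; rewrite pq.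
have := live_values_closed r_gt1 (q := q) (R := R) (delta := delta) (live := live).
rewrite -openC => /(_ y nKqy) /nbhs_ballP[eps /= eps0 epsV].
pose eta := Num.min (eps / 2) (Num.min (y / 2) ((wval R v - y) / 2)).
have eta0 : 0 < eta by rewrite !lt_min !divr_gt0// subr_gt0.
have e1 : eta <= eps / 2 by rewrite ge_min lexx.
have e2 : eta <= y / 2 by rewrite !ge_min lexx orbT.
have e3 : eta <= (wval R v - y) / 2 by rewrite !ge_min lexx !orbT.
exists (y - eta), (y + eta); split; [lra|lra|lra|].
move=> t /andP[t1 t2]; apply: epsV; rewrite /ball /= ltr_norml; apply/andP; split; lra.
Qed.

(* The cylinder of [z] is smaller than a gap [g] to its left, so that the last gap of
   size [g] is the same for all points of the cylinder. *)
Lemma Kq_last_gap : exists z (g e1 : R), [/\ after q z = q, 0 < g <= e1 &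
  forall w, live_words delta live q (wcat z w) -> last_gap Kq e1 (nu R (wcat z w)) g].
Proof.
have [a [b [a0 ab bv noK]]] := Kq_gap.
pose g := b - a; have g0 : 0 < g by rewrite subr_gt0.
have [n hn] := scale_small r_gt1 g0.
(* Starting with [v] puts the cylinder of [z] to the right of the gap; the length makes it shorter
   than [g]. *)
pose z := upow v n.+1.
have zq : after q z = q by exact: after_upow.
have nz : (n <= size z)%N.
  by rewrite size_upow -suv; apply: leq_trans (leqnSn n) _; rewrite leq_pmulr.
have sz : rr ^- size z < g.
  apply: le_lt_trans hn.
  by rewrite lef_pV2 ?posrE ?exprn_gt0// ler_eXn2l// ltr1n.
have zv : wval R v <= wval R z.
  by rewrite /z upowS wval_cat// lerDl mulr_ge0 ?wval_ge0// ltW// scale_gt0.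
have nuz w : b < nu R (wcat z w).
  rewrite nu_cat//; apply: lt_le_trans bv _; apply: le_trans zv _.
  by rewrite lerDl mulr_ge0 ?nu_ge0// ltW// scale_gt0.
have close w w' : `|nu R (wcat z w) - nu R (wcat z w')| < g.
  apply: le_lt_trans sz; apply: nu_wtake => //.
  by rewrite !wtake_cat_size.
have [w0 lw0] := live_words_exists live_next live_q.
have lz : live_words delta live q (wcat z w0).
  by apply/(live_words_cat live_prefix); rewrite zq.
have Kz : Kq (nu R (wcat z w0)) by exists (wcat z w0).
(* The first point of [Kq] beyond [b] ends a gap of size [g], so a last such gap before the sample
   point exists. *)
have [|e0 [Ke0 be0] e0min] := closed_min (b := b)
    (live_values_closed r_gt1 (q := q) (R := R) (delta := delta) (live := live)).
  by exists (nu R (wcat z w0)) => //; exact: ltW.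
have ge0 : gap Kq e0 g.
  move=> y Ky ye0; have yb : y < b.
    by rewrite ltNge; apply/negP => /(e0min _ Ky); rewrite leNgt ye0.
  have ya : y <= a by rewrite leNgt; apply/negP => ay; apply: (noK y) => //; rewrite ay.
  by rewrite /g; lra.
have e0z : e0 <= nu R (wcat z w0) by apply: e0min => //; exact: ltW.
have [e1 e01 [Ke1 e1z ge1 me1]] := last_gap_exists g0 Ke0 e0z ge0.
exists z, g, e1; split=> //; first by apply/andP; split=> //; rewrite /g; lra.
move=> w lw; have Kw : Kq (nu R (wcat z w)) by exists (wcat z w).
have c1 := close w w0; rewrite ltr_norml in c1; case/andP: c1 => c1 c2.
have e1w : e1 <= nu R (wcat z w).
  rewrite leNgt; apply/negP => we1; have := ge1 _ Kw we1; lra.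
split=> // e' Ke' ee' ew' ge'.
have [le|lt] := leP e' (nu R (wcat z w0)); first by exact: (me1 e').
by have := ge' _ Kz lt; lra.
Qed.

(** Inside the cylinder of [w], [K] is a scaled copy of [Kq]. The condition [g <= e1] keeps the
    whole gap inside this cylinder, out of reach of the points of [K] to its left. *)
Lemma last_gap_scale w (e1 g y : R) : after q0 w = q -> 0 < g <= e1 -> Kq y -> y <= 1 ->
  last_gap Kq e1 y g ->
  last_gap K (wval R w + rr ^- size w * e1) (wval R w + rr ^- size w * y) (rr ^- size w * g).
Proof.
move=> wq /andP[g0 ge1] Ky y1 [Ke1 e1y gape1 me1].
set sc := rr ^- size w; set a := wval R w.
have sc0 : 0 < sc := scale_gt0 R r_gt1 _.
have cat x : Kq x -> K (a + sc * x).
  by move=> Kx; apply: (live_values_cat live_prefix r_gt1 (p := w)); rewrite wq.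
have cyl x : 0 < x < 1 -> K (a + sc * x) -> Kq x.
  by move=> x01 /(live_values_cylinder live_prefix r_gt1 x01); rewrite wq.
have unscale x : x = a + sc * ((x - a) / sc) by rewrite [sc * _]mulrC divfK ?gt_eqF// addrC subrK.
have lesc x x' : (a + sc * x <= a + sc * x') = (x <= x') by rewrite lerD2l ler_pM2l.
have ltsc x x' : (a + sc * x < a + sc * x') = (x < x') by rewrite ltrD2l ltr_pM2l.
split.
- exact: cat.
- by rewrite lesc.
- move=> x Kx; rewrite (unscale x) in Kx *; move: ((x - a) / sc) Kx => x' Kx.
  rewrite ltsc -addrA -mulrDr lesc => x'e1.
  rewrite leNgt; apply/negP => h.
  have Kx' : Kq x' by apply: cyl Kx; apply/andP; split; lra.
  by have := gape1 _ Kx' x'e1; lra.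
- move=> e' Ke'; rewrite (unscale e') in Ke' *; move: ((e' - a) / sc) Ke' => x Kx.
  rewrite ltsc lesc => e1x xy ge'.
  (* At the right end of the cylinder [live_values_cylinder] fails, but there [x] can only be
     [y]. *)
  have Kx' : Kq x.
    have [x1|x1] := ltP x 1; first by apply: cyl Kx; apply/andP; split; lra.
    by have -> : x = y by lra.
  apply: (me1 x) => // x' Kx'' x'x.
  have := ge' _ (cat _ Kx''); rewrite ltsc => /(_ x'x).
  by rewrite -addrA -mulrDr lesc.
Qed.

(* The points [x] are the values of [p t_(f 0) t_(f 1) ...]; the words [t_j] start with
   [z], so that the last gap before [x] at the scale of the [i]-th block only depends
   on the blocks before it, and [c i j] is the effect of inserting [t_j]. *)
Lemma K_array N : exists (del : nat -> R) (c : nat -> nat -> R),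
  (forall i j k, (j < N)%N -> (k < N)%N -> j <> k -> c i j <> c i k) /\
  forall f : nat -> nat, exists x, forall i, (i < N)%N ->
    exists e, last_gap K e x (del i) /\ last_gap K (e + c i (f i)) x (del i.+1).
Proof.
have [z [g [e1 [zq ge1 hz]]]] := Kq_last_gap.
have uv : u != v.
  apply/eqP => uv; have := sep; have := scale_gt0 R r_gt1 (size u).
  by rewrite uv; lra.
(* The single block [u] in place [j] makes these words distinct; they have equal length, so the
   scale of block [i] is the same for all [f]. *)
pose t j := z ++ blocks u v (mkseq (fun i => i == j) N).
pose l := (size z + N * size u)%N.
have st j : size (t j) = l by rewrite size_cat size_blocks// size_mkseq.
have tq j : after q (t j) = q by rewrite after_cat zq after_blocks.
pose n i := (size p + i * l)%N.
(* The last gap at scale [i] ends at the value of the first [i] blocks after [p] plus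
   [r ^- n i * e1]; [c i j] is the difference of two consecutive such ends. *)
exists (fun i => rr ^- n i * g),
  (fun i j => rr ^- n i * (wval R (t j) + (rr ^- l - 1) * e1)); split.
  move=> i j k jN kN jk /(mulfI (lt0r_neq0 (scale_gt0 R r_gt1 _))) /addIr e.
  have := wval_inj r_gt1 (etrans (st j) (esym (st k))) e.
  move=> /eqP; rewrite eqseq_cat// eqxx => /eqP /(blocks_inj suv uv).
  rewrite !size_mkseq => /(_ erefl) /(congr1 (fun s => nth false s j)).
  by rewrite !nth_mkseq// eqxx => /esym/eqP.
move=> f; have [w0 lw0] := live_words_exists live_next live_q.
pose fl (s : seq nat) := flatten [seq t j | j <- s].
have flq s : after q (fl s) = q by elim: s => //= j s IH; rewrite after_cat tq.
have sfl s : size (fl s) = (size s * l)%N.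
  by elim: s => //= j s IH; rewrite size_cat st IH mulSn.
(* The final [z] provides the last gap at the scale following the last block. *)
pose Y s := wcat (fl s) (wcat z w0).
have lY s : live_words delta live q (Y s).
  by apply/(live_words_cat live_prefix); rewrite flq; apply/(live_words_cat live_prefix); rewrite zq.
have Yz s : exists w, Y s = wcat z w.
  case: s => [|j s]; first by exists w0.
  by eexists; rewrite /Y /fl /= /t -catA wcat_cat; reflexivity.
pose s := mkseq f N.
exists (nu R (wcat p (Y s))).
have lg i : (i <= N)%N -> last_gap K (wval R (p ++ fl (take i s)) + rr ^- n i * e1)
    (nu R (wcat p (Y s))) (rr ^- n i * g).
  move=> iN.
  have sw : size (p ++ fl (take i s)) = n i.
    by rewrite size_cat sfl size_takel// size_mkseq.
  have -> : wcat p (Y s) = wcat (p ++ fl (take i s)) (Y (drop i s)).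
    have -> : Y s = wcat (fl (take i s)) (Y (drop i s)).
      by rewrite /Y -(wcat_cat (fl (take i s))) /fl -flatten_cat -map_cat cat_take_drop.
    by rewrite wcat_cat.
  rewrite nu_cat// -sw; apply: last_gap_scale => //.
  - by rewrite after_cat pq flq.
  - by exists (Y (drop i s)).
  - exact: nu_le1.
  - by have := lY (drop i s); have [w ->] := Yz (drop i s); exact: hz.
move=> i iN; exists (wval R (p ++ fl (take i s)) + rr ^- n i * e1); split; first by apply: lg; exact: ltnW.
have -> : wval R (p ++ fl (take i s)) + rr ^- n i * e1 +
    rr ^- n i * (wval R (t (f i)) + (rr ^- l - 1) * e1) =
    wval R (p ++ fl (take i.+1 s)) + rr ^- n i.+1 * e1; last exact: lg.
have isz : (i < size s)%N by rewrite size_mkseq.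
rewrite (take_nth 0%N isz) nth_mkseq// /fl map_rcons flatten_rcons catA (wval_cat R r_gt1 (p ++ flatten _)).
have -> : size (p ++ flatten [seq t j | j <- take i s]) = n i.
  by rewrite size_cat sfl size_takel// size_mkseq ltnW.
have -> : rr ^- n i.+1 = rr ^- n i * rr ^- l.
  by rewrite /n mulSn addnCA exprD invfM mulrC.
ring.
Qed.

End CantorSet.

(** Doubling both loops puts the cylinder of [u ++ v] between those of [u ++ u] and [v ++ v]. *)
Lemma separated_loops (R : realType) (r : nat) (D : finType) (delta : D -> 'I_r -> D)
    (q : D) (u v : seq 'I_r) : (1 < r)%N ->
  after delta q u = q -> after delta q v = q -> size u = size v -> u <> v ->
  exists u' v', [/\ after delta q u' = q, after delta q v' = q, size u' = size v',
    (0 < size u')%N & wval R u' + 2 * r%:R ^- size u' <= wval R v'].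
Proof.
move=> r1.
wlog uv : u v / wval R u < wval R v.
  move=> h uq vq suv ne; case: (ltgtP (wval R u) (wval R v)) => c.
  - exact: (h u v).
  - by apply: (h v u) => // e; apply: ne.
  - by exfalso; apply: ne; exact: wval_inj c.
move=> uq vq suv ne; exists (u ++ u), (v ++ v).
have s0 := scale_gt0 R r1 (size v).
split; rewrite ?size_cat ?suv//.
- by rewrite after_cat !uq.
- by rewrite after_cat !vq.
- case: (v) suv ne => [|//] /size0nil ->.
  by [].
have h1 : wval R (u ++ u) + r%:R ^- size (u ++ u) <= wval R (u ++ v).
  apply: wval_lt_separated => //; first by rewrite !size_cat suv.
  by rewrite !wval_cat// ltrD2l suv ltr_pM2l.
have h2 : wval R (u ++ v) + r%:R ^- size (u ++ v) <= wval R (v ++ v).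
  apply: wval_lt_separated => //; first by rewrite !size_cat suv.
  by rewrite !wval_cat// suv ltrD2r.
by move: h1 h2; rewrite !size_cat suv; lra.
Qed.

(** * The structure defined by a set which is not sparse *)

Section FormulaDefinable.
Variables (R : realType) (d : nat) (A : set 'rV[R]_d).
Local Notation L := (lang_A d).
Local Notation S := (structure_A A).

(** No parameters are allowed, since the formula with TP2 has to be one of the language itself. *)
Definition fdef (n : nat) (B : (nat -> R) -> Prop) : Prop :=
  exists phi : formula L n, forall e : nat -> R, sat S phi (fun i : 'I_n => e i) <-> B e.

Lemma fdef_ext n B B' : (forall e, B e <-> B' e) -> fdef n B -> fdef n B'.
Proof. by move=> h [phi hphi]; exists phi => e; rewrite -h. Qed.

Lemma fdef_not n B : fdef n B -> fdef n (fun e => ~ B e).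
Proof. by move=> [phi h]; exists (Not phi) => e; rewrite sat_Not h. Qed.

Lemma fdef_imp n B B' : fdef n B -> fdef n B' -> fdef n (fun e => B e -> B' e).
Proof. by move=> [phi h] [psi h']; exists (Imp phi psi) => e /=; rewrite h h'. Qed.

Lemma fdef_and n B B' : fdef n B -> fdef n B' -> fdef n (fun e => B e /\ B' e).
Proof. by move=> [phi h] [psi h']; exists (And phi psi) => e; rewrite sat_And h h'. Qed.

Lemma fdef_ren n k B (g : nat -> nat) : (forall i, (i < n)%N -> (g i < k)%N) ->
  fdef n B -> fdef k (fun e => B (fun i => e (g i))).
Proof.
move=> gk [phi h]; exists (ren phi (fun i : 'I_n => Ordinal (gk i (ltn_ord i)))) => e.
by rewrite sat_ren -h.
Qed.

Lemma fdef_all n B : fdef n.+1 B -> fdef n (fun e => forall x, B (upd e n x)).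
Proof.
move=> [phi h]; exists (Forall (ren phi (cast_ord (esym (addn1 n))))) => e /=.
split=> s x; have := s x; rewrite sat_ren fcat_upd /= -h; exact.
Qed.

Lemma fdef_ex n B : fdef n.+1 B -> fdef n (fun e => exists x, B (upd e n x)).
Proof.
move=> /fdef_not/fdef_all/fdef_not; apply: fdef_ext => e; split=> [h|[x Bx] h].
  by apply: contrapT => no; apply: h => x Bx; apply: no; exists x.
exact: h Bx.
Qed.

Lemma fdef_ex_block n k B : fdef (n + k) B -> fdef n (fun e => exists w : 'I_k -> R,
  B (env 0 (fcat (fun i : 'I_n => e i) w))).
Proof.
move=> [phi h]; exists (Not (All (Not phi))) => e; rewrite sat_Not sat_All.
split=> [no|[w Bw] al].
  apply: contrapT => nw; apply: no => w; apply/sat_Not => s; apply: nw; exists w.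
  by apply/h; rewrite envK.
by apply: (al w); move/h: Bw; rewrite envK.
Qed.

Definition is_term (n : nat) (f : (nat -> R) -> R) : Prop :=
  exists t : term L n, forall e : nat -> R, Defs.eval S (fun i : 'I_n => e i) t = f e.

Lemma term_var n i : (i < n)%N -> is_term n (fun e => e i).
Proof. by move=> ilt; exists (@Var L n (Ordinal ilt)). Qed.

Lemma term_zero n : is_term n (fun=> 0).
Proof. have z : 'I_0 -> term L n by case. by exists (@App L n Zero z). Qed.

Lemma term_add n f g : is_term n f -> is_term n g -> is_term n (fun e => f e + g e).
Proof.
move=> [t ht] [u hu].
by exists (@App L n Add (fun i : 'I_2 => if val i is 0 then t else u)) => e /=; rewrite ht hu.
Qed.

Lemma fdef_lt n f g : is_term n f -> is_term n g -> fdef n (fun e => f e < g e).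
Proof.
move=> [t ht] [u hu].
by exists (@Rel L n Lt (fun i : 'I_2 => if val i is 0 then t else u)) => e /=; rewrite ht hu.
Qed.

Lemma fdef_le n f g : is_term n f -> is_term n g -> fdef n (fun e => f e <= g e).
Proof.
move=> tf tg; apply: fdef_ext (fdef_not (fdef_lt tg tf)) => e.
by rewrite leNgt; split=> /negP.
Qed.

Lemma fdef_eq n f g : is_term n f -> is_term n g -> fdef n (fun e => f e = g e).
Proof.
move=> tf tg; apply: fdef_ext (fdef_and (fdef_le tf tg) (fdef_le tg tf)) => e.
by split=> [[h1 h2]|->//]; apply/eqP; rewrite eq_le h1.
Qed.

Lemma fdef_A n (f : 'I_d -> (nat -> R) -> R) : (forall j, is_term n (f j)) ->
  fdef n (fun e => A (\row_(j < d) f j e)).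
Proof.
move=> tf; have [t ht] := choice tf.
exists (@Rel L n Pred t) => e /=.
rewrite (_ : \row_i Defs.eval _ _ _ = \row_(j < d) f j e)//.
by apply/rowP => j; rewrite !mxE ht.
Qed.

(** Variable 0 is the point, variable 1 the radius, and the rest a point of [A]. The distance
    condition is written with sums, as the language has no subtraction. *)
Lemma fdef_closure (i : 'I_d) : fdef 1 (fun e => closure (coord_proj i A) (e 0%N)).
Proof.
have h : fdef (2 + d) (fun e => [/\ A (\row_(j < d) e (2 + j)%N),
    e 0%N < e (2 + i)%N + e 1%N & e (2 + i)%N < e 0%N + e 1%N]).
  apply: (@fdef_ext _ (fun e => A (\row_(j < d) e (2 + j)%N) /\
    (e 0%N < e (2 + i)%N + e 1%N /\ e (2 + i)%N < e 0%N + e 1%N))).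
    by move=> e; split=> [[? []]|[]].
  have tv k : (k < 2 + d)%N -> is_term (2 + d) (fun e => e k) by exact: term_var.
  apply: fdef_and; first by apply: fdef_A => j; apply: tv; rewrite ltn_add2l.
  by apply: fdef_and; apply: fdef_lt; rewrite //; try apply: term_add; apply: tv;
    rewrite // ltn_add2l.
have pos : fdef 2 (fun e => 0 < e 1%N).
  by apply: fdef_lt; [exact: term_zero|exact: term_var].
apply: fdef_ext (fdef_all (fdef_imp pos (fdef_ex_block h))) => e.
have env_row (eps : R) (w : 'I_d -> R) (j : 'I_d) :
    env 0 (fcat (fun k : 'I_2 => upd e 1 eps k) w) (2 + j)%N = w j.
  by rewrite -[(2 + j)%N]/(val (rshift 2 j)) /env valK fcat_rshift.
have env2 (eps : R) (w : 'I_d -> R) k (k2 : (k < 2)%N) :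
    env 0 (fcat (fun k : 'I_2 => upd e 1 eps k) w) k = upd e 1 eps k.
  by rewrite -[k]/(val (lshift d (Ordinal k2))) /env valK fcat_lshift.
split=> [cl V /nbhs_ballP[eps /= eps0 epsV]|cl eps].
  have [w] := cl eps eps0.
  rewrite env_row !env2//= /upd /= => -[Aw h1 h2].
  exists (w i); split.
    exists (\row_j w j); last by rewrite mxE.
    by move: Aw; congr A; apply/rowP => j; rewrite !mxE env_row.
  by apply: epsV; rewrite /ball /= ltr_norml; apply/andP; split; lra.
rewrite /upd /= => eps0.
have [_ [[y Ay <-] hy]] := cl _ (nbhsx_ballx (e 0%N) eps eps0).
exists (fun j => y ord0 j); rewrite env_row !env2//= /upd /=.
move: hy; rewrite /ball /= ltr_norml => /andP[h1 h2]; split; [|lra|lra].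
by move: Ay; congr A; apply/rowP => j; rewrite !mxE env_row.
Qed.

Lemma fdef_gap (K : set R) : fdef 1 (fun e => K (e 0%N)) ->
  fdef 2 (fun e => gap K (e 0%N) (e 1%N)).
Proof.
move=> dK; have tv k : (k < 3)%N -> is_term 3 (fun e => e k) by exact: term_var.
have K2 : fdef 3 (fun e => K (e 2%N)) by apply: (fdef_ren (g := fun=> 2%N)) dK.
exact: (fdef_all (fdef_imp K2 (fdef_imp (fdef_lt (tv 2%N isT) (tv 0%N isT))
  (fdef_le (term_add (tv 2%N isT) (tv 1%N isT)) (tv 0%N isT))))).
Qed.

Lemma fdef_last_gap (K : set R) : fdef 1 (fun e => K (e 0%N)) ->
  fdef 3 (fun e => last_gap K (e 0%N) (e 1%N) (e 2%N)).
Proof.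
move=> dK; have tv n k : (k < n)%N -> is_term n (fun e => e k) by exact: term_var.
have dg := fdef_gap dK.
have K0 : fdef 3 (fun e => K (e 0%N)) by apply: (fdef_ren (g := fun=> 0%N)) dK.
have K3 : fdef 4 (fun e => K (e 3%N)) by apply: (fdef_ren (g := fun=> 3%N)) dK.
have g02 : fdef 3 (fun e => gap K (e 0%N) (e 2%N)).
  by apply: (fdef_ren (g := fun k => if k is 0 then 0 else 2)%N) dg => -[|[|]].
have g32 : fdef 4 (fun e => gap K (e 3%N) (e 2%N)).
  by apply: (fdef_ren (g := fun k => if k is 0 then 3 else 2)%N) dg => -[|[|]].
have := fdef_and K0 (fdef_and (fdef_le (tv 3 0%N isT) (tv 3 1%N isT)) (fdef_and g02
  (fdef_all (fdef_imp K3 (fdef_imp (fdef_lt (tv 4 0%N isT) (tv 4 3%N isT))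
    (fdef_imp (fdef_le (tv 4 3%N isT) (tv 4 1%N isT)) (fdef_not g32)))))))%N.
by apply: fdef_ext => e; split=> [[? [? []]]|[]].
Qed.

Lemma fdef_gap_step (K : set R) : fdef 1 (fun e => K (e 0%N)) ->
  fdef 4 (fun e => exists x, last_gap K x (e 0%N) (e 1%N) /\
    last_gap K (x + e 3%N) (e 0%N) (e 2%N)).
Proof.
move=> dK; have dl := fdef_last_gap dK.
have tv n k : (k < n)%N -> is_term n (fun e => e k) by exact: term_var.
have l1 : fdef 5 (fun e => last_gap K (e 4%N) (e 0%N) (e 1%N)).
  by apply: (fdef_ren (g := fun k => match k with 0 => 4 | 1 => 0 | _ => 1 end)%N) dl => -[|[|[|]]].
have l2 : fdef 6 (fun e => last_gap K (e 5%N) (e 0%N) (e 2%N)).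
  by apply: (fdef_ren (g := fun k => match k with 0 => 5 | 1 => 0 | _ => 2 end)%N) dl => -[|[|[|]]].
have eq5 := fdef_eq (tv 6 5%N isT) (term_add (tv 6 4%N isT) (tv 6 3%N isT)).
have := fdef_ex (fdef_and l1 (fdef_ex (fdef_and eq5 l2))).
apply: fdef_ext => e; split=> [[x [h1 [y [/= -> h2]]]]|[x [h1 h2]]].
  by exists x.
by exists x; split=> //; exists (x + e 3%N).
Qed.

(** Within a row both scales are fixed, so by [last_gap_unique] a point admits only one difference
    [c]. *)
Lemma fdef_array_TP2 (K : set R) : fdef 1 (fun e => K (e 0%N)) ->
  (forall N, exists (del : nat -> R) (c : nat -> nat -> R),
    (forall i j k, (j < N)%N -> (k < N)%N -> j <> k -> c i j <> c i k) /\
    forall f : nat -> nat, exists x, forall i, (i < N)%N ->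
      exists e, last_gap K e x (del i) /\ last_gap K (e + c i (f i)) x (del i.+1)) ->
  exists m n (phi : formula L (m + n)), has_TP2 (theory_of S) phi.
Proof.
move=> dK arr; have [phi hphi] := fdef_gap_step dK.
exists 1%N, 3%N, phi; apply: (@has_TP2_compact _ _ S) => // N.
have [del [c [cne hc]]] := arr N.
exists (fun i j (k : 'I_3) => nth 0 [:: del i; del i.+1; c i j] k).
have satE (a : 'I_1 -> R) i j :
    sat S phi (fcat a (fun k : 'I_3 => nth 0 [:: del i; del i.+1; c i j] k)) <->
    exists x, last_gap K x (a ord0) (del i) /\ last_gap K (x + c i j) (a ord0) (del i.+1).
  pose e k := nth 0 [:: a ord0; del i; del i.+1; c i j] k.
  rewrite -(hphi e) (_ : fcat _ _ = (fun i : 'I_(1 + 3) => e i))//.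
  apply: funext => k; rewrite -(splitK (k : 'I_(1 + 3))).
  by case: fintype.split => k'; rewrite ?fcat_lshift ?fcat_rshift//= (ord1 k').
split=> [i j k _ jN kN jk [a [/satE[x [h1 h2]] /satE[y [h3 h4]]]]|f fN].
  apply: (cne i j k jN kN jk).
  have xy := last_gap_unique h1 h3; subst y.
  exact: addrI (last_gap_unique h2 h4).
have [x hx] := hc f; exists (fun=> x) => i iN; apply/satE; exact: hx.
Qed.

(** A finite union of discrete sets is countable, since each point is isolated in its set by an
    interval with rational ends; [g] embeds the uncountable space of binary sequences. *)
Lemma fdef_not_d_minimal (K : set R) : fdef 1 (fun e => K (e 0%N)) ->
  (forall a b : R, a < b -> exists2 x, a < x < b & ~ K x) ->
  (exists g : (nat -> bool) -> R, injective g /\ forall b, K (g b)) ->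
  ~ d_minimal S.
Proof.
move=> [phi hphi] thin [g [ginj gK]] dm.
have [N hN] : exists N : nat, forall x : 'I_0 -> R,
    let fiber := [set t : R | K t] in interior fiber !=set0 \/
    exists D : 'I_N -> set R, (forall k, discrete_set (D k)) /\ fiber = \bigcup_k D k.
  have [|N hN] := dm 0%N [set x : 'I_(0 + 1) -> R | K (x ord0)].
    exists 0%N, (ren phi (lshift 0)), (fun _ : 'I_0 => 0).
    apply/seteqP; suff e (x : 'I_1 -> R) :
        sat S (ren phi (lshift 0)) (fcat x (fun _ : 'I_0 => 0)) <-> K (x ord0).
      by split=> x /=; rewrite e.
    rewrite sat_ren -(hphi (fun=> x ord0)).
    rewrite (_ : (fun _ => fcat _ _ _) = (fun=> x ord0))//.
    by apply: funext => k; rewrite fcat_lshift (ord1 k).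
  exists N => x; have := hN x; rewrite /=.
  have e (t : R) : fcat x (fun _ : 'I_1 => t) (ord0 : 'I_(0 + 1)) = t.
    by rewrite (_ : ord0 = rshift 0 ord0) ?fcat_rshift//; exact: val_inj.
  have -> : [set t : R | K (fcat x (fun _ : 'I_1 => t) (ord0 : 'I_(0 + 1)))] = [set t | K t].
    by apply: funext => t /=; rewrite e.
  exact.
have {hN} := hN (fun=> 0) => /= -[[x]|[D [dD KD]]].
  rewrite /interior /= => /nbhs_ballP[eps /= eps0 epsK].
  have [|y /andP[y1 y2]] := thin (x - eps) (x + eps); first by lra.
  by apply; apply: epsK; rewrite /ball /= ltr_norml; apply/andP; split; lra.
have code b : exists kst : 'I_N * rat * rat, D kst.1.1 `&`
    [set t | ratr kst.1.2 < t < ratr kst.2] = [set g b].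
  have : [set t | K t] (g b) by exact: gK.
  rewrite KD => -[k _ Dk]; have [a [c ac]] := dD k _ Dk.
  have : (D k `&` [set` `]a, c[]) (g b) by rewrite ac.
  move=> [_]; rewrite /= in_itv /= => /andP[ag gc].
  have [s] := rat_in_itvoo ag; rewrite in_itv /= => /andP[s1 s2].
  have [t] := rat_in_itvoo gc; rewrite in_itv /= => /andP[t1 t2].
  exists (k, s, t); apply/seteqP; split=> [x /= [Dx /andP[x1 x2]]|x ->].
    have : (D k `&` [set` `]a, c[]) x.
      by split=> //=; rewrite in_itv /= (lt_trans s1)//= (lt_trans x2).
    by rewrite ac.
  by split=> //=; rewrite s2 t1.
have [f hf] := choice code.
have finj : injective (fun b => pickle (f b)).
  move=> b b' /(pcan_inj pickleK) e; apply: ginj.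
  have : [set g b] (g b) by [].
  by rewrite -hf e hf.
(* Cantor's diagonal sequence for the injective coding [pickle (f b)]; it contradicts itself at its
   own code. *)
pose diag n := `[< forall b, pickle (f b) = n -> ~~ b n >].
case dn : (diag (pickle (f diag))).
  by have /asboolP/(_ diag erefl) := dn; rewrite dn.
have /asboolP := negbT dn; apply=> b /finj ->.
by rewrite dn.
Qed.

End FormulaDefinable.

Lemma not_sparse_cantor (R : realType) (r d : nat) (A : set 'rV[R]_d) :
  (1 < r)%N -> regular_set r A ->
  (forall i : 'I_d, (hausdorff_dim (closure (coord_proj i A)) < 1)%E) ->
  ~ sparse_set r A ->
  [/\ exists i : 'I_d, hausdorff_dim (closure (coord_proj i A)) <> 0%E,
      ~ d_minimal (structure_A A) &
      ~ NTP2 (theory_of (structure_A A))].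
Proof.
move=> r1 [L [B LB] AE] dim1 nsp.
have nspL : ~ sparse_language (buchi_language B).
  by move=> sp; apply: nsp; exists L => //; rewrite LB.
have [i [q [p [u0 [v0 [lq pq [uq0 vq0 suv0 ne]]]]]]] := not_sparse_loops nspL.
have [u [v [uq vq suv u0' sep]]] := separated_loops R r1 uq0 vq0 suv0 ne.
have KE : closure (coord_proj i A) = live_values (R := R) (subset_step i) (@subset_live _ _ B)
    (subset_init B).
  by rewrite AE LB closure_coord_proj.
have dK := fdef_closure A i.
have thin (a b : R) : a < b -> exists2 x, a < x < b & ~ closure (coord_proj i A) x.
  exact: hausdorff_dim_lt1_no_interior.
pose x0 := Ordinal (ltn_trans (ltn0Sn 0) r1).
pose g b := wval R p + r%:R ^- size p * nu R (wblocks x0 u v b).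
have gK b : closure (coord_proj i A) (g b).
  rewrite KE; exact: (K_wblocks R (@subset_live_prefix _ _ B i) r1 pq uq vq lq suv u0').
have s0 : 0 < r%:R ^- size p :> R := scale_gt0 R r1 _.
split.
- exists i; exact: (wblocks_dim_gt0 r1 suv u0' sep s0 gK).
- apply: (fdef_not_d_minimal dK thin); exists g; split=> // b b'.
  move=> /addrI /(mulfI (lt0r_neq0 s0)).
  exact: (wblocks_nu_inj r1 suv u0' sep).
- move=> ntp2; have arr := K_array (@subset_live_prefix _ _ B i) (@subset_live_next _ _ B i)
    r1 pq uq vq lq suv u0' sep.
  rewrite -KE in arr.
  have [m [n [phi tp]]] := fdef_array_TP2 dK (arr thin).
  exact: ntp2 tp.
Qed.

Theorem theorem3 (R : realType) (r d : nat) (A : set 'rV[R]_d) :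
  (1 < r)%N -> (1 <= d)%N ->
  regular_set r A ->
  (forall i : 'I_d, (hausdorff_dim (closure (coord_proj i A)) < 1)%E) ->
  [<-> sparse_set r A;
       forall i : 'I_d, hausdorff_dim (closure (coord_proj i A)) = 0%E;
       d_minimal (structure_A A);
       NIP (theory_of (structure_A A));
       NTP2 (theory_of (structure_A A))].
Proof.
move=> r1 _ reg dim1.
have back (P : Prop) : (~ sparse_set r A -> ~ P) -> P -> sparse_set r A.
  by move=> h p; apply: contrapT => /h.
have cantor := not_sparse_cantor r1 reg dim1.
tfae.
- by move=> sp i; exact: (sparse_dim0 r1 i sp).
- move=> dim0; have sp : sparse_set r A.
    by apply: back dim0 => /cantor[[i ne] _ _] dim0; exact: ne.
  by have [rho [rho2 defA]] := sparse_def r1 sp; exact: def_d_minimal defA.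
- move=> dm; have sp : sparse_set r A by apply: back dm => /cantor[].
  by have [rho [rho2 defA]] := sparse_def r1 sp; exact: def_NIP defA.
- exact: NIP_NTP2.
- by apply: back => /cantor[].
Qed.
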